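(* Assume (A1)–(A5), (H1)–(H4) and the subtangential condition $\lim_{h\to0+}\frac1h\, d\Big(e^{-Ah}\varphi(0)+\int_t^{t+h}e^{-A(t+h-s)}B(t,\varphi)\,ds;\ D(t+h)\Big)=0$ for all $(t,\varphi)\in\mathcal{D}$ hold. Let $p:\mathbb{R}\times X\to X$ satisfy $\|p(t,u)-p(s,v)\|\le L_p(|s-t|+\|u-v\|)$ for some $L_p\ge0$ and $\|p(s,u)\|\le C_1\|u\|+C_2$ for some $C_1,C_2\ge0$ and all arguments, and let $G:\mathbb{R}\times X\times X\to X$ satisfy: for each $R>0$ there are $L_{G,R}>0$ and a continuous $\nu_R:[0,\infty)\to[0,\infty)$ with $\nu_R(0)=0$ such that $\|G(t^1,u^1,v^1)-G(t^2,u^2,v^2)\|\le\nu_R(|t^1-t^2|)+L_{G,R}(\|u^1-u^2\|+\|v^1-v^2\|)$ for all $\|u^i\|,\|v^i\|\le R$ and $a\le t^1,t^2\le a+R$. Then for every $\varphi\in C$ the problem $\frac{du}{dt}+Au=B(t,u_t)$, $t\ge a$, $u_a=\varphi$, has a unique mild solution $u$ on an interval of the form $[a,b)$ with $a<b\le+\infty$. If additionally $\varphi\in\mathcal{D}(a)$, then $u(t)\in D(t)$ for $a\le t<b$, and if $b<+\infty$ then $\|u_t\|_C\to\infty$ as $t\to b-0$.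
   Context: Let $X$ be a Banach space with norm $\|\cdot\|$ (also written $|\cdot|$), $r>0$, $a\in\mathbb{R}$, and $C=C([-r,0];X)$ with the supremum norm $\|\cdot\|_C$. For a continuous $u$ on $[a-r,b)$ and $t\in[a,b)$, $u_t(\theta)=u(t+\theta)$, $\theta\in[-r,0]$. Let $A$ be the infinitesimal generator of a compact $C_0$-semigroup $\{e^{-At}\}_{t\ge0}$ on $X$ with $\|e^{-At}\|\le e^{\omega t}$, $t\ge0$, for a fixed $\omega\in\mathbb{R}$. The nonlinearity is $B(t,\psi)=G(t,\psi(0),F(t,\psi))$ with $F(t,\psi)=\int_{-r}^0p(t,\psi(\theta))\,dg(\theta,t,\psi)$ (Stieltjes integral in $\theta$), $g:[-r,0]\times\mathbb{R}\times C\to\mathbb{R}$. (A1): for every $(t,\varphi)$, $g(\cdot,t,\varphi)$ has bounded variation on $[-r,0]$ with $V_{-r}^0g(\cdot,t,\varphi)\le M_{Vg}$, a constant independent of $(t,\varphi)$. Write $g=g_d+g_c$, $g_d(\cdot,t,\varphi)$ the jump (step-function) part and $g_c=g_{ac}+g_s$ the continuous part (absolutely continuous plus singular continuous) of $g(\cdot,t,\varphi)$. (A2): for each $\theta$, $(t,\varphi)\mapsto g_c(\theta,t,\varphi)$ is continuous on $\mathbb{R}\times C$. (A3): the jump points of $g_d(\cdot,t,\varphi)$ are $\theta_k=-\eta_k(t,\varphi)$ with jumps $h_k(t,\varphi)=g_d(\theta_k+0,t,\varphi)-g_d(\theta_k-0,t,\varphi)$, where $\eta_k:\mathbb{R}\times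 C\to[0,r]$ and $h_k:\mathbb{R}\times C\to\mathbb{R}$ are continuous, and $\sum_kh_k(t,\varphi)$ converges absolutely and uniformly on bounded subsets of $\mathbb{R}\times C$. (A4): there is $L_{Vg_c}\ge0$ such that for all $t^1,t^2\ge a$, $\varphi,\psi\in C$, the total variation on $[-r,0]$ of $g_c(\cdot,t^1,\varphi)-g_c(\cdot,t^2,\psi)$ is at most $L_{Vg_c}(|t^1-t^2|+\|\varphi-\psi\|_C)$. (A5): there is a continuous $\eta_{ign}:[a,\infty)\to(0,\infty)$ such that for all $t\ge a$ and $\varphi^1,\varphi^2\in C$ with $\varphi^1=\varphi^2$ on $[-r,-\eta_{ign}(t)]$, one has $\eta_k(t,\varphi^1)=\eta_k(t,\varphi^2)$ and $h_k(t,\varphi^1)=h_k(t,\varphi^2)$ for all $k$. (H1): $D$ is a closed subset of $[a-r,\infty)\times X$ and $D(t)=\{x\in X:(t,x)\in D\}$ is nonempty for each $t\ge a-r$. (H2): $\mathcal{D}=\{(t,\varphi)\in[a,\infty)\times C:\varphi(\theta)\in D(t+\theta)\text{ for all }-r\le\theta\le0\}$ (a closed subset of $[a,\infty)\times C$), $\mathcal{D}(t)=\{\varphi\in C:(t,\varphi)\in\mathcal{D}\}$, and $\mathcal{D}(t)$ is nonempty for each $t\ge a$. (H3): for each $b>a$ there are $\hat K(b)>0$ and a continuous nondecreasing $\eta_b:[0,b-a)\to[0,\infty)$ with $\eta_b(0)=0$ such that whenever $a\le t_1<t_2\le b$, $x_1\in D(t_1)$, $x_2\in D(t_2)$, there is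 a continuous $w:[t_1,t_2]\to X$ with $w(t_1)=x_1$, $w(t_2)=x_2$, $w(t)\in D(t)$ for $t_1<t<t_2$, and $|w(t)-w(s)|\le\eta_b(|t-s|)+\hat K(b)|t-s|\frac{|x_2-x_1|}{t_2-t_1}$ for all $s,t\in[t_1,t_2]$. (H4): $B$ is continuous from a set $D(B)$ into $X$, where $\mathcal{D}\subset D(B)\subset[a,\infty)\times C$. Here $d(x;D(t))=\inf\{|x-y|:y\in D(t)\}$. A mild solution on $[a-r,T]$ is $u\in C([a-r,T];X)$ with $u_a=\varphi$ and $u(t)=e^{-A(t-a)}\varphi(0)+\int_a^te^{-A(t-s)}B(s,u_s)\,ds$ for $t\in[a,T]$; a mild solution on $[a,b)$ is one that is a mild solution on $[a-r,T]$ for each $T\in[a,b)$. *)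

(* Defs.v *)
From Stdlib Require Import Reals.
From Coquelicot Require Import Coquelicot.
Set Implicit Arguments.
Open Scope R_scope.

Fixpoint sumX {V : AbelianMonoid} (f : nat -> V) (n : nat) : V :=
  match n with O => zero | S m => plus (sumX f m) (f m) end.

Definition cont_on {V : NormedModule R_AbsRing} (u : R -> V) (lo hi : R) : Prop :=
  forall x, lo <= x <= hi -> forall eps, 0 < eps -> exists delta, 0 < delta /\
    forall y, lo <= y <= hi -> Rabs (y - x) < delta -> norm (minus (u y) (u x)) < eps.

(* ---------- the phase space C = C([-r,0];X) ----------
   Elements of C are represented by functions R -> X that are continuous on
   [-r,0]; only their restriction to [-r,0] is ever used. *)
Definition isC {X : NormedModule R_AbsRing} (r : R) (phi : R -> X) : Prop :=
  cont_on phi (- r) 0.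

Definition normC {X : NormedModule R_AbsRing} (r : R) (phi : R -> X) : R :=
  real (Lub_Rbar (fun x => exists theta, - r <= theta <= 0 /\ x = norm (phi theta))).

Definition diffC {X : NormedModule R_AbsRing} (phi psi : R -> X) : R -> X :=
  fun theta => minus (phi theta) (psi theta).

Definition seg {X : NormedModule R_AbsRing} (u : R -> X) (t : R) : R -> X :=
  fun theta => u (t + theta).

Definition contRC {X : NormedModule R_AbsRing} (r : R) (f : R -> (R -> X) -> R) : Prop :=
  forall t phi, isC r phi -> forall eps, 0 < eps -> exists delta, 0 < delta /\
    forall s psi, isC r psi -> Rabs (s - t) < delta -> normC r (diffC psi phi) < delta ->
      Rabs (f s psi - f t phi) < eps.

Definition is_partition (lo hi : R) (n : nat) (x : nat -> R) : Prop :=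
  x O = lo /\ x n = hi /\ forall i, (i < n)%nat -> x i <= x (S i).

Definition variation_le (f : R -> R) (lo hi M : R) : Prop :=
  forall n x, is_partition lo hi n x ->
    @sumX R_AbelianMonoid (fun i => Rabs (f (x (S i)) - f (x i))) n <= M.

Definition is_RSInt {X : NormedModule R_AbsRing} (f : R -> X) (g : R -> R)
    (lo hi : R) (v : X) : Prop :=
  forall eps, 0 < eps -> exists delta, 0 < delta /\
    forall n x xi, is_partition lo hi n x ->
      (forall i, (i < n)%nat -> x i <= xi i <= x (S i) /\ x (S i) - x i < delta) ->
      norm (minus (sumX (fun i => scal (g (x (S i)) - g (x i)) (f (xi i))) n) v) < eps.

Definition RSInt {X : CompleteNormedModule R_AbsRing} (f : R -> X) (g : R -> R)
    (lo hi : R) : X :=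
  iota (is_RSInt f g lo hi).

(* ---------- jump (step-function) part of a BV function on [-r,0] ----------
   gd is the jump part with jump points theta_k = - eta k and jumps h k:
   gd(-r) = 0, gd(0) = sum_k h_k, and the one-sided limits of gd are the
   sums of the jumps located strictly to the left (resp. at or to the left). *)
Definition is_jump_part (r : R) (gd : R -> R) (eta h : nat -> R) : Prop :=
  gd (- r) = 0 /\ gd 0 = Series h /\
  (forall theta, - r < theta <= 0 ->
     filterlim gd (at_left theta)
       (locally (Series (fun k => if Rlt_dec (- eta k) theta then h k else 0)))) /\
  (forall theta, - r <= theta < 0 ->
     filterlim gd (at_right theta)
       (locally (Series (fun k => if Rle_dec (- eta k) theta then h k else 0)))).

Definition Ffun {X : CompleteNormedModule R_AbsRing} (r : R) (p : R -> X -> X)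
    (g : R -> R -> (R -> X) -> R) (t : R) (psi : R -> X) : X :=
  RSInt (fun theta => p t (psi theta)) (fun theta => g theta t psi) (- r) 0.

Definition Bfun {X : CompleteNormedModule R_AbsRing} (r : R) (G : R -> X -> X -> X)
    (p : R -> X -> X) (g : R -> R -> (R -> X) -> R) (t : R) (psi : R -> X) : X :=
  G t (psi 0) (Ffun r p g t psi).

Definition compact_op {X : NormedModule R_AbsRing} (T : X -> X) : Prop :=
  forall xs : nat -> X, (exists M, forall n, norm (xs n) <= M) ->
    exists (sub : nat -> nat) (y : X), (forall n, (sub n < sub (S n))%nat) /\
      filterlim (fun n => T (xs (sub n))) eventually (locally y).

(* S t = e^{-At}: a compact C0-semigroup of bounded linear operators with
   ||e^{-At}|| <= e^{omega t} *)
Definition compact_C0_semigroup {X : NormedModule R_AbsRing} (S : R -> X -> X)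
    (omega : R) : Prop :=
  (forall t x y, 0 <= t -> S t (plus x y) = plus (S t x) (S t y)) /\
  (forall t (c : R) x, 0 <= t -> S t (scal c x) = scal c (S t x)) /\
  (forall x, S 0 x = x) /\
  (forall t s x, 0 <= t -> 0 <= s -> S (t + s) x = S t (S s x)) /\
  (forall x, filterlim (fun t => S t x) (at_right 0) (locally x)) /\
  (forall t x, 0 <= t -> norm (S t x) <= exp (omega * t) * norm x) /\
  (forall t, 0 < t -> compact_op (S t)).

Definition distD {X : NormedModule R_AbsRing} (E : X -> Prop) (x : X) : R :=
  real (Glb_Rbar (fun d => exists y, E y /\ d = norm (minus x y))).

Definition calD {X : NormedModule R_AbsRing} (D : R -> X -> Prop) (a r t : R)
    (phi : R -> X) : Prop :=
  a <= t /\ isC r phi /\ forall theta, - r <= theta <= 0 -> D (t + theta) (phi theta).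

Definition mild_sol_on {X : CompleteNormedModule R_AbsRing} (S : R -> X -> X)
    (B : R -> (R -> X) -> X) (r a T : R) (phi : R -> X) (u : R -> X) : Prop :=
  a <= T /\ cont_on u (a - r) T /\
  (forall theta, - r <= theta <= 0 -> u (a + theta) = phi theta) /\
  (forall t, a <= t <= T ->
     is_RInt (fun s => S (t - s) (B s (seg u s))) a t (minus (u t) (S (t - a) (phi 0)))).

Definition mild_sol_ab {X : CompleteNormedModule R_AbsRing} (S : R -> X -> X)
    (B : R -> (R -> X) -> X) (r a : R) (b : Rbar) (phi : R -> X) (u : R -> X) : Prop :=
  forall T, a <= T -> Rbar_lt (Finite T) b -> mild_sol_on S B r a T phi u.

(* Main.v *)
Require Import Defs.
From Stdlib Require Import Reals Lra Lia ZArith Compare_dec List Classical ClassicalEpsilon.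
From Coquelicot Require Import Coquelicot.
Open Scope R_scope.

(** By (A5) the jump positions and jump heights at time [t] depend only on the part of the
    history lying before [t - eta_ign t]. Hence on a short time interval they are the same for
    all candidate solutions with a common past, and there [B] is Lipschitz in the history, the
    continuous part of the integrator being controlled by (A4). The contraction principle
    gives local existence, with a step depending only on the size of the data, and uniqueness;
    so the maximal solution blows up when its life span is finite.

    For the invariance of [D], one builds [D]-valued [eps]-approximate solutions: the
    subtangential condition provides the next node in [D], and (H3) joins it to the previous
    one inside [D]. A chain of such approximations has a limit because, up to an error linear
    in time, the values at the nodes are transported by the semigroup, so the construction can
    be continued up to a time not depending on [eps]. By the Lipschitz property these
    approximations converge to the solution itself as [eps] tends to [0], and [D] is closed. *)

(** * Linear identities in a module *)

(** A term [p t (phi (- eta k t phi))] is continuous in [phi] but in general not Lipschitz, because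
    [phi] itself is merely continuous. [bounded_lip] therefore compares only histories that agree
    before [- eta0], where [eta0] is a positive lower bound of [eta_ign] on a compact time interval,
    and every comparison is made on an interval no longer than [eta0], so that the older part of
    both histories lies in the common past. The [D]-valued approximations share the past of the
    solution too; they are compared with it directly, so their limit needs no separate
    identification. A jump part is known only through its one-sided limits and its values at the two
    endpoints, so integrals are compared along partitions chosen for the purpose. Orbits of the
    semigroup are in general not Lipschitz in time, so plain distances do not control the nodes of
    an approximation. The defect of the variation-of-constants formula does, with the weight [gw],
    thanks to which the defects of successive steps add up without loss. Nodes may accumulate, hence
    they form a set and not a finite list. *)

Inductive vexp : Type :=
  | VAtom : nat -> vexp
  | VZero : vexp
  | VPlus : vexp -> vexp -> vexp
  | VMinus : vexp -> vexp -> vexp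
  | VOpp : vexp -> vexp
  | VScal : R -> vexp -> vexp.

Fixpoint vcoef (e : vexp) (i : nat) : R :=
  match e with
  | VAtom n => if Nat.eqb n i then 1 else 0
  | VZero => 0
  | VPlus e1 e2 => vcoef e1 i + vcoef e2 i
  | VMinus e1 e2 => vcoef e1 i - vcoef e2 i
  | VOpp e => - vcoef e i
  | VScal c e => c * vcoef e i
  end.

Section LinearIdentities.
Context {V : ModuleSpace R_Ring}.

Fixpoint veval (env : list V) (e : vexp) : V :=
  match e with
  | VAtom n => nth n env zero
  | VZero => zero
  | VPlus e1 e2 => plus (veval env e1) (veval env e2)
  | VMinus e1 e2 => minus (veval env e1) (veval env e2)
  | VOpp e => opp (veval env e)
  | VScal c e => scal c (veval env e)
  end.

Fixpoint vcomb (env : list V) (c : nat -> R) : V :=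
  match env with
  | nil => zero
  | x :: l => plus (scal (c O) x) (vcomb l (fun i => c (S i)))
  end.

Lemma vcomb_ext (env : list V) (c d : nat -> R) :
  (forall i, (i < length env)%nat -> c i = d i) -> vcomb env c = vcomb env d.
Proof.
  revert c d; induction env as [|x l IH]; intros c d H; simpl; auto.
  rewrite (H O) by (simpl; lia). f_equal. apply IH.
  intros i Hi; apply H; simpl; lia.
Qed.

Lemma vcomb_plus (env : list V) (c d : nat -> R) :
  vcomb env (fun i => c i + d i) = plus (vcomb env c) (vcomb env d).
Proof.
  revert c d; induction env as [|x l IH]; intros c d; simpl.
  - now rewrite plus_zero_l.
  - rewrite IH. replace (scal (c O + d O) x) with (plus (scal (c O) x) (scal (d O) x))
      by (symmetry; exact (scal_distr_r (c O) (d O) x)).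
    rewrite <- !plus_assoc. f_equal. rewrite !plus_assoc. f_equal. apply plus_comm.
Qed.

Lemma vcomb_scal (env : list V) (k : R) (c : nat -> R) :
  vcomb env (fun i => k * c i) = scal k (vcomb env c).
Proof.
  revert c; induction env as [|x l IH]; intros c; simpl.
  - now rewrite scal_zero_r.
  - rewrite IH, scal_distr_l, scal_assoc. reflexivity.
Qed.

Lemma vcomb_zero (env : list V) (c : nat -> R) : (forall i, c i = 0) -> vcomb env c = zero.
Proof.
  revert c; induction env as [|x l IH]; intros c H; simpl; auto.
  rewrite H, IH by auto. rewrite plus_zero_r. exact (scal_zero_l x).
Qed.

Lemma vcomb_atom (env : list V) (n : nat) :
  vcomb env (fun i => if Nat.eqb n i then 1 else 0) = nth n env zero.
Proof.
  revert n; induction env as [|x l IH]; intros [|n]; simpl; auto.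
  - rewrite vcomb_zero by auto. rewrite plus_zero_r. exact (scal_one x).
  - rewrite IH. transitivity (plus zero (nth n l zero)); [|apply plus_zero_l].
    f_equal. exact (scal_zero_l x).
Qed.

Lemma veval_vcomb (env : list V) (e : vexp) : veval env e = vcomb env (vcoef e).
Proof.
  induction e as [n| |e1 IH1 e2 IH2|e1 IH1 e2 IH2|e IH|k e IH]; simpl.
  - symmetry; apply vcomb_atom.
  - symmetry; apply vcomb_zero; auto.
  - now rewrite IH1, IH2, vcomb_plus.
  - rewrite IH1, IH2. unfold minus.
    transitivity (plus (vcomb env (vcoef e1)) (vcomb env (fun i => (-1) * vcoef e2 i))).
    + f_equal. rewrite vcomb_scal. rewrite <- scal_opp_one. reflexivity.
    + rewrite <- vcomb_plus. apply vcomb_ext; intros; ring.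
  - rewrite IH. transitivity (vcomb env (fun i => (-1) * vcoef e i)).
    + rewrite vcomb_scal. rewrite <- scal_opp_one. reflexivity.
    + apply vcomb_ext; intros; ring.
  - now rewrite IH, vcomb_scal.
Qed.

Fixpoint all_below (n : nat) (P : nat -> Prop) : Prop :=
  match n with O => True | S m => P m /\ all_below m P end.

(** Reflection behind the tactic [vec]: after both sides are expanded over the same atoms, one
    scalar equation per atom remains. The coefficients may contain real variables, so these
    equations are left to real arithmetic. *)
Lemma veval_eq (env : list V) (e1 e2 : vexp) :
  all_below (length env) (fun i => vcoef e1 i = vcoef e2 i) -> veval env e1 = veval env e2.
Proof.
  intros H. rewrite !veval_vcomb. apply vcomb_ext.
  revert H; generalize (length env) as n; induction n as [|n IH]; simpl; intros H i Hi.
  - lia.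
  - destruct H as [H0 H]. destruct (Nat.eq_dec i n) as [->|Hn]; auto. apply IH; auto; lia.
Qed.
End LinearIdentities.

Ltac v_index x env :=
  match env with
  | x :: _ => constr:(O)
  | _ :: ?l => let n := v_index x l in constr:(S n)
  end.
Ltac v_in x env :=
  match env with
  | x :: _ => constr:(true)
  | _ :: ?l => v_in x l
  | nil => constr:(false)
  end.
Ltac v_atoms env e :=
  match e with
  | plus ?a ?b => let env := v_atoms env a in v_atoms env b
  | minus ?a ?b => let env := v_atoms env a in v_atoms env b
  | opp ?a => v_atoms env a
  | scal _ ?a => v_atoms env a
  | zero => env
  | _ => match v_in e env with true => env | false => constr:(e :: env) end
  end.
Ltac v_reify env e :=
  match e with
  | plus ?a ?b => let x := v_reify env a in let y := v_reify env b in constr:(VPlus x y)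
  | minus ?a ?b => let x := v_reify env a in let y := v_reify env b in constr:(VMinus x y)
  | opp ?a => let x := v_reify env a in constr:(VOpp x)
  | scal ?c ?a => let x := v_reify env a in constr:(VScal c x)
  | zero => constr:(VZero)
  | _ => let n := v_index e env in constr:(VAtom n)
  end.
Ltac vec :=
  match goal with
  | |- @eq ?T ?a ?b =>
      let env := v_atoms (@nil T) a in
      let env := v_atoms env b in
      let x := v_reify env a in
      let y := v_reify env b in
      apply (veval_eq env x y); cbn -[Rplus Rmult Rminus Ropp Rinv Rdiv];
      repeat split; try ring; try lra; try (field; lra)
  end.

Ltac case_Rle :=
  repeat match goal with |- context[Rle_dec ?x ?y] => destruct (Rle_dec x y) end.

(* [minus] on a complete normed module elaborates along several canonical-structure paths;
   [lra] needs them syntactically equal. *)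
Ltac vcanon :=
  repeat match goal with
  | H : context [@norm ?K ?V (@minus ?P ?a ?b)] |- _ =>
      lazymatch P with
      | NormedModule.AbelianGroup K V => fail
      | _ => change (@minus P a b) with (@minus (NormedModule.AbelianGroup K V) a b) in H
      end
  | |- context [@norm ?K ?V (@minus ?P ?a ?b)] =>
      lazymatch P with
      | NormedModule.AbelianGroup K V => fail
      | _ => change (@minus P a b) with (@minus (NormedModule.AbelianGroup K V) a b)
      end
  end.
Ltac vlra := first [lra | vcanon; lra].

Lemma pos_min3 (x y z : R) : 0 < x -> 0 < y -> 0 < z ->
  exists d, 0 < d /\ d <= x /\ d <= y /\ d <= z.
Proof.
  intros. exists (Rmin x (Rmin y z)). split; [repeat apply Rmin_pos; auto|].
  pose proof (Rmin_l x (Rmin y z)). pose proof (Rmin_r x (Rmin y z)).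
  pose proof (Rmin_l y z). pose proof (Rmin_r y z). lra.
Qed.

(** * Norm inequalities *)

Section NormBasics.
Context {V : NormedModule R_AbsRing}.

Lemma norm_minus_sym (x y : V) : norm (minus x y) = norm (minus y x).
Proof. rewrite <- (opp_minus x y). symmetry; apply norm_opp. Qed.

Lemma norm_minus_tri (x y z : V) :
  norm (minus x z) <= norm (minus x y) + norm (minus y z).
Proof. rewrite (minus_trans y). apply norm_triangle. Qed.

Lemma norm_minus_le (x y : V) : norm (minus x y) <= norm x + norm y.
Proof. unfold minus. rewrite <- (norm_opp y). apply norm_triangle. Qed.

Lemma norm_minus_eq (e x y : V) : e = minus x y -> norm e <= norm x + norm y.
Proof. intros ->; apply norm_minus_le. Qed.

Lemma norm_minus_zero_le (x : V) : norm (minus x zero) <= norm x.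
Proof. rewrite minus_zero_r. apply Rle_refl. Qed.

Lemma norm_minus_diag (x : V) : norm (minus x x) = 0.
Proof. rewrite minus_eq_zero. apply norm_zero. Qed.

Lemma norm_le_minus (x y : V) : norm x <= norm y + norm (minus x y).
Proof. replace x with (plus y (minus x y)) at 1 by vec. apply norm_triangle. Qed.

Lemma norm_minus_small_eq (x y : V) :
  (forall eps, 0 < eps -> norm (minus x y) <= eps) -> x = y.
Proof.
  intros H.
  assert (E : norm (minus x y) = 0).
  { apply Rle_antisym; [|apply norm_ge_0]. apply le_epsilon. intros e He.
    rewrite Rplus_0_l. now apply H. }
  apply norm_eq_zero in E.
  replace x with (plus y (minus x y)) by vec. rewrite E. apply plus_zero_r.
Qed.

Lemma norm_scal_Rabs (c : R) (x : V) : norm (scal c x) <= Rabs c * norm x.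
Proof. exact (norm_scal c x). Qed.

Lemma norm_scal_eq (e : V) (c : R) (x : V) : e = scal c x -> norm e <= Rabs c * norm x.
Proof. intros ->; apply norm_scal_Rabs. Qed.

Lemma norm_plus2 (e x y : V) : e = plus x y -> norm e <= norm x + norm y.
Proof. intros ->; apply norm_triangle. Qed.

Lemma norm_plus3 (e x y z : V) : e = plus x (plus y z) -> norm e <= norm x + norm y + norm z.
Proof.
  intros ->. eapply Rle_trans; [apply norm_triangle|].
  pose proof (norm_triangle y z). lra.
Qed.

(** * Epsilon-delta continuity *)

Lemma continuous_eps (f : R -> V) (x : R) :
  continuous f x <->
  forall eps, 0 < eps -> exists delta, 0 < delta /\
    forall y, Rabs (y - x) < delta -> norm (minus (f y) (f x)) < eps.
Proof.
  split.
  - intros H eps He.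
    pose proof (proj1 (filterlim_locally_ball_norm f (f x)) H (mkposreal eps He)) as [d Hd].
    exists d; split; [apply cond_pos|]. intros y Hy. apply (Hd y). exact Hy.
  - intros H. apply (proj2 (filterlim_locally_ball_norm f (f x))). intros eps.
    destruct (H eps (cond_pos eps)) as [d [Hd Hy]].
    exists (mkposreal d Hd). intros y By. apply Hy. exact By.
Qed.

Lemma seq_lim_eps (f : nat -> V) (l : V) :
  filterlim f eventually (locally l) <->
  forall eps, 0 < eps -> exists N, forall n, (N <= n)%nat -> norm (minus (f n) l) < eps.
Proof.
  split.
  - intros H eps He.
    destruct (proj1 (filterlim_locally_ball_norm f l) H (mkposreal eps He)) as [N HN].
    exists N. intros n Hn. exact (HN n Hn).
  - intros H. apply (proj2 (filterlim_locally_ball_norm f l)). intros eps.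
    destruct (H eps (cond_pos eps)) as [N HN]. exists N. intros n Hn. exact (HN n Hn).
Qed.

Lemma at_right_eps (f : R -> V) (x : R) (l : V) :
  filterlim f (at_right x) (locally l) <->
  forall eps, 0 < eps -> exists delta, 0 < delta /\
    forall y, x < y < x + delta -> norm (minus (f y) l) < eps.
Proof.
  split.
  - intros H eps He.
    destruct (proj1 (filterlim_locally_ball_norm f l) H (mkposreal eps He)) as [d Hd].
    exists d; split; [apply cond_pos|]. intros y Hy. apply (Hd y); [|lra].
    change (Rabs (y - x) < d). rewrite Rabs_right; lra.
  - intros H. apply (proj2 (filterlim_locally_ball_norm f l)). intros eps.
    destruct (H eps (cond_pos eps)) as [d [Hd Hy]].
    exists (mkposreal d Hd). intros y By Hxy. apply Hy.
    change (Rabs (y - x) < d) in By. apply Rabs_def2 in By. lra.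
Qed.

(** The projection onto [[lo, hi]]. Composing with it turns a function continuous on a compact
    interval into one continuous on the whole line, frozen outside the interval. *)
Definition clamp (lo hi x : R) : R := Rmax lo (Rmin hi x).

Lemma clamp_in (lo hi x : R) : lo <= hi -> lo <= clamp lo hi x <= hi.
Proof.
  intros; unfold clamp, Rmin; case_Rle; unfold Rmax; case_Rle; lra.
Qed.

Lemma clamp_id (lo hi x : R) : lo <= x <= hi -> clamp lo hi x = x.
Proof.
  intros; unfold clamp, Rmin; case_Rle; unfold Rmax; case_Rle; lra.
Qed.

Lemma clamp_lo (lo hi x : R) : lo <= hi -> x <= lo -> clamp lo hi x = lo.
Proof.
  intros; unfold clamp, Rmin; case_Rle; unfold Rmax; case_Rle; lra.
Qed.

Lemma clamp_hi (lo hi x : R) : lo <= hi -> hi <= x -> clamp lo hi x = hi.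
Proof.
  intros; unfold clamp, Rmin; case_Rle; unfold Rmax; case_Rle; lra.
Qed.

Lemma clamp_le (lo hi x y : R) : x <= y -> clamp lo hi x <= clamp lo hi y.
Proof.
  intros; unfold clamp, Rmin; case_Rle; unfold Rmax; case_Rle; lra.
Qed.

Lemma clamp_lip (lo hi x y : R) : Rabs (clamp lo hi y - clamp lo hi x) <= Rabs (y - x).
Proof.
  unfold clamp, Rmin; case_Rle; unfold Rmax; case_Rle;
  unfold Rabs; repeat match goal with |- context[Rcase_abs ?x] => destruct (Rcase_abs x) end; lra.
Qed.

Lemma cont_on_clamp (u : R -> V) (lo hi : R) :
  lo <= hi -> cont_on u lo hi -> forall x, continuous (fun y => u (clamp lo hi y)) x.
Proof.
  intros Hl Hu x. apply continuous_eps. intros eps He.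
  destruct (Hu (clamp lo hi x) (clamp_in lo hi x Hl) eps He) as [d [Hd H]].
  exists d; split; auto. intros y Hy. apply H.
  - now apply clamp_in.
  - eapply Rle_lt_trans; [apply clamp_lip|exact Hy].
Qed.

Lemma continuous_cont_on (u : R -> V) (lo hi : R) :
  (forall x, lo <= x <= hi -> continuous u x) -> cont_on u lo hi.
Proof.
  intros Hu x Hx eps He.
  destruct (proj1 (continuous_eps u x) (Hu x Hx) eps He) as [d [Hd H]].
  exists d; split; auto.
Qed.

Lemma cont_on_ext (u v : R -> V) (lo hi : R) :
  (forall x, lo <= x <= hi -> u x = v x) -> cont_on u lo hi -> cont_on v lo hi.
Proof.
  intros E Hu x Hx eps He. destruct (Hu x Hx eps He) as [d [Hd H]].
  exists d; split; auto. intros y Hy Hyx. rewrite <- !E by auto. auto.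
Qed.

Lemma cont_on_unif (u : R -> V) (lo hi : R) :
  cont_on u lo hi -> forall eps, 0 < eps -> exists delta, 0 < delta /\
    forall x y, lo <= x <= hi -> lo <= y <= hi -> Rabs (y - x) < delta ->
      norm (minus (u y) (u x)) < eps.
Proof.
  intros Hu eps He. destruct (Rle_dec lo hi) as [Hl|Hl].
  - destruct (unifcont_normed_1d (fun y => u (clamp lo hi y)) lo hi
      (fun x _ => cont_on_clamp u lo hi Hl Hu x) (mkposreal eps He)) as [d Hd].
    exists d; split; [apply cond_pos|]. intros x y Hx Hy Hxy.
    specialize (Hd x y Hx Hy Hxy). unfold ball_norm in Hd.
    rewrite !clamp_id in Hd by auto. exact Hd.
  - exists 1; split; [lra|]. intros x y Hx; lra.
Qed.

Lemma cont_on_bounded (u : R -> V) (lo hi : R) :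
  cont_on u lo hi -> exists M, 0 <= M /\ forall x, lo <= x <= hi -> norm (u x) <= M.
Proof.
  intros Hu. destruct (Rle_dec lo hi) as [Hl|Hl].
  - destruct (bounded_continuity (fun y => u (clamp lo hi y)) lo hi) as [M HM].
    { intros x _. apply (cont_on_clamp u lo hi Hl Hu x). }
    assert (HB : forall x, lo <= x <= hi -> norm (u x) <= M).
    { intros x Hx. specialize (HM x Hx). rewrite clamp_id in HM by auto. lra. }
    exists M; split; auto. apply Rle_trans with (norm (u lo)); [apply norm_ge_0|apply HB; lra].
  - exists 0; split; [lra|]. intros x Hx; lra.
Qed.

Lemma cont_on_minus (u v : R -> V) (lo hi : R) :
  cont_on u lo hi -> cont_on v lo hi -> cont_on (fun x => minus (u x) (v x)) lo hi.
Proof.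
  intros Hu Hv x Hx eps He.
  destruct (Hu x Hx (eps/2) ltac:(lra)) as [d1 [Hd1 H1]].
  destruct (Hv x Hx (eps/2) ltac:(lra)) as [d2 [Hd2 H2]].
  exists (Rmin d1 d2); split; [now apply Rmin_pos|]. intros y Hy Hyx.
  assert (Rabs (y - x) < d1) by (eapply Rlt_le_trans; [exact Hyx|apply Rmin_l]).
  assert (Rabs (y - x) < d2) by (eapply Rlt_le_trans; [exact Hyx|apply Rmin_r]).
  eapply Rle_lt_trans.
  - apply (norm_plus2 _ (minus (u y) (u x)) (minus (v x) (v y))). vec.
  - rewrite (norm_minus_sym (v x)). specialize (H1 y Hy H); specialize (H2 y Hy H0). lra.
Qed.

(** * The phase space *)

Lemma normC_le (r : R) (phi : R -> V) (c : R) :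
  0 <= r -> (forall th, - r <= th <= 0 -> norm (phi th) <= c) -> normC r phi <= c.
Proof.
  intros Hr H. unfold normC.
  set (E := fun x => exists th, - r <= th <= 0 /\ x = norm (phi th)).
  destruct (Lub_Rbar_correct E) as [Hub Hlub].
  (* A nonempty set excludes the supremum [m_infty], whose [real] would be a meaningless 0. *)
  assert (H0 : E (norm (phi 0))) by (exists 0; split; [lra|auto]).
  assert (Hc : Rbar_le (Lub_Rbar E) c).
  { apply Hlub. intros x [th [Hth ->]]. simpl. auto. }
  specialize (Hub _ H0). destruct (Lub_Rbar E) as [l| |]; simpl in *; auto.
  - contradiction.
  - contradiction.
Qed.

Lemma normC_ge (r : R) (phi : R -> V) (th : R) :
  isC r phi -> - r <= th <= 0 -> norm (phi th) <= normC r phi.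
Proof.
  intros Hphi Hth. unfold normC.
  set (E := fun x => exists th, - r <= th <= 0 /\ x = norm (phi th)).
  destruct (Lub_Rbar_correct E) as [Hub Hlub].
  destruct (cont_on_bounded phi (-r) 0 Hphi) as [M [_ HM]].
  assert (Hc : Rbar_le (Lub_Rbar E) M).
  { apply Hlub. intros x [t [Ht ->]]. simpl. auto. }
  assert (H0 : E (norm (phi th))) by (exists th; auto).
  specialize (Hub _ H0). destruct (Lub_Rbar E) as [l| |]; simpl in *; auto; contradiction.
Qed.

Lemma normC_ge_0 (r : R) (phi : R -> V) : 0 <= r -> isC r phi -> 0 <= normC r phi.
Proof.
  intros Hr H. apply Rle_trans with (norm (phi 0)); [apply norm_ge_0|apply normC_ge; auto; lra].
Qed.

Lemma isC_diffC (r : R) (phi psi : R -> V) : isC r phi -> isC r psi -> isC r (diffC phi psi).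
Proof. intros; now apply cont_on_minus. Qed.

Lemma isC_seg (r : R) (u : R -> V) (t : R) : (forall x, continuous u x) -> isC r (seg u t).
Proof.
  intros H x Hx eps He.
  destruct (proj1 (continuous_eps u (t + x)) (H _) eps He) as [d [Hd Hy]].
  exists d; split; auto. intros y _ Hyx. apply Hy. replace (t + y - (t + x)) with (y - x) by ring.
  auto.
Qed.

Lemma isC_seg_cont_on (r : R) (u : R -> V) (lo hi t : R) :
  cont_on u lo hi -> lo <= t - r -> t <= hi -> isC r (seg u t).
Proof.
  intros H H1 H2 x Hx eps He.
  destruct (H (t + x) ltac:(lra) eps He) as [d [Hd Hy]].
  exists d; split; auto. intros y Hyr Hyx. apply Hy; [lra|].
  replace (t + y - (t + x)) with (y - x) by ring. auto.
Qed.

(** Uniform continuity of [u] on [[t - r - 1, t + 1]], which contains the windows of all nearby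
    times. *)
Lemma seg_continuous (r : R) (u : R -> V) (t : R) :
  0 <= r -> (forall x, continuous u x) -> forall eps, 0 < eps -> exists delta, 0 < delta /\
    forall s, Rabs (s - t) < delta -> normC r (diffC (seg u s) (seg u t)) < eps.
Proof.
  intros Hr Hu eps He.
  destruct (cont_on_unif u (t - r - 1) (t + 1)
    (continuous_cont_on u _ _ (fun x _ => Hu x)) (eps/2) ltac:(lra)) as [d [Hd H]].
  exists (Rmin 1 d); split; [apply Rmin_pos; lra|]. intros s Hs.
  assert (H1 : Rabs (s - t) < 1) by (eapply Rlt_le_trans; [exact Hs|apply Rmin_l]).
  assert (H2 : Rabs (s - t) < d) by (eapply Rlt_le_trans; [exact Hs|apply Rmin_r]).
  apply Rabs_def2 in H1.
  apply Rle_lt_trans with (eps/2); [|lra]. apply normC_le; auto. intros th Hth.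
  unfold diffC, seg. left. apply H; try lra.
  replace (s + th - (t + th)) with (s - t) by ring. auto.
Qed.
End NormBasics.

(** * Finite sums *)

Definition rsum (f : nat -> R) (n : nat) : R := @sumX R_AbelianMonoid f n.

Lemma sumX_ext {V : AbelianMonoid} (f g : nat -> V) (n : nat) :
  (forall i, (i < n)%nat -> f i = g i) -> sumX f n = sumX g n.
Proof.
  induction n as [|n IH]; intros H; simpl; auto.
  rewrite IH by (intros; apply H; lia). now rewrite H by lia.
Qed.

Lemma sumX_split {V : AbelianMonoid} (f : nat -> V) (n m : nat) :
  sumX f (n + m) = plus (sumX f n) (sumX (fun k => f (n + k)%nat) m).
Proof.
  induction m as [|m IH]; simpl.
  - rewrite Nat.add_0_r. now rewrite plus_zero_r.
  - rewrite Nat.add_succ_r. simpl. rewrite IH. now rewrite plus_assoc.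
Qed.

Lemma rsum_ext (f g : nat -> R) (n : nat) :
  (forall i, (i < n)%nat -> f i = g i) -> rsum f n = rsum g n.
Proof. exact (sumX_ext f g n). Qed.

Lemma rsum_0 (f : nat -> R) : rsum f O = 0.
Proof. reflexivity. Qed.

Lemma rsum_S (f : nat -> R) (n : nat) : rsum f (S n) = rsum f n + f n.
Proof. reflexivity. Qed.

Lemma rsum_le (f g : nat -> R) (n : nat) :
  (forall i, (i < n)%nat -> f i <= g i) -> rsum f n <= rsum g n.
Proof.
  induction n as [|n IH]; intros H; [rewrite !rsum_0; lra|]. rewrite !rsum_S.
  apply Rplus_le_compat; [apply IH; intros; apply H; lia|apply H; lia].
Qed.

Lemma rsum_plus (f g : nat -> R) (n : nat) :
  rsum (fun i => f i + g i) n = rsum f n + rsum g n.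
Proof.
  induction n as [|n IH]; [rewrite ?rsum_0; simpl; ring|]. rewrite !rsum_S, IH. ring.
Qed.

Lemma rsum_scal (c : R) (f : nat -> R) (n : nat) : rsum (fun i => c * f i) n = c * rsum f n.
Proof.
  induction n as [|n IH]; [rewrite ?rsum_0; simpl; ring|]. rewrite !rsum_S, IH. ring.
Qed.

Lemma rsum_const (c : R) (n : nat) : rsum (fun _ => c) n = INR n * c.
Proof.
  induction n as [|n IH]; [rewrite ?rsum_0; simpl; ring|].
  rewrite rsum_S, IH, S_INR. ring.
Qed.

Lemma rsum_telescope (v : nat -> R) (n : nat) : rsum (fun i => v (S i) - v i) n = v n - v O.
Proof.
  induction n as [|n IH]; [rewrite ?rsum_0; simpl; ring|]. rewrite rsum_S, IH. ring.
Qed.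

Lemma rsum_ge_0 (f : nat -> R) (n : nat) : (forall i, (i < n)%nat -> 0 <= f i) -> 0 <= rsum f n.
Proof.
  intros H. apply Rle_trans with (rsum (fun _ => 0) n); [rewrite rsum_const; lra|].
  now apply rsum_le.
Qed.

Lemma rsum_sum_n (f : nat -> R) (n : nat) : rsum f (S n) = sum_n f n.
Proof.
  induction n as [|n IH].
  - rewrite sum_O, rsum_S, rsum_0. ring.
  - rewrite sum_Sn, <- IH. reflexivity.
Qed.

Section Sums.
Context {V : NormedModule R_AbsRing}.

(* [sumX] with the canonical-structure path to the monoid of [V] fixed. *)
Definition vsum (f : nat -> V) (n : nat) : V := sumX f n.

Lemma vsum_0 (f : nat -> V) : vsum f O = zero.
Proof. reflexivity. Qed.

Lemma vsum_S (f : nat -> V) (n : nat) : vsum f (S n) = plus (vsum f n) (f n).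
Proof. reflexivity. Qed.

Lemma vsum_ext (f g : nat -> V) (n : nat) :
  (forall i, (i < n)%nat -> f i = g i) -> vsum f n = vsum g n.
Proof. exact (sumX_ext f g n). Qed.

Lemma vsum_split (f : nat -> V) (n m : nat) :
  vsum f (n + m) = plus (vsum f n) (vsum (fun k => f (n + k)%nat) m).
Proof. exact (sumX_split f n m). Qed.

Lemma vsum_norm (f : nat -> V) (n : nat) : norm (vsum f n) <= rsum (fun i => norm (f i)) n.
Proof.
  induction n as [|n IH].
  - rewrite vsum_0, norm_zero. apply Rle_refl.
  - rewrite rsum_S, vsum_S. eapply Rle_trans; [apply norm_triangle|].
    now apply Rplus_le_compat_r.
Qed.

Lemma vsum_plus (f g : nat -> V) (n : nat) :
  vsum (fun i => plus (f i) (g i)) n = plus (vsum f n) (vsum g n).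
Proof.
  induction n as [|n IH]; [rewrite !vsum_0; vec|]. rewrite !vsum_S, IH. vec.
Qed.

Lemma vsum_minus (f g : nat -> V) (n : nat) :
  vsum (fun i => minus (f i) (g i)) n = minus (vsum f n) (vsum g n).
Proof.
  induction n as [|n IH]; [rewrite !vsum_0; vec|]. rewrite !vsum_S, IH. vec.
Qed.

Lemma vsum_scal_r (c : nat -> R) (x : V) (n : nat) :
  vsum (fun i => scal (c i) x) n = scal (rsum c n) x.
Proof.
  induction n as [|n IH]; [rewrite vsum_0, rsum_0; vec|].
  rewrite rsum_S, vsum_S, IH. vec.
Qed.

Lemma vsum_scal_l (c : R) (f : nat -> V) (n : nat) :
  vsum (fun i => scal c (f i)) n = scal c (vsum f n).
Proof.
  induction n as [|n IH]; [rewrite !vsum_0; vec|]. rewrite !vsum_S, IH. vec.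
Qed.

Lemma vsum_swap (f : nat -> nat -> V) (n m : nat) :
  vsum (fun i => vsum (fun j => f i j) m) n = vsum (fun j => vsum (fun i => f i j) n) m.
Proof.
  induction n as [|n IH].
  - induction m as [|m IH]; [reflexivity|]. rewrite vsum_S, <- IH. rewrite !vsum_0. vec.
  - rewrite vsum_S, IH, <- vsum_plus. reflexivity.
Qed.
End Sums.

Lemma nat_choice {A : Type} (P : nat -> A -> Prop) :
  (forall n, exists y, P n y) -> exists f, forall n, P n (f n).
Proof.
  intros H.
  exists (fun n => proj1_sig (constructive_indefinite_description _ (H n))).
  intros n. apply proj2_sig.
Qed.

Lemma cauchy_seq_lim {X : CompleteNormedModule R_AbsRing} (s : nat -> X) :
  (forall eps, 0 < eps -> exists N, forall n m, (N <= n)%nat -> (N <= m)%nat ->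
     norm (minus (s n) (s m)) < eps) ->
  exists l, filterlim s eventually (locally l).
Proof.
  intros H. apply (proj1 (filterlim_locally_cauchy (F := eventually) s)).
  intros eps. destruct (H eps (cond_pos eps)) as [N HN].
  exists (fun n => (N <= n)%nat). split.
  - exists N; auto.
  - intros u v Hu Hv. apply (norm_compat1 (s u) (s v) eps). apply HN; auto.
Qed.

(** * Riemann-Stieltjes integrals against functions of bounded variation *)

(** The model for [v] is the variation function of [g]. Bounds by increments of [v] telescope over a
    partition, which replaces all handling of total variations. *)
Definition dominates (v g : R -> R) (lo hi : R) : Prop :=
  forall x y, lo <= x -> x <= y -> y <= hi -> Rabs (g y - g x) <= v y - v x.

Lemma dominates_ge_0 (v g : R -> R) (lo hi : R) :
  lo <= hi -> dominates v g lo hi -> 0 <= v hi - v lo.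
Proof.
  intros Hl H. eapply Rle_trans; [apply Rabs_pos|apply (H lo hi); lra].
Qed.

Lemma partition_range (lo hi : R) (n : nat) (x : nat -> R) :
  is_partition lo hi n x -> forall i, (i <= n)%nat -> lo <= x i <= hi.
Proof.
  intros [H0 [Hn Hi]].
  assert (L : forall i, (i <= n)%nat -> lo <= x i).
  { induction i as [|i IH]; intros Hin; [lra|]. specialize (IH ltac:(lia)).
    specialize (Hi i ltac:(lia)). lra. }
  assert (U : forall k, (k <= n)%nat -> x (n - k)%nat <= hi).
  { induction k as [|k IH]; intros Hk; [rewrite Nat.sub_0_r; lra|].
    specialize (IH ltac:(lia)). specialize (Hi (n - S k)%nat ltac:(lia)).
    replace (S (n - S k)) with (n - k)%nat in Hi by lia. lra. }
  intros i Hin; split; auto. replace i with (n - (n - i))%nat by lia. apply U. lia.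
Qed.

(** The witness is the variation function: [v x] is the supremum of the variation sums of [g] over
    partitions of [[lo, x]]. *)
Lemma variation_dominated (g : R -> R) (lo hi M : R) :
  lo <= hi -> variation_le g lo hi M ->
  exists v, dominates v g lo hi /\ v hi - v lo <= M.
Proof.
  intros Hl Hv.
  set (E := fun x s => exists n p, is_partition lo x n p /\
    s = rsum (fun i => Rabs (g (p (S i)) - g (p i))) n).
  set (v := fun x => real (Lub_Rbar (E x))).
  (* Appending [y] to a partition of [[lo, x]] adds exactly one increment; this gives both the
     domination and, with [y = hi], the finiteness of the supremum. *)
  assert (Happ : forall x y s, lo <= x -> x <= y -> E x s -> E y (s + Rabs (g y - g x))).
  { intros x y s H1 H2 [n [p [[P0 [Pn Pi]] ->]]].
    exists (S n), (fun i => if le_dec i n then p i else y). split.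
    - split; [|split].
      + destruct (le_dec 0 n); [auto|lia].
      + destruct (le_dec (S n) n); [lia|auto].
      + intros i Hi. destruct (le_dec i n); [|lia].
        destruct (le_dec (S i) n); [apply Pi; lia|].
        replace i with n by lia. lra.
    - rewrite rsum_S. f_equal.
      + apply rsum_ext. intros i Hi. destruct (le_dec i n); [|lia].
        destruct (le_dec (S i) n); [auto|lia].
      + destruct (le_dec (S n) n); [lia|]. destruct (le_dec n n); [|lia]. now rewrite Pn. }
  assert (Hbd : forall x s, lo <= x -> x <= hi -> E x s -> s <= M).
  { intros x s H1 H2 Hs. destruct (Happ x hi s H1 H2 Hs) as [n [p [Hp Es]]].
    pose proof (Hv n p Hp) as H3.
    fold (rsum (fun i => Rabs (g (p (S i)) - g (p i))) n) in H3. rewrite <- Es in H3.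
    pose proof (Rabs_pos (g hi - g x)). lra. }
  assert (Hne : forall x, lo <= x -> exists s, 0 <= s /\ E x s).
  { intros x Hx. exists (0 + Rabs (g x - g lo)). split.
    - pose proof (Rabs_pos (g x - g lo)); lra.
    - apply Happ; try lra. exists O, (fun _ => lo). split; [|reflexivity].
      repeat split; auto. intros i Hi; lia. }
  assert (Hlub : forall x, lo <= x -> x <= hi ->
    (forall s, E x s -> s <= v x) /\ (forall c, (forall s, E x s -> s <= c) -> v x <= c)).
  { intros x H1 H2. unfold v. destruct (Lub_Rbar_correct (E x)) as [Hub Hlb].
    destruct (Hne x H1) as [s0 [_ Hs0]].
    assert (HM : Rbar_le (Lub_Rbar (E x)) M).
    { apply Hlb. intros s Hs. apply (Hbd x s); auto. }
    pose proof (Hub s0 Hs0) as H0.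
    destruct (Lub_Rbar (E x)) as [l| |]; simpl in *; try contradiction.
    split.
    - intros s Hs. exact (Hub s Hs).
    - intros c Hc. apply (Hlb (Finite c)). intros s Hs. apply Hc; auto. }
  exists v. split.
  - intros x y H1 H2 H3.
    cut (v x <= v y - Rabs (g y - g x)); [lra|].
    apply (proj2 (Hlub x H1 ltac:(lra))). intros s Hs.
    pose proof (proj1 (Hlub y ltac:(lra) H3) _ (Happ x y s H1 H2 Hs)). lra.
  - assert (v hi <= M).
    { apply (proj2 (Hlub hi Hl ltac:(lra))). intros s Hs. apply (Hbd hi s); auto; lra. }
    destruct (Hne lo ltac:(lra)) as [s [Hs0 Hs]].
    pose proof (proj1 (Hlub lo ltac:(lra) Hl) s Hs). lra.
Qed.

Definition tagged (lo hi delta : R) (n : nat) (x xi : nat -> R) : Prop :=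
  is_partition lo hi n x /\
  forall i, (i < n)%nat -> x i <= xi i <= x (S i) /\ x (S i) - x i < delta.

Lemma archimed_inv (c d : R) : 0 < d -> exists n : nat, (1 <= n)%nat /\ c / INR n < d.
Proof.
  intros Hd. destruct (archimed (c / d)) as [H _].
  set (n := Z.to_nat (Z.max 1 (up (c / d)))).
  assert (Hn : (1 <= n)%nat) by (unfold n; lia).
  assert (Hle : IZR (up (c/d)) <= INR n).
  { unfold n. rewrite INR_IZR_INZ. apply IZR_le. rewrite Z2Nat.id; lia. }
  exists n; split; auto.
  assert (Hp : 0 < INR n) by (apply lt_0_INR; lia).
  apply Rmult_lt_reg_r with (INR n); auto.
  unfold Rdiv. rewrite Rmult_assoc, Rinv_l, Rmult_1_r by lra.
  apply Rmult_lt_reg_r with (/ d); [now apply Rinv_0_lt_compat|].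
  replace (d * INR n * / d) with (INR n) by (field; lra). unfold Rdiv in *. lra.
Qed.

Definition upart (lo hi : R) (n : nat) (i : nat) : R := lo + INR i * ((hi - lo) / INR n).

Lemma upart_step (lo hi : R) (n i : nat) :
  upart lo hi n (S i) - upart lo hi n i = (hi - lo) / INR n.
Proof. unfold upart. rewrite S_INR. ring. Qed.

Lemma upart_partition (lo hi : R) (n : nat) :
  lo <= hi -> (1 <= n)%nat -> is_partition lo hi n (upart lo hi n).
Proof.
  intros Hl Hn. assert (Hp : 0 < INR n) by (apply lt_0_INR; lia).
  split; [|split].
  - unfold upart. simpl. ring.
  - unfold upart. field. lra.
  - intros i _. pose proof (upart_step lo hi n i).
    assert (0 <= (hi - lo) / INR n) by (apply Rdiv_le_0_compat; lra). lra.
Qed.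

Lemma upart_tagged (lo hi d : R) (n : nat) :
  lo <= hi -> (1 <= n)%nat -> (hi - lo) / INR n < d ->
  tagged lo hi d n (upart lo hi n) (upart lo hi n).
Proof.
  intros Hl Hn Hd. pose proof (upart_partition lo hi n Hl Hn) as Hp.
  split; auto. intros i Hi. pose proof (proj2 (proj2 Hp) i Hi).
  rewrite upart_step. lra.
Qed.

(** If two cells meet, the projected endpoints are the ends of their intersection, whichever cell
    one projects onto; otherwise both projections collapse to a point. Either way the increment over
    the intersection is symmetric in the two cells. *)
Lemma clamp_overlap (x0 x1 y0 y1 : R) : x0 <= x1 -> y0 <= y1 ->
  (clamp x0 x1 y1 = clamp y0 y1 x1 /\ clamp x0 x1 y0 = clamp y0 y1 x0 /\ x0 <= y1 /\ y0 <= x1) \/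
  (clamp x0 x1 y1 = clamp x0 x1 y0 /\ clamp y0 y1 x1 = clamp y0 y1 x0).
Proof.
  intros Hx Hy. unfold clamp, Rmin; case_Rle; unfold Rmax; case_Rle; lra.
Qed.

Section RiemannStieltjes.
Context {X : NormedModule R_AbsRing}.

Definition RSsum (f : R -> X) (g : R -> R) (n : nat) (x xi : nat -> R) : X :=
  vsum (fun i => scal (g (x (S i)) - g (x i)) (f (xi i))) n.

(* The increments of [g] over the intersections of the cells of the two partitions are written
   with [clamp], which makes both row and column sums telescope; this replaces a common
   refinement. *)
Lemma RSsum_close (f : R -> X) (g v : R -> R) (lo hi delta om : R) n x xi m y zeta :
  dominates v g lo hi -> 0 <= om ->
  (forall s t, lo <= s <= hi -> lo <= t <= hi -> Rabs (s - t) < 2 * delta ->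
     norm (minus (f s) (f t)) <= om) ->
  tagged lo hi delta n x xi -> tagged lo hi delta m y zeta ->
  norm (minus (RSsum f g n x xi) (RSsum f g m y zeta)) <= om * (v hi - v lo).
Proof.
  intros Hdom Hom Huc [Hx Hxi] [Hy Hze].
  set (D := fun (k : R -> R) i j =>
    k (clamp (x i) (x (S i)) (y (S j))) - k (clamp (x i) (x (S i)) (y j))).
  assert (Rx : forall i, (i <= n)%nat -> lo <= x i <= hi) by exact (partition_range _ _ _ _ Hx).
  assert (Ry : forall i, (i <= m)%nat -> lo <= y i <= hi) by exact (partition_range _ _ _ _ Hy).
  pose proof Hx as [X0 [Xn Xi]]. pose proof Hy as [Y0 [Ym Yi]].
  assert (Row : forall k i, (i < n)%nat -> rsum (D k i) m = k (x (S i)) - k (x i)).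
  { intros k i Hi. unfold D.
    rewrite (rsum_telescope (fun j => k (clamp (x i) (x (S i)) (y j)))).
    rewrite Y0, Ym. specialize (Xi i Hi).
    pose proof (Rx i ltac:(lia)). pose proof (Rx (S i) ltac:(lia)).
    rewrite clamp_hi, clamp_lo by lra. ring. }
  assert (Col : forall k j, (j < m)%nat -> rsum (fun i => D k i j) n = k (y (S j)) - k (y j)).
  { intros k j Hj.
    transitivity (rsum (fun i => k (clamp (y j) (y (S j)) (x (S i))) -
                               k (clamp (y j) (y (S j)) (x i))) n).
    - apply rsum_ext. intros i Hi. unfold D.
      destruct (clamp_overlap (x i) (x (S i)) (y j) (y (S j)) (Xi i Hi) (Yi j Hj))
        as [[-> [-> _]]|[-> ->]]; [reflexivity|ring].
    - rewrite (rsum_telescope (fun i => k (clamp (y j) (y (S j)) (x i)))).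
      rewrite X0, Xn. specialize (Yi j Hj).
      pose proof (Ry j ltac:(lia)). pose proof (Ry (S j) ltac:(lia)).
      rewrite clamp_hi, clamp_lo by lra. ring. }
  assert (E1 : RSsum f g n x xi = vsum (fun i => vsum (fun j => scal (D g i j) (f (xi i))) m) n).
  { unfold RSsum. apply vsum_ext. intros i Hi. rewrite vsum_scal_r. now rewrite Row. }
  assert (E2 : RSsum f g m y zeta = vsum (fun i => vsum (fun j => scal (D g i j) (f (zeta j))) m) n).
  { rewrite (vsum_swap (fun i j => scal (D g i j) (f (zeta j)))). unfold RSsum. apply vsum_ext. intros j Hj.
    cbv beta. rewrite (vsum_scal_r (fun i => D g i j)). now rewrite Col. }
  rewrite E1, E2, <- vsum_minus.
  eapply Rle_trans; [apply vsum_norm|].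
  apply Rle_trans with (rsum (fun i => om * (v (x (S i)) - v (x i))) n).
  - apply rsum_le. intros i Hi. rewrite <- vsum_minus.
    eapply Rle_trans; [apply vsum_norm|].
    rewrite <- Row by auto. rewrite <- rsum_scal. apply rsum_le. intros j Hj.
    eapply Rle_trans;
      [apply (norm_scal_eq _ (D g i j) (minus (f (xi i)) (f (zeta j)))); vec|].
    pose proof (Rx i ltac:(lia)) as R1. pose proof (Rx (S i) ltac:(lia)) as R2.
    pose proof (Ry j ltac:(lia)) as R3. pose proof (Ry (S j) ltac:(lia)) as R4.
    pose proof (Xi i Hi) as L1. pose proof (Yi j Hj) as L2.
    destruct (Hxi i Hi) as [T1 T2]. destruct (Hze j Hj) as [T3 T4].
    pose proof (clamp_in (x i) (x (S i)) (y (S j)) L1) as C1.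
    pose proof (clamp_in (x i) (x (S i)) (y j) L1) as C2.
    pose proof (clamp_le (x i) (x (S i)) (y j) (y (S j)) L2) as C3.
    assert (Hd : Rabs (D g i j) <= D v i j) by (apply Hdom; lra).
    (* Tags of two cells that meet are less than [2 * delta] apart; cells that do not meet carry a
       zero increment. *)
    destruct (clamp_overlap (x i) (x (S i)) (y j) (y (S j)) L1 L2)
        as [[_ [_ [O1 O2]]]|[O1 _]].
    + rewrite Rmult_comm. apply Rmult_le_compat; auto using norm_ge_0, Rabs_pos.
      apply Huc; try lra. apply Rabs_def1; lra.
    + assert (Z : D g i j = 0) by (unfold D; rewrite O1; ring).
      rewrite Z, Rabs_R0, Rmult_0_l. apply Rmult_le_pos; auto.
      eapply Rle_trans; [apply Rabs_pos|exact Hd].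
  - rewrite rsum_scal. apply Rmult_le_compat_l; auto.
    rewrite (rsum_telescope (fun i => v (x i))). rewrite X0, Xn. lra.
Qed.

(** Since both integrals exist, one well-chosen tagged partition for each mesh size is enough. This
    freedom is what later permits partitions adapted to the jump parts. *)
Lemma RSInt_diff_le (f1 f2 : R -> X) (g1 g2 : R -> R) (lo hi c : R) (v1 v2 : X) :
  is_RSInt f1 g1 lo hi v1 -> is_RSInt f2 g2 lo hi v2 ->
  (forall delta, 0 < delta -> exists n x xi, tagged lo hi delta n x xi /\
     norm (minus (RSsum f1 g1 n x xi) (RSsum f2 g2 n x xi)) <= c) ->
  norm (minus v1 v2) <= c.
Proof.
  intros H1 H2 H. apply le_epsilon. intros e He.
  destruct (H1 (e/2) ltac:(lra)) as [d1 [Hd1 P1]].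
  destruct (H2 (e/2) ltac:(lra)) as [d2 [Hd2 P2]].
  destruct (H (Rmin d1 d2) ltac:(now apply Rmin_pos)) as [n [x [xi [[Hp Hxi] Hc]]]].
  specialize (P1 n x xi Hp). specialize (P2 n x xi Hp).
  assert (Q1 := P1 ltac:(intros i Hi; destruct (Hxi i Hi); split; auto;
    eapply Rlt_le_trans; [eassumption|apply Rmin_l])).
  assert (Q2 := P2 ltac:(intros i Hi; destruct (Hxi i Hi); split; auto;
    eapply Rlt_le_trans; [eassumption|apply Rmin_r])).
  change (norm (minus (RSsum f1 g1 n x xi) v1) < e/2) in Q1.
  change (norm (minus (RSsum f2 g2 n x xi) v2) < e/2) in Q2.
  eapply Rle_trans.
  - apply (norm_plus3 _ (minus v1 (RSsum f1 g1 n x xi))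
      (minus (RSsum f1 g1 n x xi) (RSsum f2 g2 n x xi)) (minus (RSsum f2 g2 n x xi) v2)). vec.
  - rewrite (norm_minus_sym v1). lra.
Qed.

Lemma fine_tagged_exists (lo hi delta : R) :
  lo <= hi -> 0 < delta -> exists n x xi, tagged lo hi delta n x xi.
Proof.
  intros Hl Hd. destruct (archimed_inv (hi - lo) delta Hd) as [n [Hn1 Hn]].
  exists n, (upart lo hi n), (upart lo hi n). now apply upart_tagged.
Qed.

Lemma sum_dominated_le (f : R -> X) (g v : R -> R) (lo hi delta c : R) n x xi :
  dominates v g lo hi -> tagged lo hi delta n x xi -> 0 <= c ->
  (forall s, lo <= s <= hi -> norm (f s) <= c) ->
  norm (RSsum f g n x xi) <= c * (v hi - v lo).
Proof.
  intros Hdom [Hx Hxi] Hc Hf. unfold RSsum.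
  pose proof (partition_range _ _ _ _ Hx) as Rx. destruct Hx as [X0 [Xn Xi]].
  eapply Rle_trans; [apply vsum_norm|].
  apply Rle_trans with (rsum (fun i => c * (v (x (S i)) - v (x i))) n).
  - apply rsum_le. intros i Hi. eapply Rle_trans; [apply norm_scal_Rabs|].
    pose proof (Rx i ltac:(lia)). pose proof (Rx (S i) ltac:(lia)). destruct (Hxi i Hi).
    rewrite Rmult_comm. apply Rmult_le_compat; auto using norm_ge_0, Rabs_pos.
    + apply Hf; lra.
    + apply Hdom; lra.
  - rewrite rsum_scal, (rsum_telescope (fun i => v (x i))), X0, Xn. lra.
Qed.

Lemma RSInt_lip (f1 f2 : R -> X) (g v : R -> R) (lo hi c : R) (v1 v2 : X) :
  lo <= hi -> dominates v g lo hi -> 0 <= c ->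
  (forall s, lo <= s <= hi -> norm (minus (f1 s) (f2 s)) <= c) ->
  is_RSInt f1 g lo hi v1 -> is_RSInt f2 g lo hi v2 ->
  norm (minus v1 v2) <= c * (v hi - v lo).
Proof.
  intros Hl Hdom Hc Hf H1 H2. apply (RSInt_diff_le f1 f2 g g lo hi _ v1 v2); auto.
  intros d Hd. destruct (fine_tagged_exists lo hi d Hl Hd) as [n [x [xi Ht]]].
  exists n, x, xi. split; auto.
  replace (minus (RSsum f1 g n x xi) (RSsum f2 g n x xi))
    with (RSsum (fun s => minus (f1 s) (f2 s)) g n x xi).
  - apply (sum_dominated_le _ g v lo hi d); auto.
  - unfold RSsum. rewrite <- vsum_minus. apply vsum_ext. intros i _. vec.
Qed.

Lemma RSInt_zero (g : R -> R) (lo hi : R) : is_RSInt (fun _ => zero : X) g lo hi zero.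
Proof.
  intros e He. exists 1; split; [lra|]. intros n x xi _ _.
  change (norm (minus (RSsum (fun _ => zero) g n x xi) (zero : X)) < e).
  replace (RSsum (fun _ => zero) g n x xi) with (zero : X).
  - now rewrite norm_minus_diag.
  - unfold RSsum. induction n as [|n IH]; [reflexivity|]. rewrite vsum_S, <- IH. vec.
Qed.

Lemma RSInt_norm_le (f : R -> X) (g v : R -> R) (lo hi c : R) (l : X) :
  lo <= hi -> dominates v g lo hi -> 0 <= c ->
  (forall s, lo <= s <= hi -> norm (f s) <= c) ->
  is_RSInt f g lo hi l -> norm l <= c * (v hi - v lo).
Proof.
  intros Hl Hdom Hc Hf H. replace l with (minus l zero) by vec.
  apply (RSInt_lip f (fun _ => zero) g v lo hi c l zero); auto;
    [|exact (RSInt_zero g lo hi)].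
  intros s Hs. eapply Rle_trans; [apply norm_minus_le|].
  rewrite norm_zero, Rplus_0_r. auto.
Qed.
End RiemannStieltjes.

(** By [RSsum_close] the sums over uniform grids are Cauchy, and any sufficiently fine tagged sum is
    close to them. *)
Lemma RSInt_exists {X : CompleteNormedModule R_AbsRing} (f : R -> X) (g v : R -> R) (lo hi : R) :
  lo <= hi -> cont_on f lo hi -> dominates v g lo hi -> exists l, is_RSInt f g lo hi l.
Proof.
  intros Hl Hf Hdom.
  (* The added 1 keeps this divisor positive when [v] has no increase. *)
  set (C := v hi - v lo + 1).
  assert (HC : 0 < C) by (unfold C; pose proof (dominates_ge_0 v g lo hi Hl Hdom); lra).
  assert (Key : forall eps, 0 < eps -> exists d, 0 < d /\ forall n x xi m y zeta,
    tagged lo hi d n x xi -> tagged lo hi d m y zeta ->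
    norm (minus (RSsum f g n x xi) (RSsum f g m y zeta)) < eps).
  { intros eps He.
    destruct (cont_on_unif f lo hi Hf (eps / C) ltac:(now apply Rdiv_lt_0_compat))
      as [d [Hd Hu]].
    exists (d/2); split; [lra|]. intros n x xi m y zeta H1 H2.
    apply Rle_lt_trans with (eps / C * (v hi - v lo)).
    - apply (RSsum_close f g v lo hi (d/2)); auto.
      + left; now apply Rdiv_lt_0_compat.
      + intros s t Hs Ht Hst. left. apply Hu; auto. lra.
    - apply Rlt_le_trans with (eps / C * C).
      + apply Rmult_lt_compat_l; [now apply Rdiv_lt_0_compat|unfold C; lra].
      + right; field; lra. }
  assert (Ht : forall d, 0 < d -> exists N, forall k, (N <= k)%nat ->
    tagged lo hi d (S k) (upart lo hi (S k)) (upart lo hi (S k))).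
  { intros d Hd. destruct (archimed_inv (hi - lo) d Hd) as [N [HN1 HN]].
    exists N. intros k Hk. apply upart_tagged; auto; [lia|].
    eapply Rle_lt_trans; [|exact HN]. apply Rmult_le_compat_l; [lra|].
    apply Rinv_le_contravar; [apply lt_0_INR; lia|apply le_INR; lia]. }
  destruct (cauchy_seq_lim (fun k => RSsum f g (S k) (upart lo hi (S k)) (upart lo hi (S k))))
    as [l Hlim].
  { intros eps He. destruct (Key eps He) as [d [Hd Hk]]. destruct (Ht d Hd) as [N HN].
    exists N. intros n m Hn Hm. apply Hk; auto. }
  exists l. intros eps He. destruct (Key (eps/2) ltac:(lra)) as [d [Hd Hk]].
  exists d; split; auto. intros n x xi Hp Hxi.
  destruct (Ht d Hd) as [N1 HN1].
  destruct (proj1 (seq_lim_eps _ l) Hlim (eps/2) ltac:(lra)) as [N2 HN2].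
  set (k := Nat.max N1 N2).
  eapply Rle_lt_trans;
    [apply (norm_minus_tri _ (RSsum f g (S k) (upart lo hi (S k)) (upart lo hi (S k))))|].
  specialize (HN2 k ltac:(lia)). specialize (HN1 k ltac:(lia)).
  specialize (Hk n x xi _ _ _ (conj Hp Hxi) HN1).
  change (norm (minus (RSsum f g n x xi) (RSsum f g (S k) (upart lo hi (S k)) (upart lo hi (S k)))) +
    norm (minus (RSsum f g (S k) (upart lo hi (S k)) (upart lo hi (S k))) l) < eps). lra.
Qed.

(** [iota] selects the integral once it is known to be unique; uniqueness comes from evaluating both
    candidates on a single fine partition. *)
Lemma RSInt_correct {X : CompleteNormedModule R_AbsRing} (f : R -> X) (g v : R -> R) (lo hi : R) :
  lo <= hi -> cont_on f lo hi -> dominates v g lo hi -> is_RSInt f g lo hi (RSInt f g lo hi).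
Proof.
  intros Hl Hf Hd. destruct (RSInt_exists f g v lo hi Hl Hf Hd) as [l Hlim].
  unfold RSInt. apply iota_correct. exists l; split; auto.
  intros l' Hl'. apply norm_minus_small_eq. intros e He.
  apply (RSInt_diff_le f f g g lo hi e l l'); auto.
  intros d Hdp. destruct (fine_tagged_exists lo hi d Hl Hdp) as [n [x [xi Ht]]].
  exists n, x, xi. split; auto. rewrite norm_minus_diag. lra.
Qed.


(** * The jump part of the integrator *)

(* Right-continuous indicator of [z <= x], forced to vanish at the left endpoint (index [0]),
   where a jump part is normalised to [0]. *)
Definition chi (i : nat) (x z : R) : R :=
  match i with O => 0 | S _ => if Rle_dec z x then 1 else 0 end.

Lemma chi_range (i : nat) (x z : R) : 0 <= chi i x z <= 1.
Proof. unfold chi. destruct i; [lra|]. case_Rle; lra. Qed.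

Section Jumps.
Context {X : NormedModule R_AbsRing}.

(** The increments of [chi] along the partition are nonnegative, vanish on cells that do not contain
    [z], and have total 1 because [chi] starts at 0 by convention and ends at 1 as [z <= 0]. The sum
    is thus a convex combination of values of [f] near [z]. *)
Lemma chi_sum_approx (f : R -> X) (r : R) (n : nat) (x xi : nat -> R) (z om Fb : R) :
  (1 <= n)%nat -> is_partition (- r) 0 n x -> - r <= z <= 0 ->
  (forall i, (i < n)%nat -> x i <= xi i <= x (S i)) ->
  (forall i, (i < n)%nat -> forall s, x i <= s <= x (S i) -> norm (minus (f (xi i)) (f s)) <= om) ->
  (forall s, - r <= s <= 0 -> norm (f s) <= Fb) ->
  norm (vsum (fun i => scal (chi (S i) (x (S i)) z - chi i (x i) z) (f (xi i))) n) <= Fb /\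
  norm (minus (vsum (fun i => scal (chi (S i) (x (S i)) z - chi i (x i) z) (f (xi i))) n) (f z)) <= om.
Proof.
  intros Hn Hp Hz Hxi Hom HF. pose proof (partition_range _ _ _ _ Hp) as Rx.
  destruct Hp as [X0 [Xn Xi]].
  set (d := fun i => chi (S i) (x (S i)) z - chi i (x i) z).
  assert (Hd : forall i, (i < n)%nat -> 0 <= d i /\ (d i = 0 \/ x i <= z <= x (S i))).
  { intros i Hi. specialize (Xi i Hi). unfold d, chi. destruct i as [|i].
    - rewrite X0 in *. case_Rle; lra.
    - case_Rle; lra. }
  assert (Hs : rsum d n = 1).
  { unfold d. rewrite (rsum_telescope (fun i => chi i (x i) z)). rewrite Xn.
    destruct n as [|n]; [lia|]. unfold chi. case_Rle; lra. }
  split.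
  - eapply Rle_trans; [apply vsum_norm|].
    apply Rle_trans with (rsum (fun i => Fb * d i) n).
    + apply rsum_le. intros i Hi. eapply Rle_trans; [apply norm_scal_Rabs|].
      fold (d i). destruct (Hd i Hi) as [H0 _]. rewrite Rabs_right by lra. rewrite Rmult_comm.
      apply Rmult_le_compat_r; auto. apply HF.
      pose proof (Rx i ltac:(lia)). pose proof (Rx (S i) ltac:(lia)).
      specialize (Hxi i Hi). lra.
    + rewrite rsum_scal, Hs. lra.
  - assert (E : f z = vsum (fun i => scal (d i) (f z)) n).
    { rewrite vsum_scal_r, Hs. symmetry. exact (scal_one (f z)). }
    rewrite E, <- vsum_minus.
    eapply Rle_trans; [apply vsum_norm|].
    apply Rle_trans with (rsum (fun i => om * d i) n).
    + apply rsum_le. intros i Hi.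
      eapply Rle_trans; [apply (norm_scal_eq _ (d i) (minus (f (xi i)) (f z))); unfold d; vec|].
      destruct (Hd i Hi) as [H0 [H1|H1]].
      * rewrite H1, Rabs_R0. lra.
      * rewrite Rabs_right by lra. rewrite Rmult_comm. apply Rmult_le_compat_r; auto.
    + rewrite rsum_scal, Hs. lra.
Qed.
End Jumps.

(** For a positive index this is the right limit at [x] of the jump part; at index 0 it is the
    normalised value 0 at the left endpoint. *)
Definition jump_cum (eta h : nat -> R) (i : nat) (x : R) : R :=
  Series (fun k => h k * chi i x (- eta k)).

Lemma jump_ex_series (eta h : nat -> R) (i : nat) (x : R) :
  ex_series (fun k => Rabs (h k)) -> ex_series (fun k => h k * chi i x (- eta k)).
Proof.
  intros H.
  apply (ex_series_le (K := R_AbsRing) (V := R_CompleteNormedModule) _ (fun k => Rabs (h k))); auto.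
  intros k. change (Rabs (h k * chi i x (- eta k)) <= Rabs (h k)).
  rewrite Rabs_mult. pose proof (chi_range i x (- eta k)). rewrite (Rabs_right (chi _ _ _)) by lra.
  rewrite <- (Rmult_1_r (Rabs (h k))) at 2. apply Rmult_le_compat_l; [apply Rabs_pos|lra].
Qed.

(** Only finitely many grid points matter, so one truncation of the series of jumps serves all of
    them. *)
Lemma jump_partial_sums (eta h : nat -> R) (x : nat -> R) (n : nat) (tol : R) :
  ex_series (fun k => Rabs (h k)) -> 0 < tol ->
  exists M0, forall M, (M0 <= M)%nat -> forall i, (i <= n)%nat ->
    Rabs (rsum (fun k => h k * chi i (x i) (- eta k)) M - jump_cum eta h i (x i)) < tol.
Proof.
  intros Hh Ht.
  assert (H1 : forall i, exists M0, forall M, (M0 <= M)%nat ->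
    Rabs (rsum (fun k => h k * chi i (x i) (- eta k)) M - jump_cum eta h i (x i)) < tol).
  { intros i. pose proof (Series_correct _ (jump_ex_series eta h i (x i) Hh)) as Hs.
    destruct (proj1 (seq_lim_eps (V := R_NormedModule) _ _) Hs tol Ht) as [N HN].
    exists (S N). intros M HM. destruct M as [|M]; [lia|].
    rewrite rsum_sum_n. apply (HN M). lia. }
  induction n as [|n IH].
  - destruct (H1 O) as [M0 HM]. exists M0. intros M Hle i Hi. replace i with O by lia. auto.
  - destruct IH as [M1 HM1]. destruct (H1 (S n)) as [M2 HM2].
    exists (Nat.max M1 M2). intros M Hle i Hi.
    destruct (Nat.eq_dec i (S n)) as [->|Hne]; [apply HM2; lia|apply HM1; lia].
Qed.

Lemma jump_part_near (r : R) (gd : R -> R) (eta h : nat -> R) (i : nat) (x tol : R) :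
  is_jump_part r gd eta h -> (0 < i)%nat -> - r <= x < 0 -> 0 < tol ->
  exists d, 0 < d /\ forall y, x < y < x + d -> Rabs (gd y - jump_cum eta h i x) < tol.
Proof.
  intros [_ [_ [_ Hr]]] Hi Hx Ht.
  destruct (proj1 (at_right_eps (V := R_NormedModule) _ _ _) (Hr x Hx) tol Ht) as [d [Hd H]].
  exists d; split; auto. intros y Hy. specialize (H y Hy).
  replace (jump_cum eta h i x) with
    (Series (fun k => if Rle_dec (- eta k) x then h k else 0)); [exact H|].
  apply Series_ext. intros k. unfold chi. destruct i; [lia|]. case_Rle; ring.
Qed.

Lemma jump_part_left (r : R) (gd : R -> R) (eta h : nat -> R) (x : R) :
  is_jump_part r gd eta h -> gd (- r) = jump_cum eta h 0 x.
Proof.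
  intros [H0 _]. rewrite H0. unfold jump_cum, chi.
  (* Writing 0 as [0 * 0] lets [Series_scal_l] evaluate the zero series. *)
  rewrite (Series_ext _ (fun _ => 0 * 0)) by (intros; ring).
  rewrite Series_scal_l. ring.
Qed.

Lemma jump_part_right (r : R) (gd : R -> R) (eta h : nat -> R) (n : nat) :
  is_jump_part r gd eta h -> (0 < n)%nat -> (forall k, 0 <= eta k <= r) ->
  gd 0 = jump_cum eta h n 0.
Proof.
  intros [_ [H0 _]] Hn He. rewrite H0. apply Series_ext. intros k.
  specialize (He k). unfold chi. destruct n; [lia|]. case_Rle; [ring|lra].
Qed.

(* Partition points of a uniform grid are moved slightly to the right: there the values of
   both jump parts are controlled, whatever they are at the jump points themselves. *)
Lemma perturbed_partition (r : R) (gd1 gd2 : R -> R) (eta1 eta2 h1 h2 : nat -> R)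
    (n : nat) (tol : R) :
  0 < r -> (1 <= n)%nat -> 0 < tol ->
  is_jump_part r gd1 eta1 h1 -> is_jump_part r gd2 eta2 h2 ->
  (forall k, 0 <= eta1 k <= r) -> (forall k, 0 <= eta2 k <= r) ->
  exists y : nat -> R,
    y O = - r /\ y n = 0 /\
    (forall i, (i < n)%nat -> upart (- r) 0 n i <= y i <= upart (- r) 0 n (S i)) /\
    (forall i, (i <= n)%nat ->
       Rabs (gd1 (y i) - jump_cum eta1 h1 i (upart (- r) 0 n i)) < tol /\
       Rabs (gd2 (y i) - jump_cum eta2 h2 i (upart (- r) 0 n i)) < tol).
Proof.
  intros Hr Hn Ht J1 J2 E1 E2. set (x := upart (- r) 0 n).
  assert (Hp : is_partition (- r) 0 n x) by (apply upart_partition; auto; lra).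
  pose proof (partition_range _ _ _ _ Hp) as Rx. destruct Hp as [X0 [Xn Xi]].
  assert (Hst : forall i, x (S i) - x i = r / INR n).
  { intros i. unfold x. rewrite upart_step. f_equal. ring. }
  assert (Hpos : 0 < r / INR n) by (apply Rdiv_lt_0_compat; auto; apply lt_0_INR; lia).
  (* The endpoints stay fixed, since there [is_jump_part] prescribes the values exactly; interior
     points move by less than one grid step; indices above [n] receive a dummy value. *)
  destruct (nat_choice (fun i y =>
    (i = O -> y = - r) /\ (i = n -> y = 0) /\
    ((0 < i < n)%nat -> x i <= y <= x (S i) /\
       Rabs (gd1 y - jump_cum eta1 h1 i (x i)) < tol /\
       Rabs (gd2 y - jump_cum eta2 h2 i (x i)) < tol))) as [y Hy].
  { intros i. destruct (Nat.eq_dec i 0) as [->|H0].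
    { exists (- r). repeat split; auto; intros; lia. }
    destruct (Nat.eq_dec i n) as [->|H1].
    { exists 0. repeat split; auto; intros; lia. }
    destruct (le_lt_dec n i) as [H2|H2].
    { exists 0. repeat split; auto; intros; lia. }
    assert (Hxi : - r <= x i < 0).
    { pose proof (Rx i ltac:(lia)). pose proof (Rx (S i) ltac:(lia)). specialize (Hst i). lra. }
    destruct (jump_part_near r gd1 eta1 h1 i (x i) tol J1 ltac:(lia) Hxi Ht) as [d1 [Hd1 P1]].
    destruct (jump_part_near r gd2 eta2 h2 i (x i) tol J2 ltac:(lia) Hxi Ht) as [d2 [Hd2 P2]].
    destruct (pos_min3 (r / INR n) d1 d2 Hpos Hd1 Hd2) as [d [Hd [D0 [D1 D2]]]].
    specialize (Hst i).
    exists (x i + d / 2). split; [intros; lia|split; [intros; lia|]]. intros _.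
    split; [lra|split]; [apply P1|apply P2]; lra. }
  exists y. destruct (Hy O) as [Hy0 _]. destruct (Hy n) as [_ [Hyn _]].
  specialize (Hy0 eq_refl). specialize (Hyn eq_refl).
  split; [auto|split; [auto|split]].
  - intros i Hi. destruct (Nat.eq_dec i 0) as [->|H0].
    + rewrite Hy0. specialize (Xi O Hi). lra.
    + apply (proj2 (proj2 (Hy i))). lia.
  - intros i Hi. destruct (Nat.eq_dec i 0) as [->|H0].
    { rewrite Hy0. rewrite <- (jump_part_left r gd1 eta1 h1), <- (jump_part_left r gd2 eta2 h2) by auto.
      rewrite !Rminus_diag, Rabs_R0. auto. }
    destruct (Nat.eq_dec i n) as [->|H1].
    { rewrite Hyn, Xn.
      rewrite <- (jump_part_right r gd1 eta1 h1), <- (jump_part_right r gd2 eta2 h2) by (auto; lia).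
      rewrite !Rminus_diag, Rabs_R0. auto. }
    apply (proj2 (proj2 (Hy i))). lia.
Qed.

(** On a perturbed grid the difference of the Stieltjes sums splits into three parts: the continuous
    parts, bounded through their variation [c]; the error of replacing both jump parts by finite
    sums of steps; and these finite sums, which nearly equal sums of [h k] times the value of [f] at
    [- eta k]. Jumps from index [N] on are not compared but bounded by their tails, hence the term
    with [e]. *)
Lemma RSInt_integrator_diff {X : NormedModule R_AbsRing} (r : R) (f : R -> X)
    (g1 g2 gc1 gc2 : R -> R) (eta1 eta2 h1 h2 : nat -> R) (v1 v2 : X) (Fb c e : R) (N : nat) :
  0 < r -> cont_on f (- r) 0 -> (forall s, - r <= s <= 0 -> norm (f s) <= Fb) ->
  is_RSInt f g1 (- r) 0 v1 -> is_RSInt f g2 (- r) 0 v2 ->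
  is_jump_part r (fun th => g1 th - gc1 th) eta1 h1 ->
  is_jump_part r (fun th => g2 th - gc2 th) eta2 h2 ->
  (forall k, 0 <= eta1 k <= r) -> (forall k, 0 <= eta2 k <= r) ->
  ex_series (fun k => Rabs (h1 k)) -> ex_series (fun k => Rabs (h2 k)) ->
  variation_le (fun th => gc1 th - gc2 th) (- r) 0 c ->
  (forall m, rsum (fun k => Rabs (h1 (N + k)%nat)) m <= e) ->
  (forall m, rsum (fun k => Rabs (h2 (N + k)%nat)) m <= e) ->
  norm (minus v1 v2) <= Fb * c + 2 * Fb * e +
    rsum (fun k => Rabs (h1 k - h2 k) * Fb + Rabs (h2 k) * norm (minus (f (- eta1 k)) (f (- eta2 k)))) N.
Proof.
  intros Hr Hf HF I1 I2 J1 J2 E1 E2 S1 S2 Hvar T1 T2.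
  set (Main := rsum _ N). apply le_epsilon. intros kap Hk.
  assert (HFb : 0 <= Fb).
  { apply Rle_trans with (norm (f 0)); [apply norm_ge_0|apply HF; lra]. }
  (* With [om = kap / (4 * H)], moving the tags to the jump points costs at most
     [2 * om * H = kap / 2]. *)
  set (H := rsum (fun k => Rabs (h2 k)) N + 1).
  assert (HH : 0 < H).
  { unfold H. assert (0 <= rsum (fun k => Rabs (h2 k)) N); [|lra].
    apply rsum_ge_0; intros; apply Rabs_pos. }
  set (om := kap / (4 * H)).
  assert (Hom : 0 < om) by (unfold om; apply Rdiv_lt_0_compat; lra).
  destruct (cont_on_unif f (- r) 0 Hf om Hom) as [d [Hd Hu]].
  apply (RSInt_diff_le f f g1 g2 (- r) 0 _ v1 v2); auto.
  intros delta Hdel.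
  destruct (archimed_inv r (Rmin (delta / 2) d)) as [n [Hn1 Hn]].
  { apply Rmin_pos; lra. }
  assert (Hn2 : r / INR n < delta / 2) by (eapply Rlt_le_trans; [exact Hn|apply Rmin_l]).
  assert (Hn3 : r / INR n < d) by (eapply Rlt_le_trans; [exact Hn|apply Rmin_r]).
  assert (HnR : 0 < INR n) by (apply lt_0_INR; lia).
  (* Each of the [n] increments of the error [er] is at most [8 * tol], so the error term [w2] stays
     below [kap / 2]. *)
  set (tol := kap / (16 * INR n * (Fb + 1))).
  assert (Htol : 0 < tol).
  { unfold tol. apply Rdiv_lt_0_compat; auto. repeat apply Rmult_lt_0_compat; lra. }
  set (x := upart (- r) 0 n).
  assert (Hp : is_partition (- r) 0 n x) by (apply upart_partition; auto; lra).
  pose proof (partition_range _ _ _ _ Hp) as Rx.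
  assert (Hst : forall i, x (S i) - x i = r / INR n).
  { intros i. unfold x. rewrite upart_step. f_equal. ring. }
  destruct (perturbed_partition r (fun th => g1 th - gc1 th) (fun th => g2 th - gc2 th)
    eta1 eta2 h1 h2 n tol) as [y [Y0 [Yn [Yi Yj]]]]; auto.
  fold x in Yi, Yj.
  destruct (jump_partial_sums eta1 h1 x n tol S1 Htol) as [M1 HM1].
  destruct (jump_partial_sums eta2 h2 x n tol S2 Htol) as [M2 HM2].
  (* The truncation index [M] exceeds [N] by [m], so the finite sum splits into the first [N] jumps,
     compared termwise, and a stretch of the tail. *)
  set (m := Nat.max M1 M2). set (M := (N + m)%nat).
  specialize (HM1 M ltac:(unfold M; lia)). specialize (HM2 M ltac:(unfold M; lia)).
  assert (Ymono : forall i, (i < n)%nat -> y i <= y (S i) /\ y (S i) - y i < delta).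
  { intros i Hi. pose proof (Yi i Hi) as A. pose proof (Hst i) as B.
    destruct (Nat.eq_dec (S i) n) as [E|E].
    - rewrite E, Yn in *. destruct Hp as [_ [Xn _]]. lra.
    - pose proof (Yi (S i) ltac:(lia)) as A'. pose proof (Hst (S i)). lra. }
  assert (Yp : is_partition (- r) 0 n y).
  { split; [auto|split; [auto|]]. intros i Hi. now apply Ymono. }
  exists n, y, y. split.
  { split; auto. intros i Hi. destruct (Ymono i Hi). lra. }
  pose proof (partition_range _ _ _ _ Yp) as Ry.
  set (P1 := fun i => rsum (fun k => h1 k * chi i (x i) (- eta1 k)) M).
  set (P2 := fun i => rsum (fun k => h2 k * chi i (x i) (- eta2 k)) M).
  set (gcd := fun th => gc1 th - gc2 th).
  set (er := fun i => (g1 (y i) - gc1 (y i) - P1 i) - (g2 (y i) - gc2 (y i) - P2 i)).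
  assert (Her : forall i, (i <= n)%nat -> Rabs (er i) <= 4 * tol).
  { intros i Hi. destruct (Yj i Hi) as [A1 A2]. specialize (HM1 i Hi). specialize (HM2 i Hi).
    fold (P1 i) in HM1. fold (P2 i) in HM2. unfold er.
    apply Rabs_def2 in A1. apply Rabs_def2 in A2. apply Rabs_def2 in HM1. apply Rabs_def2 in HM2.
    apply Rabs_le. lra. }
  set (w1 := vsum (fun i => scal (gcd (y (S i)) - gcd (y i)) (f (y i))) n).
  set (w2 := vsum (fun i => scal (er (S i) - er i) (f (y i))) n).
  set (w3 := vsum (fun i => scal ((P1 (S i) - P1 i) - (P2 (S i) - P2 i)) (f (y i))) n).
  assert (B1 : norm w1 <= Fb * c).
  { eapply Rle_trans; [apply vsum_norm|].
    apply Rle_trans with (rsum (fun i => Fb * Rabs (gcd (y (S i)) - gcd (y i))) n).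
    - apply rsum_le. intros i Hi. eapply Rle_trans; [apply norm_scal_Rabs|].
      rewrite Rmult_comm. apply Rmult_le_compat_r; [apply Rabs_pos|]. apply HF. apply Ry; lia.
    - rewrite rsum_scal. apply Rmult_le_compat_l; auto. exact (Hvar n y Yp). }
  assert (B2 : norm w2 <= kap / 2).
  { eapply Rle_trans; [apply vsum_norm|].
    apply Rle_trans with (rsum (fun i => 8 * tol * Fb) n).
    - apply rsum_le. intros i Hi. eapply Rle_trans; [apply norm_scal_Rabs|].
      apply Rmult_le_compat; auto using Rabs_pos, norm_ge_0; [|apply HF; apply Ry; lia].
      pose proof (Her i ltac:(lia)) as A1. pose proof (Her (S i) ltac:(lia)) as A2.
      apply Rabs_le_between in A1. apply Rabs_le_between in A2. apply Rabs_le. lra.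
    - rewrite rsum_const. unfold tol.
      replace (INR n * (8 * (kap / (16 * INR n * (Fb + 1))) * Fb))
        with (kap / 2 * (Fb / (Fb + 1))) by (field; lra).
      rewrite <- (Rmult_1_r (kap / 2)) at 2. apply Rmult_le_compat_l; [lra|].
      apply Rmult_le_reg_r with (Fb + 1); [lra|].
      unfold Rdiv. rewrite Rmult_assoc, Rinv_l by lra. lra. }
  (* Contribution of a unit jump at [- eta k]. Exchanging the sums over cells and over jumps turns
     [w3] into sums of [h k] times these, and [chi_sum_approx] puts them near [f (- eta k)]. *)
  set (EE := fun (eta : nat -> R) k =>
    vsum (fun i => scal (chi (S i) (x (S i)) (- eta k) - chi i (x i) (- eta k)) (f (y i))) n).
  assert (HEE : forall eta, (forall k, 0 <= eta k <= r) -> forall k,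
    norm (EE eta k) <= Fb /\ norm (minus (EE eta k) (f (- eta k))) <= om).
  { intros eta He k. apply (chi_sum_approx f r n x y (- eta k) om Fb); auto.
    - specialize (He k); lra.
    - intros i Hi s Hs. pose proof (Rx i ltac:(lia)). pose proof (Rx (S i) ltac:(lia)).
      specialize (Yi i Hi). specialize (Hst i). left. apply Hu; try lra.
      apply Rle_lt_trans with (r / INR n); auto. apply Rabs_le; lra. }
  assert (E3 : w3 = vsum (fun k => minus (scal (h1 k) (EE eta1 k)) (scal (h2 k) (EE eta2 k))) M).
  { assert (Q : forall (h eta : nat -> R) ,
      vsum (fun i => scal (rsum (fun k => h k * chi (S i) (x (S i)) (- eta k)) M -
                           rsum (fun k => h k * chi i (x i) (- eta k)) M) (f (y i))) n =
      vsum (fun k => scal (h k) (EE eta k)) M).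
    { intros h eta.
      transitivity (vsum (fun k => vsum (fun i =>
        scal (h k * (chi (S i) (x (S i)) (- eta k) - chi i (x i) (- eta k))) (f (y i))) n) M).
      - rewrite (vsum_swap (fun k i =>
          scal (h k * (chi (S i) (x (S i)) (- eta k) - chi i (x i) (- eta k))) (f (y i)))).
        apply vsum_ext. intros i Hi.
        rewrite (vsum_scal_r (fun k => h k * (chi (S i) (x (S i)) (- eta k) - chi i (x i) (- eta k)))).
        f_equal.
        rewrite (rsum_ext (fun k => h k * (chi (S i) (x (S i)) (- eta k) - chi i (x i) (- eta k)))
          (fun k => h k * chi (S i) (x (S i)) (- eta k) + (-1) * (h k * chi i (x i) (- eta k))))
          by (intros; ring).
        rewrite rsum_plus, rsum_scal. ring.
      - apply vsum_ext. intros k Hk'. unfold EE. rewrite <- vsum_scal_l. apply vsum_ext.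
        intros i Hi. vec. }
    etransitivity; [|symmetry; apply (vsum_minus (fun k => scal (h1 k) (EE eta1 k))
      (fun k => scal (h2 k) (EE eta2 k)) M)].
    rewrite <- (Q h1 eta1), <- (Q h2 eta2). rewrite <- vsum_minus.
    apply vsum_ext. intros i Hi. unfold P1, P2. vec. }
  assert (B3 : norm w3 <= Main + kap / 2 + 2 * Fb * e).
  { rewrite E3. unfold M. rewrite vsum_split.
    eapply Rle_trans; [apply norm_triangle|]. apply Rplus_le_compat.
    - eapply Rle_trans; [apply vsum_norm|].
      apply Rle_trans with (rsum (fun k => (Rabs (h1 k - h2 k) * Fb +
        Rabs (h2 k) * norm (minus (f (- eta1 k)) (f (- eta2 k)))) + 2 * om * Rabs (h2 k)) N).
      + apply rsum_le. intros k Hk'.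
        destruct (HEE eta1 E1 k) as [A1 A2]. destruct (HEE eta2 E2 k) as [A3 A4].
        eapply Rle_trans.
        { apply (norm_plus2 _ (scal (h1 k - h2 k) (EE eta1 k))
            (scal (h2 k) (minus (EE eta1 k) (EE eta2 k)))). vec. }
        rewrite Rplus_assoc. apply Rplus_le_compat.
        * eapply Rle_trans; [apply norm_scal_Rabs|].
          apply Rmult_le_compat_l; auto. apply Rabs_pos.
        * eapply Rle_trans; [apply norm_scal_Rabs|].
          replace (2 * om * Rabs (h2 k)) with (Rabs (h2 k) * (2 * om)) by ring.
          rewrite <- Rmult_plus_distr_l. apply Rmult_le_compat_l; [apply Rabs_pos|].
          eapply Rle_trans.
          { apply (norm_plus3 _ (minus (EE eta1 k) (f (- eta1 k)))
              (minus (f (- eta1 k)) (f (- eta2 k))) (minus (f (- eta2 k)) (EE eta2 k))). vec. }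
          rewrite (norm_minus_sym (f (- eta2 k))). lra.
      + rewrite rsum_plus, rsum_scal. fold Main. apply Rplus_le_compat_l.
        apply Rle_trans with (2 * om * H); [|unfold om; right; field; lra].
        apply Rmult_le_compat_l; [lra|]. unfold H. lra.
    - eapply Rle_trans; [apply vsum_norm|].
      apply Rle_trans with (rsum (fun k => Fb * Rabs (h1 (N + k)%nat) + Fb * Rabs (h2 (N + k)%nat)) m).
      + apply rsum_le. intros k Hk'.
        destruct (HEE eta1 E1 (N + k)%nat) as [A1 _]. destruct (HEE eta2 E2 (N + k)%nat) as [A3 _].
        eapply Rle_trans; [apply norm_minus_le|]. apply Rplus_le_compat;
        (eapply Rle_trans; [apply norm_scal_Rabs|]; rewrite Rmult_comm;
         apply Rmult_le_compat_r; auto; apply Rabs_pos).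
      + rewrite rsum_plus, !rsum_scal. specialize (T1 m). specialize (T2 m).
        replace (2 * Fb * e) with (Fb * e + Fb * e) by ring.
        apply Rplus_le_compat; apply Rmult_le_compat_l; auto. }
  eapply Rle_trans.
  { apply (norm_plus3 _ w1 w2 w3). unfold w1, w2, w3. rewrite <- !vsum_plus.
    unfold RSsum. rewrite <- vsum_minus. apply vsum_ext. intros i Hi.
    unfold gcd, er. vec. }
  lra.
Qed.

(** * Continuity and Lipschitz properties of the nonlinearity *)

Lemma normC_tri {V : NormedModule R_AbsRing} (r : R) (phi psi : R -> V) :
  0 <= r -> isC r phi -> isC r psi -> normC r psi <= normC r phi + normC r (diffC psi phi).
Proof.
  intros Hr H1 H2. apply normC_le; auto. intros th Hth.
  pose proof (normC_ge r phi th H1 Hth).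
  pose proof (normC_ge r (diffC psi phi) th (isC_diffC r psi phi H2 H1) Hth) as A.
  change (diffC psi phi th) with (minus (psi th) (phi th)) in A. pose proof (norm_le_minus (psi th) (phi th)). vlra.
Qed.

Lemma cont_on_pos_lower (f : R -> R) (lo hi : R) :
  lo <= hi -> cont_on (V := R_NormedModule) f lo hi -> (forall t, lo <= t <= hi -> 0 < f t) ->
  exists m, 0 < m /\ forall t, lo <= t <= hi -> m <= f t.
Proof.
  intros Hl Hc Hp.
  destruct (continuity_ab_min (fun x => f (clamp lo hi x)) lo hi Hl) as [mx [H1 H2]].
  { intros c _. apply continuity_pt_filterlim. exact (cont_on_clamp (V := R_NormedModule) f lo hi Hl Hc c). }
  exists (f mx). split; [auto|]. intros t Ht. specialize (H1 t Ht).
  rewrite !clamp_id in H1 by auto. exact H1.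
Qed.

(* The Lipschitz estimate only compares histories that agree up to time [- eta0]: by (A5) they
   have the same jumps. *)
Definition bounded_lip {X : NormedModule R_AbsRing} (r a : R) (B : R -> (R -> X) -> X)
    (R1 L M eta0 : R) : Prop :=
  forall t, a <= t <= a + R1 ->
    (forall phi, isC r phi -> normC r phi <= R1 -> norm (B t phi) <= M) /\
    (forall phi psi, isC r phi -> isC r psi -> normC r phi <= R1 -> normC r psi <= R1 ->
       (forall th, - r <= th <= - eta0 -> psi th = phi th) ->
       norm (minus (B t psi) (B t phi)) <= L * normC r (diffC psi phi)).

Section Nonlinearity.
Context (X : CompleteNormedModule R_AbsRing) (r a : R)
  (p : R -> X -> X) (G : R -> X -> X -> X)
  (g gc : R -> R -> (R -> X) -> R)
  (eta h : nat -> R -> (R -> X) -> R)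
  (M_Vg L_Vgc : R) (eta_ign : R -> R) (Lp C1 C2 : R)
  (Hr : 0 < r)
  (HA1 : forall t phi, isC r phi -> variation_le (fun theta => g theta t phi) (- r) 0 M_Vg)
  (Hgd : forall t phi, isC r phi ->
     is_jump_part r (fun theta => g theta t phi - gc theta t phi)
       (fun k => eta k t phi) (fun k => h k t phi))
  (HA3_eta_cont : forall k, contRC r (eta k))
  (HA3_h_cont : forall k, contRC r (h k))
  (HA3_eta_range : forall k t phi, isC r phi -> 0 <= eta k t phi <= r)
  (HA3_abs : forall t phi, isC r phi -> ex_series (fun k => Rabs (h k t phi)))
  (HA3_unif : forall Rb, 0 < Rb -> forall eps, 0 < eps -> exists N : nat,
     forall t phi, isC r phi -> Rabs t <= Rb -> normC r phi <= Rb ->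
       forall n m : nat, (N <= n)%nat ->
         @sumX R_AbelianMonoid (fun k => Rabs (h (n + k)%nat t phi)) m <= eps)
  (HA4_L : 0 <= L_Vgc)
  (HA4 : forall t1 t2 phi psi, a <= t1 -> a <= t2 -> isC r phi -> isC r psi ->
     variation_le (fun theta => gc theta t1 phi - gc theta t2 psi) (- r) 0
       (L_Vgc * (Rabs (t1 - t2) + normC r (diffC phi psi))))
  (HA5_cont : forall T, a <= T -> cont_on eta_ign a T)
  (HA5_pos : forall t, a <= t -> 0 < eta_ign t)
  (HA5 : forall t phi1 phi2, a <= t -> isC r phi1 -> isC r phi2 ->
     (forall theta, - r <= theta <= - eta_ign t -> phi1 theta = phi2 theta) ->
     forall k, eta k t phi1 = eta k t phi2 /\ h k t phi1 = h k t phi2)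
  (Hp_L : 0 <= Lp) (Hp_C1 : 0 <= C1) (Hp_C2 : 0 <= C2)
  (Hp_lip : forall t s u v, norm (minus (p t u) (p s v)) <= Lp * (Rabs (s - t) + norm (minus u v)))
  (Hp_growth : forall s u, norm (p s u) <= C1 * norm u + C2)
  (HG : forall R0, 0 < R0 -> exists (LG : R) (nu : R -> R), 0 < LG /\
     (forall T, 0 <= T -> cont_on nu 0 T) /\ (forall s, 0 <= s -> 0 <= nu s) /\ nu 0 = 0 /\
     (forall t1 t2 u1 u2 v1 v2,
        norm u1 <= R0 -> norm u2 <= R0 -> norm v1 <= R0 -> norm v2 <= R0 ->
        a <= t1 <= a + R0 -> a <= t2 <= a + R0 ->
        norm (minus (G t1 u1 v1) (G t2 u2 v2)) <=
          nu (Rabs (t1 - t2)) + LG * (norm (minus u1 u2) + norm (minus v1 v2)))).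

Let Hr0 : 0 <= r := Rlt_le _ _ Hr.

Lemma p_comp_cont (t : R) (phi : R -> X) : isC r phi -> cont_on (fun th => p t (phi th)) (- r) 0.
Proof.
  intros Hphi x Hx eps He.
  destruct (Hphi x Hx (eps / (Lp + 1)) ltac:(apply Rdiv_lt_0_compat; vlra)) as [d [Hd H]].
  exists d; split; auto. intros y Hy Hyx. specialize (H y Hy Hyx).
  eapply Rle_lt_trans; [apply Hp_lip|]. rewrite Rminus_diag, Rabs_R0, Rplus_0_l.
  apply Rle_lt_trans with ((Lp + 1) * norm (minus (phi y) (phi x))).
  - apply Rmult_le_compat_r; [apply norm_ge_0|vlra].
  - apply Rlt_le_trans with ((Lp + 1) * (eps / (Lp + 1))); [apply Rmult_lt_compat_l; vlra|].
    right; field; vlra.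
Qed.

Lemma g_dominated (t : R) (phi : R -> X) : isC r phi ->
  exists v, dominates v (fun th => g th t phi) (- r) 0 /\ 0 <= v 0 - v (- r) <= M_Vg.
Proof.
  intros Hphi. destruct (variation_dominated _ (- r) 0 M_Vg ltac:(vlra) (HA1 t phi Hphi)) as [v [H1 H2]].
  exists v. split; [auto|split; auto]. apply (dominates_ge_0 v (fun th => g th t phi) (- r) 0); [vlra|exact H1].
Qed.

(** Integrand and integrator are taken at different points: this is the intermediate term when one
    is changed before the other. *)
Lemma mixed_RSInt (t s : R) (phi psi : R -> X) : isC r phi -> isC r psi ->
  is_RSInt (fun th => p t (phi th)) (fun th => g th s psi) (- r) 0
    (RSInt (fun th => p t (phi th)) (fun th => g th s psi) (- r) 0).
Proof.
  intros H1 H2. destruct (g_dominated s psi H2) as [v [Hv _]].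
  apply (RSInt_correct _ _ v); [vlra|now apply p_comp_cont|auto].
Qed.

Lemma M_Vg_ge_0 : 0 <= M_Vg.
Proof.
  assert (H : isC r (fun _ => zero : X)).
  { intros x _ eps He. exists 1; split; [vlra|]. intros. now rewrite norm_minus_diag. }
  destruct (g_dominated 0 _ H) as [v [_ Hv]]. vlra.
Qed.

Lemma p_comp_bound (t : R) (phi : R -> X) (th : R) :
  isC r phi -> - r <= th <= 0 -> norm (p t (phi th)) <= C1 * normC r phi + C2.
Proof.
  intros H1 Hth. eapply Rle_trans; [apply Hp_growth|]. apply Rplus_le_compat_r.
  apply Rmult_le_compat_l; auto. now apply normC_ge.
Qed.

Lemma growth_ge_0 (phi : R -> X) : isC r phi -> 0 <= C1 * normC r phi + C2.
Proof.
  intros H. pose proof (Rmult_le_pos _ _ Hp_C1 (normC_ge_0 r phi Hr0 H)). vlra.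
Qed.

Lemma Ffun_bound (t : R) (phi : R -> X) :
  isC r phi -> norm (Ffun r p g t phi) <= (C1 * normC r phi + C2) * M_Vg.
Proof.
  intros H. destruct (g_dominated t phi H) as [v [Hv Hv2]].
  eapply Rle_trans.
  - apply (RSInt_norm_le (fun th => p t (phi th)) (fun th => g th t phi) v (- r) 0
      (C1 * normC r phi + C2)); auto; [vlra|now apply growth_ge_0| |].
    + intros s Hs. now apply p_comp_bound.
    + exact (mixed_RSInt t t phi phi H H).
  - apply Rmult_le_compat_l; [now apply growth_ge_0|vlra].
Qed.

(** The integrand is changed first, at the cost of [Lp] times the variation, then the integrator.
    The jump terms are left in the bound on purpose: continuity makes them small, and agreement of
    the two histories before the ignored interval makes them vanish. *)
Lemma Ffun_diff (t s : R) (phi psi : R -> X) (N : nat) (e : R) :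
  a <= t -> a <= s -> isC r phi -> isC r psi ->
  (forall m, rsum (fun k => Rabs (h (N + k)%nat s psi)) m <= e) ->
  (forall m, rsum (fun k => Rabs (h (N + k)%nat t phi)) m <= e) ->
  let Fb := C1 * normC r phi + C2 in
  norm (minus (Ffun r p g s psi) (Ffun r p g t phi)) <=
    (Lp * M_Vg + Fb * L_Vgc) * (Rabs (s - t) + normC r (diffC psi phi)) + 2 * Fb * e +
    rsum (fun k => Rabs (h k s psi - h k t phi) * Fb +
      Rabs (h k t phi) * norm (minus (p t (phi (- eta k s psi))) (p t (phi (- eta k t phi))))) N.
Proof.
  intros Ht Hs H1 H2 T1 T2 Fb.
  set (mid := RSInt (fun th => p t (phi th)) (fun th => g th s psi) (- r) 0).
  pose proof (isC_diffC r psi phi H2 H1) as Hd.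
  assert (Hdp : 0 <= Rabs (s - t) + normC r (diffC psi phi)).
  { pose proof (Rabs_pos (s - t)). pose proof (normC_ge_0 r _ Hr0 Hd). vlra. }
  eapply Rle_trans; [apply (norm_minus_tri _ mid)|].
  destruct (g_dominated s psi H2) as [v [Hv Hv2]].
  assert (A : norm (minus (Ffun r p g s psi) mid) <=
    Lp * M_Vg * (Rabs (s - t) + normC r (diffC psi phi))).
  { eapply Rle_trans.
    - apply (RSInt_lip (fun th => p s (psi th)) (fun th => p t (phi th))
        (fun th => g th s psi) v (- r) 0 (Lp * (Rabs (s - t) + normC r (diffC psi phi)))); auto.
      + vlra.
      + now apply Rmult_le_pos.
      + intros x Hx. eapply Rle_trans; [apply Hp_lip|]. apply Rmult_le_compat_l; auto.
        rewrite Rabs_minus_sym. apply Rplus_le_compat_l.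
        exact (normC_ge r (diffC psi phi) x Hd Hx).
      + exact (mixed_RSInt s s psi psi H2 H2).
      + exact (mixed_RSInt t s phi psi H1 H2).
    - replace (Lp * M_Vg * (Rabs (s - t) + normC r (diffC psi phi)))
        with (Lp * (Rabs (s - t) + normC r (diffC psi phi)) * M_Vg) by ring.
      apply Rmult_le_compat_l; [now apply Rmult_le_pos|vlra]. }
  assert (B := RSInt_integrator_diff r (fun th => p t (phi th))
    (fun th => g th s psi) (fun th => g th t phi)
    (fun th => gc th s psi) (fun th => gc th t phi)
    (fun k => eta k s psi) (fun k => eta k t phi)
    (fun k => h k s psi) (fun k => h k t phi) mid (Ffun r p g t phi) Fb
    (L_Vgc * (Rabs (s - t) + normC r (diffC psi phi))) e N Hr
    (p_comp_cont t phi H1) (fun th Hth => p_comp_bound t phi th H1 Hth)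
    (mixed_RSInt t s phi psi H1 H2) (mixed_RSInt t t phi phi H1 H1)
    (Hgd s psi H2) (Hgd t phi H1)
    (fun k => HA3_eta_range k s psi H2) (fun k => HA3_eta_range k t phi H1)
    (HA3_abs s psi H2) (HA3_abs t phi H1)
    (HA4 s t psi phi Hs Ht H2 H1) T1 T2).
  set (Q := rsum _ N).
  change (norm (minus mid (Ffun r p g t phi)) <=
    Fb * (L_Vgc * (Rabs (s - t) + normC r (diffC psi phi))) + 2 * Fb * e + Q) in B.
  vlra.
Qed.

(** For a fixed [phi] the map [theta |-> p t (phi theta)] is continuous, so moving [- eta k]
    slightly has little effect; no rate is available, and only finitely many jumps are treated. *)
Lemma jump_terms_cont (t : R) (phi : R -> X) (Fb : R) (N : nat) :
  isC r phi -> 0 <= Fb -> forall eps, 0 < eps -> exists delta, 0 < delta /\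
  forall s psi, isC r psi -> Rabs (s - t) < delta -> normC r (diffC psi phi) < delta ->
    rsum (fun k => Rabs (h k s psi - h k t phi) * Fb +
      Rabs (h k t phi) * norm (minus (p t (phi (- eta k s psi))) (p t (phi (- eta k t phi))))) N <= eps.
Proof.
  intros H1 HFb. induction N as [|N IH]; intros eps He.
  - exists 1; split; [vlra|]. intros. rewrite rsum_0. vlra.
  - destruct (IH (eps/2) ltac:(vlra)) as [d0 [Hd0 P0]].
    set (q := Rabs (h N t phi)). assert (Hq : 0 <= q) by apply Rabs_pos.
    destruct (HA3_h_cont N t phi H1 (eps / (4 * (Fb + 1)))) as [d1 [Hd1 P1]].
    { apply Rdiv_lt_0_compat; vlra. }
    destruct (p_comp_cont t phi H1 (- eta N t phi)) with (eps := eps / (4 * (q + 1)))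
      as [dx [Hdx Px]].
    { pose proof (HA3_eta_range N t phi H1). vlra. }
    { apply Rdiv_lt_0_compat; vlra. }
    destruct (HA3_eta_cont N t phi H1 dx Hdx) as [d2 [Hd2 P2]].
    destruct (pos_min3 d0 d1 d2 Hd0 Hd1 Hd2) as [d [Hd [L0 [L1 L2]]]].
    exists d. split; [exact Hd|]. intros s psi H2 Hs Hn.
    rewrite rsum_S. specialize (P0 s psi H2 ltac:(vlra) ltac:(vlra)).
    specialize (P1 s psi H2 ltac:(vlra) ltac:(vlra)). specialize (P2 s psi H2 ltac:(vlra) ltac:(vlra)).
    assert (A : Rabs (h N s psi - h N t phi) * Fb <= eps / 4).
    { apply Rle_trans with (eps / (4 * (Fb + 1)) * (Fb + 1)); [|right; field; vlra].
      apply Rmult_le_compat; try vlra. apply Rabs_pos. }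
    assert (B : q * norm (minus (p t (phi (- eta N s psi))) (p t (phi (- eta N t phi)))) <= eps / 4).
    { apply Rle_trans with ((q + 1) * (eps / (4 * (q + 1)))); [|right; field; vlra].
      apply Rmult_le_compat; try vlra; [apply norm_ge_0|]. left. apply Px.
      - pose proof (HA3_eta_range N s psi H2). vlra.
      - replace (- eta N s psi - - eta N t phi) with (- (eta N s psi - eta N t phi)) by ring.
        now rewrite Rabs_Ropp. }
    fold q. vlra.
Qed.

Lemma Ffun_cont (t : R) (phi : R -> X) : a <= t -> isC r phi ->
  forall eps, 0 < eps -> exists delta, 0 < delta /\
  forall s psi, a <= s -> isC r psi -> Rabs (s - t) < delta -> normC r (diffC psi phi) < delta ->
    norm (minus (Ffun r p g s psi) (Ffun r p g t phi)) < eps.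
Proof.
  intros Ht H1 eps He.
  set (Fb := C1 * normC r phi + C2). assert (HFb : 0 <= Fb) by now apply growth_ge_0.
  (* The perturbed data stay within distance 1, so this radius covers them as well, and the
     truncation index [N] can be fixed before the final [delta]. *)
  set (Rb := Rabs t + normC r phi + 2).
  pose proof (normC_ge_0 r phi Hr0 H1) as Hn0. pose proof (Rabs_pos t) as Ht0.
  set (e := eps / (8 * (Fb + 1))).
  assert (Hee : 0 < e) by (unfold e; apply Rdiv_lt_0_compat; vlra).
  destruct (HA3_unif Rb ltac:(unfold Rb; vlra) e Hee) as [N HN].
  destruct (jump_terms_cont t phi Fb N H1 HFb (eps / 4) ltac:(vlra)) as [d1 [Hd1 P1]].
  set (K := Lp * M_Vg + Fb * L_Vgc + 1).
  assert (HK : 1 <= K).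
  { unfold K. pose proof (Rmult_le_pos _ _ Hp_L M_Vg_ge_0). pose proof (Rmult_le_pos _ _ HFb HA4_L). vlra. }
  set (d2 := eps / (8 * K)). assert (Hd2 : 0 < d2) by (unfold d2; apply Rdiv_lt_0_compat; vlra).
  destruct (pos_min3 1 d1 d2 Rlt_0_1 Hd1 Hd2) as [d [Hd [L0 [L1 L2]]]].
  exists d. split; [exact Hd|]. intros s psi Hs H2 Hst Hn.
  specialize (P1 s psi H2 ltac:(vlra) ltac:(vlra)).
  pose proof (normC_tri r phi psi Hr0 H1 H2) as Htri.
  assert (Hsb : Rabs s <= Rb).
  { unfold Rb. pose proof (Rabs_triang_inv s t). vlra. }
  eapply Rle_lt_trans.
  { apply (Ffun_diff t s phi psi N e Ht Hs H1 H2).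
    - intros m. exact (HN s psi H2 Hsb ltac:(unfold Rb; vlra) N m (le_n N)).
    - intros m. exact (HN t phi H1 ltac:(unfold Rb; vlra) ltac:(unfold Rb; vlra) N m (le_n N)). }
  fold Fb.
  assert (A : 2 * Fb * e <= eps / 4).
  { apply Rle_trans with (2 * (Fb + 1) * e); [|unfold e; right; field; vlra].
    apply Rmult_le_compat_r; vlra. }
  assert (B : (Lp * M_Vg + Fb * L_Vgc) * (Rabs (s - t) + normC r (diffC psi phi)) <= eps / 4).
  { apply Rle_trans with (K * (2 * d2)); [|unfold d2; right; field; vlra].
    pose proof (Rabs_pos (s - t)). pose proof (normC_ge_0 r _ Hr0 (isC_diffC r psi phi H2 H1)).
    apply Rmult_le_compat; unfold K in *; vlra. }
  vlra.
Qed.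

(** By (A5) all positions and heights of the jumps coincide, so the finite jump sum in [Ffun_diff]
    is zero; the remaining tail [e] is arbitrary. *)
Lemma Ffun_lip (t : R) (phi psi : R -> X) : a <= t -> isC r phi -> isC r psi ->
  (forall th, - r <= th <= - eta_ign t -> psi th = phi th) ->
  norm (minus (Ffun r p g t psi) (Ffun r p g t phi)) <=
    (Lp * M_Vg + (C1 * normC r phi + C2) * L_Vgc) * normC r (diffC psi phi).
Proof.
  intros Ht H1 H2 Heq. apply le_epsilon. intros eps He.
  set (Fb := C1 * normC r phi + C2). assert (HFb : 0 <= Fb) by now apply growth_ge_0.
  set (Rb := Rabs t + normC r phi + normC r psi + 1).
  pose proof (normC_ge_0 r phi Hr0 H1). pose proof (normC_ge_0 r psi Hr0 H2).
  pose proof (Rabs_pos t).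
  set (e := eps / (2 * (Fb + 1))).
  assert (Hee : 0 < e) by (unfold e; apply Rdiv_lt_0_compat; vlra).
  destruct (HA3_unif Rb ltac:(unfold Rb; vlra) e Hee) as [N HN].
  eapply Rle_trans.
  { apply (Ffun_diff t t phi psi N e Ht Ht H1 H2).
    - intros m. exact (HN t psi H2 ltac:(unfold Rb; vlra) ltac:(unfold Rb; vlra) N m (le_n N)).
    - intros m. exact (HN t phi H1 ltac:(unfold Rb; vlra) ltac:(unfold Rb; vlra) N m (le_n N)). }
  fold Fb. rewrite Rminus_diag, Rabs_R0, Rplus_0_l.
  assert (A : 2 * Fb * e <= eps).
  { apply Rle_trans with (2 * (Fb + 1) * e); [|unfold e; right; field; vlra].
    apply Rmult_le_compat_r; vlra. }
  rewrite (rsum_ext _ (fun _ => 0)).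
  - rewrite rsum_const. vlra.
  - intros k _. destruct (HA5 t psi phi Ht H2 H1 Heq k) as [-> ->].
    vcanon. rewrite norm_minus_diag, Rminus_diag, Rabs_R0. ring.
Qed.

Lemma Bfun_cont (t : R) (phi : R -> X) : a <= t -> isC r phi ->
  forall eps, 0 < eps -> exists delta, 0 < delta /\
  forall s psi, a <= s -> isC r psi -> Rabs (s - t) < delta -> normC r (diffC psi phi) < delta ->
    norm (minus (Bfun r G p g s psi) (Bfun r G p g t phi)) < eps.
Proof.
  intros Ht H1 eps He.
  pose proof (normC_ge_0 r phi Hr0 H1) as Hn0.
  set (f0 := norm (Ffun r p g t phi)). assert (Hf0 : 0 <= f0) by apply norm_ge_0.
  (* Large enough for the histories, the values of [Ffun] and the times within distance 1 of the
     given ones, so that one Lipschitz constant of [G] serves all. *)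
  set (R0 := normC r phi + f0 + (t - a) + 3).
  destruct (HG R0 ltac:(unfold R0; vlra)) as [LG [nu [HLG [Hnuc [Hnu0 [Hnuz HGl]]]]]].
  destruct (Ffun_cont t phi Ht H1 (Rmin 1 (eps / (4 * LG)))) as [d1 [Hd1 P1]].
  { apply Rmin_pos; [vlra|apply Rdiv_lt_0_compat; vlra]. }
  destruct (Hnuc 1 ltac:(vlra) 0 ltac:(vlra) (eps / 4) ltac:(vlra)) as [d2 [Hd2 P2]].
  set (d3 := eps / (4 * LG)). assert (Hd3 : 0 < d3) by (apply Rdiv_lt_0_compat; vlra).
  destruct (pos_min3 d1 d2 d3 Hd1 Hd2 Hd3) as [d4 [Hd4 [L1 [L2 L3]]]].
  set (d := Rmin 1 d4).
  assert (Hd : 0 < d) by (apply Rmin_pos; vlra).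
  assert (L0 : d <= 1) by apply Rmin_l. assert (L4 : d <= d4) by apply Rmin_r.
  exists d; split; auto. intros s psi Hs H2 Hst Hn.
  specialize (P1 s psi Hs H2 ltac:(vlra) ltac:(vlra)).
  destruct (Rmin_Rgt_l _ _ _ P1) as [P1a P1b].
  pose proof (Rabs_pos (s - t)) as Hst0.
  specialize (P2 (Rabs (s - t)) ltac:(vlra)).
  rewrite Rminus_0_r, Rabs_Rabsolu in P2. specialize (P2 ltac:(vlra)).
  change (norm (minus (nu (Rabs (s - t))) (nu 0))) with (Rabs (nu (Rabs (s - t)) - nu 0)) in P2.
  rewrite Hnuz, Rminus_0_r, Rabs_right in P2 by (apply Rle_ge; auto).
  assert (N0 : norm (minus (psi 0) (phi 0)) <= normC r (diffC psi phi)).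
  { apply (normC_ge r (diffC psi phi) 0); [now apply isC_diffC|vlra]. }
  pose proof (normC_ge r phi 0 H1 ltac:(vlra)) as N1.
  pose proof (norm_le_minus (psi 0) (phi 0)) as N2.
  pose proof (norm_le_minus (Ffun r p g s psi) (Ffun r p g t phi)) as N3.
  apply Rabs_def2 in Hst as Hst'.
  unfold Bfun. eapply Rle_lt_trans.
  { apply HGl; unfold R0; fold f0 in N3; unfold f0 in *; vlra. }
  assert (Q : LG * (norm (minus (psi 0) (phi 0)) +
    norm (minus (Ffun r p g s psi) (Ffun r p g t phi))) <= LG * (2 * d3)).
  { apply Rmult_le_compat_l; [vlra|]. fold d3 in P1b. vlra. }
  replace (LG * (2 * d3)) with (eps / 2) in Q by (unfold d3; field; vlra).
  vlra.
Qed.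

(** [FB] bounds [Ffun] on the ball, which fixes the radius at which [G] is used. The bound [M] comes
    from comparison with [G a zero zero], and [eta0] is a positive lower bound of [eta_ign] on
    [[a, a + R1]]. *)
Lemma Bfun_bounded_lip (R1 : R) : 0 < R1 -> exists L M eta0,
  0 <= L /\ 0 <= M /\ 0 < eta0 /\ bounded_lip r a (Bfun r G p g) R1 L M eta0.
Proof.
  intros HR1.
  pose proof M_Vg_ge_0 as HM.
  pose proof (Rmult_le_pos _ _ Hp_C1 (Rlt_le _ _ HR1)) as HC.
  pose proof (Rmult_le_pos (C1 * R1 + C2) M_Vg ltac:(vlra) HM) as HCM.
  set (FB := (C1 * R1 + C2) * M_Vg) in *.
  assert (HF : forall t phi, isC r phi -> normC r phi <= R1 -> norm (Ffun r p g t phi) <= FB).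
  { intros t phi H1 Hn. eapply Rle_trans; [now apply Ffun_bound|].
    apply Rmult_le_compat_r; auto. apply Rplus_le_compat_r. now apply Rmult_le_compat_l. }
  assert (H0 : forall phi : R -> X, isC r phi -> normC r phi <= R1 -> norm (phi 0) <= R1).
  { intros phi H1 Hn. pose proof (normC_ge r phi 0 H1 ltac:(vlra)). vlra. }
  set (R0 := R1 + FB).
  destruct (HG R0 ltac:(unfold R0; vlra)) as [LG [nu [HLG [Hnuc [Hnu0 [Hnuz HGl]]]]]].
  destruct (cont_on_bounded _ _ _ (Hnuc R1 ltac:(vlra))) as [nuM [HnuM0 HnuM]].
  destruct (cont_on_pos_lower eta_ign a (a + R1) ltac:(vlra) (HA5_cont (a + R1) ltac:(vlra)))
    as [eta0 [Heta0 Heta]].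
  { intros t Ht. apply HA5_pos; vlra. }
  set (Fb := C1 * R1 + C2).
  exists (LG * (1 + (Lp * M_Vg + Fb * L_Vgc))), (norm (G a zero zero) + nuM + LG * (R1 + FB)), eta0.
  assert (HK : 0 <= Lp * M_Vg + Fb * L_Vgc).
  { pose proof (Rmult_le_pos _ _ Hp_L HM). pose proof (Rmult_le_pos Fb L_Vgc ltac:(unfold Fb; vlra) HA4_L). vlra. }
  split; [apply Rmult_le_pos; vlra|]. split.
  { pose proof (norm_ge_0 (G a zero zero)). pose proof (Rmult_le_pos LG (R1 + FB) ltac:(vlra) ltac:(vlra)). vlra. }
  split; auto. intros t Ht. split.
  - intros phi H1 Hn. pose proof (HF t phi H1 Hn) as A. pose proof (H0 phi H1 Hn) as A0.
    unfold Bfun.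
    pose proof (norm_le_minus (G t (phi 0) (Ffun r p g t phi)) (G a zero zero)) as B.
    assert (D : norm (minus (G t (phi 0) (Ffun r p g t phi)) (G a zero zero)) <=
      nu (Rabs (t - a)) + LG * (norm (minus (phi 0) zero) + norm (minus (Ffun r p g t phi) zero))).
    { apply HGl; unfold R0; try vlra; (eapply Rle_trans; [apply Req_le; exact norm_zero|vlra]). }
    assert (E1 : norm (minus (phi 0) zero) <= norm (phi 0))
      by exact (norm_minus_zero_le (phi 0)).
    assert (E2 : norm (minus (Ffun r p g t phi) zero) <= norm (Ffun r p g t phi))
      by exact (norm_minus_zero_le (Ffun r p g t phi)).
    assert (F : LG * (norm (minus (phi 0) zero) + norm (minus (Ffun r p g t phi) zero)) <= LG * (R1 + FB)).
    { apply Rmult_le_compat_l; vlra. }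
    assert (Nu : nu (Rabs (t - a)) <= nuM).
    { specialize (HnuM (Rabs (t - a))). rewrite (Rabs_right (t - a)) in * by vlra.
      specialize (HnuM ltac:(vlra)).
      eapply Rle_trans; [apply Rle_abs|exact HnuM]. }
    vlra.
  - intros phi psi H1 H2 Hn1 Hn2 Heq. unfold Bfun.
    pose proof (isC_diffC r psi phi H2 H1) as Hd.
    pose proof (HF t phi H1 Hn1). pose proof (H0 phi H1 Hn1).
    pose proof (HF t psi H2 Hn2). pose proof (H0 psi H2 Hn2).
    eapply Rle_trans; [apply HGl; unfold R0; vlra|].
    rewrite Rminus_diag, Rabs_R0, Hnuz, Rplus_0_l, Rmult_assoc.
    apply Rmult_le_compat_l; [vlra|]. rewrite Rmult_plus_distr_r, Rmult_1_l.
    apply Rplus_le_compat; [exact (normC_ge r (diffC psi phi) 0 Hd ltac:(vlra))|].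
    eapply Rle_trans.
    + apply (Ffun_lip t phi psi); auto; [vlra|].
      intros th Hth. apply Heq. specialize (Heta t Ht). vlra.
    + apply Rmult_le_compat_r; [now apply normC_ge_0|]. apply Rplus_le_compat_l.
      apply Rmult_le_compat_r; auto. apply Rplus_le_compat_r. now apply Rmult_le_compat_l.
Qed.
End Nonlinearity.

(** * The semigroup and its convolutions *)

(** A linear map commutes with Riemann sums, and its boundedness lets it pass to their limit. *)
Lemma is_RInt_linear {V : NormedModule R_AbsRing} (L : V -> V) (f : R -> V) (lo hi : R) (l : V) (c : R) :
  (forall x y, L (plus x y) = plus (L x) (L y)) ->
  (forall k x, L (scal k x) = scal k (L x)) ->
  (forall x, norm (L x) <= c * norm x) ->
  is_RInt f lo hi l -> is_RInt (fun s => L (f s)) lo hi (L l).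
Proof.
  intros Lp Ls Lb H. unfold is_RInt in *.
  assert (E : forall ptd, scal (sign (hi - lo)) (Riemann_sum (fun s => L (f s)) ptd) =
    L (scal (sign (hi - lo)) (Riemann_sum f ptd))).
  { intros ptd. rewrite Ls. f_equal. apply SF_cons_ind with (s := ptd).
    - intros x0. change (zero = L zero). replace (zero : V) with (scal 0 (zero : V)) by vec.
      rewrite Ls. vec.
    - intros h0 s IH. rewrite !Riemann_sum_cons, Lp, Ls, IH. reflexivity. }
  apply filterlim_ext with (fun ptd => L (scal (sign (hi - lo)) (Riemann_sum f ptd))).
  { intros; symmetry; apply E. }
  apply (filterlim_comp _ _ _ _ _ _ _ _ H).
  apply (proj2 (filterlim_locally_ball_norm L (L l))). intros eps.
  assert (Hc : 0 < eps / (Rabs c + 1)).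
  { apply Rdiv_lt_0_compat; [apply cond_pos|]. pose proof (Rabs_pos c); lra. }
  pose proof (locally_le_locally_norm l) as Hl.
  apply Hl. exists (mkposreal _ Hc). intros y Hy. unfold ball_norm in *. simpl in Hy.
  assert (E1 : minus (L y) (L l) = L (minus y l)).
  { replace (minus y l) with (plus y (scal (-1) l)) by vec. rewrite Lp, Ls. vec. }
  rewrite E1. eapply Rle_lt_trans; [apply Lb|].
  pose proof (norm_ge_0 (minus y l)). pose proof (Rle_abs c). pose proof (Rabs_pos c).
  apply Rle_lt_trans with ((Rabs c + 1) * norm (minus y l)).
  - apply Rmult_le_compat_r; lra.
  - apply Rlt_le_trans with ((Rabs c + 1) * (eps / (Rabs c + 1))).
    + apply Rmult_lt_compat_l; lra.
    + right; field; lra.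
Qed.

Section Semigroup.
Context {X : CompleteNormedModule R_AbsRing} (S : R -> X -> X) (omega : R)
  (HS : compact_C0_semigroup S omega).

(** Extended by the identity to negative times, so that integrands such as [St (t - s) (f s)] are
    continuous in [s] on the whole line. *)
Definition St (t : R) (x : X) : X := S (Rmax 0 t) x.
(** The absolute value makes the growth bound monotone, and at least 1 at nonnegative times, also
    for negative [omega]. *)
Definition gw (t : R) : R := exp (Rabs omega * t).

Lemma gw_pos (t : R) : 0 < gw t.
Proof. apply exp_pos. Qed.

Lemma gw_mono (s t : R) : s <= t -> gw s <= gw t.
Proof.
  intros H. unfold gw. destruct (Req_dec s t) as [->|Hne]; [lra|].
  pose proof (Rabs_pos omega) as H0.
  assert (H1 : Rabs omega * s <= Rabs omega * t) by (apply Rmult_le_compat_l; lra).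
  destruct H1 as [H1|H1]; [left; now apply exp_increasing|rewrite H1; lra].
Qed.

Lemma gw_ge_1 (t : R) : 0 <= t -> 1 <= gw t.
Proof.
  intros H. replace 1 with (gw 0); [now apply gw_mono|]. unfold gw. now rewrite Rmult_0_r, exp_0.
Qed.

Lemma gw_plus (s t : R) : gw (s + t) = gw s * gw t.
Proof. unfold gw. rewrite Rmult_plus_distr_l. apply exp_plus. Qed.

Lemma St_plus (t : R) (x y : X) : St t (plus x y) = plus (St t x) (St t y).
Proof. apply HS. apply Rmax_l. Qed.

Lemma St_scal (t k : R) (x : X) : St t (scal k x) = scal k (St t x).
Proof. destruct HS as [_ [H _]]. apply H. apply Rmax_l. Qed.

Lemma St_minus (t : R) (x y : X) : St t (minus x y) = minus (St t x) (St t y).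
Proof.
  transitivity (St t (plus x (scal (-1) y))); [f_equal; vec|].
  rewrite St_plus, St_scal. vec.
Qed.

Lemma St_0 (t : R) (x : X) : t <= 0 -> St t x = x.
Proof.
  intros H. unfold St. rewrite Rmax_left by lra. destruct HS as [_ [_ [H0 _]]]. apply H0.
Qed.

Lemma St_semi (t s : R) (x : X) : 0 <= t -> 0 <= s -> St (t + s) x = St t (St s x).
Proof.
  intros H1 H2. unfold St. rewrite !Rmax_right by lra.
  destruct HS as [_ [_ [_ [H0 _]]]]. now apply H0.
Qed.

Lemma St_S (t : R) (x : X) : 0 <= t -> St t x = S t x.
Proof. intros H. unfold St. now rewrite Rmax_right. Qed.

Lemma St_norm (T t : R) (x : X) : 0 <= T -> t <= T -> norm (St t x) <= gw T * norm x.
Proof.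
  intros HT Ht. unfold St. destruct HS as [_ [_ [_ [_ [_ [H0 _]]]]]].
  eapply Rle_trans; [apply H0; apply Rmax_l|].
  apply Rmult_le_compat_r; [apply norm_ge_0|].
  apply Rle_trans with (gw (Rmax 0 t)); [|apply gw_mono; now apply Rmax_lub].
  unfold gw.
  assert (H1 : omega * Rmax 0 t <= Rabs omega * Rmax 0 t).
  { apply Rmult_le_compat_r; [apply Rmax_l|apply Rle_abs]. }
  destruct H1 as [H1|H1]; [left; now apply exp_increasing|rewrite H1; lra].
Qed.

Lemma St_diff_norm (T t : R) (x y : X) : 0 <= T -> t <= T ->
  norm (minus (St t x) (St t y)) <= gw T * norm (minus x y).
Proof. intros. rewrite <- St_minus. now apply St_norm. Qed.

Lemma St_near_0 (x : X) (eps : R) : 0 < eps ->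
  exists d, 0 < d /\ forall t, t < d -> norm (minus (St t x) x) < eps.
Proof.
  intros He. destruct HS as [_ [_ [_ [_ [H0 _]]]]].
  destruct (proj1 (at_right_eps _ _ _) (H0 x) eps He) as [d [Hd H]].
  exists d; split; auto. intros t Ht.
  destruct (Rle_dec t 0) as [Ht0|Ht0].
  - rewrite St_0 by auto. vcanon. rewrite norm_minus_diag. auto.
  - rewrite St_S by lra. apply H. lra.
Qed.

(** Of two nearby times the later is the earlier plus a short increment, so the operator at the
    earlier time is applied to a small vector. The estimate is symmetric, and left continuity
    follows from right continuity at 0. *)
Lemma St_cont (x : X) (t : R) : continuous (fun t => St t x) t.
Proof.
  apply (proj2 (continuous_eps (fun t => St t x) t)). intros eps He.
  set (T := Rmax 0 t + 1). assert (HT : 1 <= T) by (unfold T; pose proof (Rmax_l 0 t); lra).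
  assert (HtT : t + 1 <= T) by (unfold T; pose proof (Rmax_r 0 t); lra).
  pose proof (gw_pos T) as Hg.
  destruct (St_near_0 x (eps / gw T)) as [d [Hd H]]; [now apply Rdiv_lt_0_compat|].
  assert (Key : forall s s', s <= T -> s <= s' -> s' - s < d -> norm (minus (St s' x) (St s x)) < eps).
  { intros s s' HsT Hss Hd'. destruct (Rle_dec s 0) as [Hs|Hs].
    - rewrite (St_0 s) by auto. apply Rlt_le_trans with (eps / gw T).
      + destruct (Rle_dec s' 0); [rewrite St_0 by auto; vcanon; rewrite norm_minus_diag; now apply Rdiv_lt_0_compat|].
        destruct (Rlt_dec s' d); [apply H; auto|].
        exfalso. lra.
      + pose proof (gw_ge_1 T ltac:(lra)). apply Rmult_le_reg_r with (gw T); auto.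
        unfold Rdiv. rewrite Rmult_assoc, Rinv_l, Rmult_1_r by lra.
        rewrite <- (Rmult_1_r eps) at 1. apply Rmult_le_compat_l; lra.
    - replace s' with (s + (s' - s)) by ring. rewrite St_semi by lra.
      eapply Rle_lt_trans; [apply (St_diff_norm T); lra|].
      specialize (H (s' - s) Hd').
      apply Rlt_le_trans with (gw T * (eps / gw T)); [now apply Rmult_lt_compat_l|].
      right; field; lra. }
  exists (Rmin 1 d). split; [apply Rmin_pos; lra|]. intros s Hs.
  destruct (Rmin_Rgt_l _ _ _ Hs) as [H1 H2].
  apply Rabs_def2 in H1. apply Rabs_def2 in H2.
  destruct (Rle_dec t s).
  - apply Key; lra.
  - vcanon. rewrite norm_minus_sym. apply Key; lra.
Qed.

Lemma St_comp_cont (f : R -> X) (t : R) :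
  (forall s, continuous f s) -> forall s, continuous (fun s => St (t - s) (f s)) s.
Proof.
  intros Hf s. apply (proj2 (continuous_eps (fun s => St (t - s) (f s)) s)). intros eps He.
  set (T := Rmax 0 (t - s) + 1). assert (HT : 1 <= T) by (unfold T; pose proof (Rmax_l 0 (t - s)); lra).
  assert (HtT : t - s + 1 <= T) by (unfold T; pose proof (Rmax_r 0 (t - s)); lra).
  pose proof (gw_pos T) as Hg.
  destruct (proj1 (continuous_eps f s) (Hf s) (eps / (2 * gw T))) as [d1 [Hd1 P1]].
  { apply Rdiv_lt_0_compat; lra. }
  destruct (proj1 (continuous_eps (fun t => St t (f s)) (t - s)) (St_cont (f s) (t - s)) (eps / 2) ltac:(lra))
    as [d2 [Hd2 P2]].
  destruct (pos_min3 1 d1 d2 Rlt_0_1 Hd1 Hd2) as [d [Hd [L0 [L1 L2]]]].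
  exists d. split; [exact Hd|]. intros y Hy.
  specialize (P1 y ltac:(lra)).
  specialize (P2 (t - y) ltac:(replace (t - y - (t - s)) with (- (y - s)) by ring; rewrite Rabs_Ropp; lra)).
  assert (Hy1 : Rabs (y - s) < 1) by lra. apply Rabs_def2 in Hy1.
  eapply Rle_lt_trans; [apply (norm_minus_tri _ (St (t - y) (f s)))|].
  pose proof (St_diff_norm T (t - y) (f y) (f s) ltac:(lra) ltac:(lra)) as A.
  assert (B : gw T * norm (minus (f y) (f s)) <= eps / 2).
  { apply Rle_trans with (gw T * (eps / (2 * gw T))); [apply Rmult_le_compat_l; vlra|].
    right; field; lra. }
  vlra.
Qed.

Definition conv (f : R -> X) (t0 t : R) : X := RInt (fun s => St (t - s) (f s)) t0 t.

Lemma conv_ex (f : R -> X) (t lo hi : R) :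
  (forall s, continuous f s) -> ex_RInt (fun s => St (t - s) (f s)) lo hi.
Proof. intros Hf. apply ex_RInt_continuous. intros z _. now apply St_comp_cont. Qed.

Lemma conv_is (f : R -> X) (t0 t : R) :
  (forall s, continuous f s) -> is_RInt (fun s => St (t - s) (f s)) t0 t (conv f t0 t).
Proof. intros Hf. apply (RInt_correct (V := X)). now apply conv_ex. Qed.

Lemma conv_point (f : R -> X) (t : R) : conv f t t = zero.
Proof. apply (RInt_point (V := X)). Qed.

Lemma conv_ext (f f' : R -> X) (t0 t : R) : t0 <= t ->
  (forall s, t0 <= s <= t -> f s = f' s) -> conv f t0 t = conv f' t0 t.
Proof.
  intros Ht H. apply (RInt_ext (V := X)). intros x. rewrite Rmin_left, Rmax_right by lra. intros Hx.
  rewrite H by lra. reflexivity.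
Qed.

Lemma conv_diff_bound (f f' : R -> X) (t0 t c : R) :
  (forall s, continuous f s) -> (forall s, continuous f' s) -> t0 <= t -> 0 <= c ->
  (forall s, t0 <= s <= t -> norm (minus (f s) (f' s)) <= c) ->
  norm (minus (conv f t0 t) (conv f' t0 t)) <= gw (t - t0) * c * (t - t0).
Proof.
  intros Hf Hf' Ht Hc H.
  pose proof (is_RInt_minus _ _ _ _ _ _ (conv_is f t0 t Hf) (conv_is f' t0 t Hf')) as I.
  rewrite Rmult_comm.
  refine (norm_RInt_le_const _ _ _ _ _ Ht _ I). intros s Hs.
  eapply Rle_trans; [apply (St_diff_norm (t - t0)); lra|].
  apply Rmult_le_compat_l; [left; apply gw_pos|]. now apply H.
Qed.

Lemma conv_bound (f : R -> X) (t0 t c : R) :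
  (forall s, continuous f s) -> t0 <= t -> 0 <= c ->
  (forall s, t0 <= s <= t -> norm (f s) <= c) ->
  norm (conv f t0 t) <= gw (t - t0) * c * (t - t0).
Proof.
  intros Hf Ht Hc H. rewrite Rmult_comm.
  refine (norm_RInt_le_const _ _ _ _ _ Ht _ (conv_is f t0 t Hf)). intros s Hs.
  eapply Rle_trans; [apply (St_norm (t - t0)); lra|].
  apply Rmult_le_compat_l; [left; apply gw_pos|]. now apply H.
Qed.

(** On [[t0, m]] the semigroup law factors out the bounded operator [St (t - m)], which commutes
    with the integral. *)
Lemma conv_chasles (f : R -> X) (t0 m t : R) :
  (forall s, continuous f s) -> t0 <= m -> m <= t ->
  conv f t0 t = plus (St (t - m) (conv f t0 m)) (conv f m t).
Proof.
  intros Hf H1 H2. unfold conv at 1.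
  rewrite <- (RInt_Chasles (V := X) _ t0 m t) by now apply conv_ex.
  f_equal.
  apply (is_RInt_unique (V := X)).
  apply (is_RInt_ext (fun s => St (t - m) (St (m - s) (f s)))).
  { intros x. rewrite Rmin_left, Rmax_right by lra. intros Hx.
    replace (t - x) with ((t - m) + (m - x)) by ring. rewrite St_semi by lra. reflexivity. }
  apply (is_RInt_linear (St (t - m)) _ t0 m (conv f t0 m) (gw (t - m))).
  - intros; apply St_plus.
  - intros; apply St_scal.
  - intros; apply St_norm; lra.
  - now apply conv_is.
Qed.

(* Up to an error linear in time, [z] is transported by the semigroup; so near any point it
   inherits the continuity of the orbit through a slightly earlier value. *)
Lemma quasi_orbit_cont (z : R -> X) (t0 T C : R) : 0 <= C ->
  (forall s t, t0 <= s -> s <= t -> t <= T -> norm (minus (z t) (St (t - s) (z s))) <= C * (t - s)) ->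
  cont_on z t0 T.
Proof.
  intros HC H t1 Ht1 eps He.
  set (kap := eps / (8 * (C + 1))).
  assert (Hk : 0 < kap) by (unfold kap; apply Rdiv_lt_0_compat; lra).
  assert (HCk : C * kap <= eps / 8).
  { apply Rle_trans with ((C + 1) * kap); [apply Rmult_le_compat_r; lra|].
    unfold kap. right; field; lra. }
  (* Every [t] in the interval within [kap] of [t1] satisfies [k <= t], so a single orbit starting
     at [k] serves both sides of [t1]. *)
  set (k := Rmax t0 (t1 - kap)).
  assert (K1 : t0 <= k) by apply Rmax_l.
  assert (K2 : t1 - kap <= k) by apply Rmax_r.
  assert (K3 : k <= t1) by (apply Rmax_lub; lra).
  assert (K4 : k = t0 \/ k = t1 - kap).
  { unfold k, Rmax. case_Rle; auto. }
  destruct (proj1 (continuous_eps (fun t => St t (z k)) (t1 - k)) (St_cont (z k) (t1 - k)) (eps / 4) ltac:(lra))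
    as [d [Hd P]].
  exists (Rmin d kap). split; [now apply Rmin_pos|]. intros t Ht Htt.
  destruct (Rmin_Rgt_l _ _ _ Htt) as [H1 H2]. apply Rabs_def2 in H2.
  assert (Hkt : k <= t) by (destruct K4; lra).
  specialize (P (t - k) ltac:(replace (t - k - (t1 - k)) with (t - t1) by ring; auto)).
  pose proof (H k t K1 Hkt ltac:(lra)) as A. pose proof (H k t1 K1 K3 ltac:(lra)) as B.
  assert (A' : C * (t - k) <= C * (2 * kap)) by (apply Rmult_le_compat_l; lra).
  assert (B' : C * (t1 - k) <= C * kap) by (apply Rmult_le_compat_l; lra).
  eapply Rle_lt_trans.
  { apply (norm_plus3 _ (minus (z t) (St (t - k) (z k)))
      (minus (St (t - k) (z k)) (St (t1 - k) (z k))) (minus (St (t1 - k) (z k)) (z t1))). vec. }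
  rewrite (norm_minus_sym (St (t1 - k) (z k))). vlra.
Qed.

Lemma conv_cont_on (f : R -> X) (t0 T : R) :
  (forall s, continuous f s) -> cont_on (conv f t0) t0 T.
Proof.
  intros Hf. destruct (Rle_dec t0 T) as [HT|HT]; [|intros x Hx; lra].
  destruct (cont_on_bounded f t0 T (continuous_cont_on f t0 T (fun x _ => Hf x))) as [M [HM0 HM]].
  apply (quasi_orbit_cont _ t0 T (gw (T - t0) * M)).
  { apply Rmult_le_pos; auto. left; apply gw_pos. }
  intros s t H1 H2 H3. rewrite (conv_chasles f t0 s t) by auto.
  replace (minus (plus (St (t - s) (conv f t0 s)) (conv f s t)) (St (t - s) (conv f t0 s)))
    with (conv f s t) by vec.
  eapply Rle_trans; [apply (conv_bound f s t M); auto|].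
  - intros x Hx. apply HM; lra.
  - apply Rmult_le_compat_r; [lra|]. apply Rmult_le_compat_r; auto. apply gw_mono; lra.
Qed.

Lemma conv_clamp_cont (f : R -> X) (t0 T : R) :
  (forall s, continuous f s) -> t0 <= T -> forall y, continuous (fun y => conv f t0 (clamp t0 T y)) y.
Proof. intros Hf HT. apply (cont_on_clamp (conv f t0)); auto. now apply conv_cont_on. Qed.
End Semigroup.

(** * Mild solutions *)

Lemma pow_half_small (c eps : R) : 0 < eps -> exists n, c * (/ 2) ^ n < eps.
Proof.
  intros He. destruct (pow_lt_1_zero (/ 2)) with (y := eps / (Rabs c + 1)) as [N HN].
  - rewrite Rabs_right; lra.
  - apply Rdiv_lt_0_compat; auto. pose proof (Rabs_pos c). lra.
  - exists N. specialize (HN N (le_n N)).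
    assert (Hp : 0 < (/ 2) ^ N) by (apply pow_lt; lra).
    rewrite Rabs_right in HN by lra.
    pose proof (Rabs_pos c). pose proof (Rle_abs c).
    apply Rle_lt_trans with ((Rabs c + 1) * (/ 2) ^ N); [apply Rmult_le_compat_r; lra|].
    apply Rlt_le_trans with ((Rabs c + 1) * (eps / (Rabs c + 1))); [apply Rmult_lt_compat_l; lra|].
    right; field; lra.
Qed.

Lemma pow_half_le (n m : nat) : (n <= m)%nat -> (/ 2) ^ m <= (/ 2) ^ n.
Proof.
  induction 1 as [|m _ IH]; [lra|]. assert (0 < (/ 2) ^ m) by (apply pow_lt; lra). simpl. lra.
Qed.

(** A contraction argument without suprema: iterating the improvement from [c0] gives the bounds
    [2 * E + c0 * (/ 2) ^ n]. It serves for uniqueness with [E = 0] and for error estimates. *)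
Lemma halving (P : R -> Prop) (d : R -> R) (c0 E : R) : 0 <= E -> 0 <= c0 ->
  (forall t, P t -> d t <= c0) ->
  (forall c, 0 <= c -> (forall t, P t -> d t <= c) -> forall t, P t -> d t <= E + c / 2) ->
  forall t, P t -> d t <= 2 * E.
Proof.
  intros HE Hc0 H0 Hs t Ht.
  assert (H : forall n, forall t, P t -> d t <= 2 * E + c0 * (/ 2) ^ n).
  { induction n as [|n IH]; intros s Hs'.
    - simpl. specialize (H0 s Hs'). lra.
    - assert (Hp : 0 <= c0 * (/ 2) ^ n) by (apply Rmult_le_pos; auto; apply pow_le; lra).
      specialize (Hs (2 * E + c0 * (/ 2) ^ n) ltac:(lra) IH s Hs'). simpl. lra. }
  apply le_epsilon. intros eps He. destruct (pow_half_small c0 eps He) as [n Hn].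
  specialize (H n t Ht). lra.
Qed.

Lemma geometric_limit {X : CompleteNormedModule R_AbsRing} (s : nat -> X) (c : R) :
  (forall n, norm (minus (s (S n)) (s n)) <= c * (/ 2) ^ n) ->
  exists l, forall n, norm (minus l (s n)) <= 2 * c * (/ 2) ^ n.
Proof.
  intros H.
  (* The subtracted power makes the induction on [k] close; it is dropped afterwards. *)
  assert (Hk : forall n k, norm (minus (s (n + k)%nat) (s n)) <= 2 * c * ((/ 2) ^ n - (/ 2) ^ (n + k))).
  { intros n k. induction k as [|k IH].
    - rewrite Nat.add_0_r. vcanon. rewrite norm_minus_diag. lra.
    - eapply Rle_trans; [apply (norm_minus_tri _ (s (n + k)%nat))|].
      specialize (H (n + k)%nat). rewrite Nat.add_succ_r. simpl pow. vlra. }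
  assert (Hc : 0 <= c).
  { specialize (H O). simpl in H. pose proof (norm_ge_0 (minus (s 1%nat) (s 0%nat))). vlra. }
  assert (Hpp : forall n, 0 < (/ 2) ^ n) by (intros; apply pow_lt; lra).
  assert (Hk' : forall n k, norm (minus (s (n + k)%nat) (s n)) <= 2 * c * (/ 2) ^ n).
  { intros n k. eapply Rle_trans; [apply Hk|]. apply Rmult_le_compat_l; [lra|].
    pose proof (Hpp (n + k)%nat). lra. }
  destruct (cauchy_seq_lim s) as [l Hl].
  { intros eps He. destruct (pow_half_small (4 * c) eps He) as [N HN]. exists N. intros n m Hn Hm.
    eapply Rle_lt_trans; [apply (norm_minus_tri _ (s N))|].
    rewrite (norm_minus_sym (s N)).
    pose proof (Hk' N (n - N)%nat) as A. pose proof (Hk' N (m - N)%nat) as B.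
    replace (N + (n - N))%nat with n in A by lia. replace (N + (m - N))%nat with m in B by lia. vlra. }
  exists l. intros n. apply le_epsilon. intros eps He.
  destruct (proj1 (seq_lim_eps s l) Hl eps He) as [N HN].
  specialize (HN (n + N)%nat ltac:(lia)). specialize (Hk' n N).
  eapply Rle_trans; [apply (norm_minus_tri _ (s (n + N)%nat))|].
  rewrite (norm_minus_sym l). vlra.
Qed.

Lemma continuous_uniform_limit {V : NormedModule R_AbsRing} (v : R -> V) :
  (forall eps, 0 < eps -> exists u, (forall x, continuous u x) /\
     forall x, norm (minus (v x) (u x)) <= eps) ->
  forall x, continuous v x.
Proof.
  intros H x. apply (proj2 (continuous_eps v x)). intros eps He.
  destruct (H (eps / 4) ltac:(lra)) as [u [Hu Hv]].
  destruct (proj1 (continuous_eps u x) (Hu x) (eps / 4) ltac:(lra)) as [d [Hd P]].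
  exists d; split; auto. intros y Hy. specialize (P y Hy).
  pose proof (Hv x). pose proof (Hv y).
  eapply Rle_lt_trans.
  { apply (norm_plus3 _ (minus (v y) (u y)) (minus (u y) (u x)) (minus (u x) (v x))). vec. }
  rewrite (norm_minus_sym (u x)). lra.
Qed.

Lemma continuous_glue {V : NormedModule R_AbsRing} (u v : R -> V) (t : R) :
  (forall x, continuous u x) -> (forall x, continuous v x) -> u t = v t ->
  forall x, continuous (fun y => if Rle_dec y t then u y else v y) x.
Proof.
  intros Hu Hv E x.
  apply (proj2 (continuous_eps (fun y => if Rle_dec y t then u y else v y) x)). intros eps He.
  destruct (proj1 (continuous_eps u x) (Hu x) eps He) as [d1 [Hd1 P1]].
  destruct (proj1 (continuous_eps v x) (Hv x) eps He) as [d2 [Hd2 P2]].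
  destruct (total_order_T x t) as [[Hx|Hx]|Hx].
  - exists (Rmin d1 (t - x)). split; [apply Rmin_pos; lra|]. intros y Hy.
    destruct (Rmin_Rgt_l _ _ _ Hy) as [H1 H2]. apply Rabs_def2 in H2.
    destruct (Rle_dec y t); [|lra]. destruct (Rle_dec x t); [|lra]. auto.
  - exists (Rmin d1 d2). split; [now apply Rmin_pos|]. intros y Hy.
    destruct (Rmin_Rgt_l _ _ _ Hy) as [H1 H2].
    destruct (Rle_dec x t); [|lra]. destruct (Rle_dec y t); auto.
    subst x. rewrite E. auto.
  - exists (Rmin d2 (x - t)). split; [apply Rmin_pos; lra|]. intros y Hy.
    destruct (Rmin_Rgt_l _ _ _ Hy) as [H1 H2]. apply Rabs_def2 in H2.
    destruct (Rle_dec y t); [lra|]. destruct (Rle_dec x t); [lra|]. auto.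
Qed.

Lemma continuous_clamp_comp {V : NormedModule R_AbsRing} (u : R -> V) (lo hi : R) :
  (forall x, continuous u x) -> forall x, continuous (fun y => u (clamp lo hi y)) x.
Proof.
  intros Hu x. apply (proj2 (continuous_eps (fun y => u (clamp lo hi y)) x)). intros eps He.
  destruct (proj1 (continuous_eps u (clamp lo hi x)) (Hu _) eps He) as [d [Hd P]].
  exists d; split; auto. intros y Hy. apply P.
  eapply Rle_lt_trans; [apply clamp_lip|exact Hy].
Qed.

Lemma continuous_translate {V : NormedModule R_AbsRing} (u : R -> V) (k : R) :
  (forall x, continuous u x) -> forall x, continuous (fun y => u (y - k)) x.
Proof.
  intros Hu x. apply (proj2 (continuous_eps (fun y => u (y - k)) x)). intros eps He.
  destruct (proj1 (continuous_eps u (x - k)) (Hu _) eps He) as [d [Hd P]].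
  exists d; split; auto. intros y Hy. apply P.
  now replace (y - k - (x - k)) with (y - x) by ring.
Qed.

Lemma Rmax_lip (a s y : R) : Rabs (Rmax a y - Rmax a s) <= Rabs (y - s).
Proof.
  unfold Rmax; case_Rle; unfold Rabs;
  repeat match goal with |- context[Rcase_abs ?x] => destruct (Rcase_abs x) end; lra.
Qed.

Section Mild.
Context {X : CompleteNormedModule R_AbsRing} (S : R -> X -> X) (omega : R)
  (HS : compact_C0_semigroup S omega) (r a : R) (Hr : 0 < r)
  (B : R -> (R -> X) -> X)
  (HBc : forall t phi, a <= t -> isC r phi -> forall eps, 0 < eps -> exists delta, 0 < delta /\
     forall s psi, a <= s -> isC r psi -> Rabs (s - t) < delta -> normC r (diffC psi phi) < delta ->
       norm (minus (B s psi) (B t phi)) < eps)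
  (HBl : forall R1, 0 < R1 -> exists L M eta0, 0 <= L /\ 0 <= M /\ 0 < eta0 /\
     bounded_lip r a B R1 L M eta0).

Local Notation "'stp'" := (St S).
Local Notation "'cnv'" := (conv S).
Local Notation "'gro'" := (gw omega).

(* [B s (seg v s)], frozen for [s < a] so as to be continuous on the whole line. *)
Definition fB (v : R -> X) (s : R) : X := B (Rmax a s) (seg v (Rmax a s)).

Lemma fB_eq (v : R -> X) (s : R) : a <= s -> fB v s = B s (seg v s).
Proof. intros H. unfold fB. now rewrite Rmax_right. Qed.

Lemma fB_cont (v : R -> X) : (forall x, continuous v x) -> forall s, continuous (fB v) s.
Proof.
  intros Hv s. apply (proj2 (continuous_eps (fB v) s)). intros eps He. unfold fB.
  destruct (HBc (Rmax a s) (seg v (Rmax a s)) (Rmax_l _ _) (isC_seg r v _ Hv) eps He) as [d [Hd P]].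
  destruct (seg_continuous r v (Rmax a s) ltac:(lra) Hv d Hd) as [d2 [Hd2 P2]].
  exists (Rmin d d2). split; [now apply Rmin_pos|]. intros y Hy.
  destruct (Rmin_Rgt_l _ _ _ Hy) as [H1 H2].
  pose proof (Rmax_lip a s y) as Hl.
  apply P; [apply Rmax_l|now apply isC_seg|lra|]. apply P2. lra.
Qed.

(** Elements of the phase space are represented by functions on the whole line, so independence of
    the values outside [[-r, 0]] must be proved. It follows from continuity, since the two histories
    have distance 0. *)
Lemma B_ext (t : R) (phi psi : R -> X) : a <= t -> isC r phi -> isC r psi ->
  (forall th, - r <= th <= 0 -> psi th = phi th) -> B t psi = B t phi.
Proof.
  intros Ht H1 H2 E. apply norm_minus_small_eq. intros eps He.
  destruct (HBc t phi Ht H1 eps He) as [d [Hd P]]. left. apply P; auto.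
  - rewrite Rminus_diag, Rabs_R0. auto.
  - apply Rle_lt_trans with 0; auto. apply normC_le; [lra|]. intros th Hth.
    unfold diffC. rewrite E by auto. vcanon. rewrite norm_minus_diag. lra.
Qed.

Lemma fB_ext (v v' : R -> X) (s : R) : (forall x, continuous v x) -> (forall x, continuous v' x) ->
  a <= s -> (forall x, s - r <= x <= s -> v x = v' x) -> fB v s = fB v' s.
Proof.
  intros Hv Hv' Hs E. rewrite !fB_eq by auto. apply B_ext; auto using isC_seg.
  intros th Hth. unfold seg. apply E. lra.
Qed.

(** The formula may start at any [t0], as continuation requires, and [v] is continuous on the whole
    line so that no integrability side conditions arise. *)
Definition mild (v : R -> X) (t0 T : R) : Prop :=
  (forall x, continuous v x) /\
  forall t, t0 <= t <= T -> v t = plus (stp (t - t0) (v t0)) (cnv (fB v) t0 t).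

Lemma mild_sub (v : R -> X) (t0 T T' : R) : T' <= T -> mild v t0 T -> mild v t0 T'.
Proof. intros HT [Hc H]. split; auto. intros t Ht. apply H. lra. Qed.

Lemma mild_ext (v v' : R -> X) (t0 T : R) : a <= t0 -> mild v t0 T -> (forall x, continuous v' x) ->
  (forall x, t0 - r <= x <= T -> v' x = v x) -> mild v' t0 T.
Proof.
  intros Ha [Hc H] Hc' E. split; auto. intros t Ht. rewrite !E by lra. rewrite (H t Ht) at 1.
  f_equal. apply conv_ext; [lra|]. intros s Hs. apply fB_ext; auto; [lra|].
  intros x Hx. symmetry. apply E. lra.
Qed.

Lemma mild_shift (v : R -> X) (t0 t1 T : R) : t0 <= t1 <= T -> mild v t0 T -> mild v t1 T.
Proof.
  intros H1 [Hc H]. split; auto. intros t Ht. rewrite (H t) by lra. rewrite (H t1) by lra.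
  rewrite (conv_chasles S omega HS (fB v) t0 t1 t) by (try lra; now apply fB_cont).
  rewrite (St_plus S omega HS). replace (t - t0) with ((t - t1) + (t1 - t0)) by ring.
  rewrite (St_semi S omega HS) by lra. vec.
Qed.

Lemma mild_concat (v : R -> X) (t0 t1 T : R) : t0 <= t1 <= T ->
  mild v t0 t1 -> mild v t1 T -> mild v t0 T.
Proof.
  intros H1 [Hc Ha] [_ Hb]. split; auto. intros t Ht.
  destruct (Rle_dec t t1) as [Hle|Hle]; [apply Ha; lra|].
  rewrite (Hb t) by lra. rewrite (Ha t1) at 1 by lra.
  rewrite (conv_chasles S omega HS (fB v) t0 t1 t) by (try lra; now apply fB_cont).
  rewrite (St_plus S omega HS). replace (t - t0) with ((t - t1) + (t1 - t0)) by ring.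
  rewrite (St_semi S omega HS) by lra. vec.
Qed.

Lemma seg_norm_le (v : R -> X) (s c : R) :
  (forall x, s - r <= x <= s -> norm (v x) <= c) -> normC r (seg v s) <= c.
Proof. intros H. apply normC_le; [lra|]. intros th Hth. apply H. lra. Qed.

(** As [t1 - t0 <= eta0], the part of a history at time [s <= t1] that is older than [eta0] lies
    before [t0], where [v] and [v'] coincide; this is the agreement that [bounded_lip] asks for. *)
Lemma fB_lip (R1 L M eta0 : R) (v v' : R -> X) (t0 t1 c : R) :
  bounded_lip r a B R1 L M eta0 ->
  0 <= L -> 0 <= c ->
  (forall x, continuous v x) -> (forall x, continuous v' x) ->
  a <= t0 -> t1 <= a + R1 -> t1 - t0 <= eta0 ->
  (forall x, t0 - r <= x <= t1 -> norm (v x) <= R1) ->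
  (forall x, t0 - r <= x <= t1 -> norm (v' x) <= R1) ->
  (forall x, t0 - r <= x <= t0 -> v x = v' x) ->
  (forall x, t0 <= x <= t1 -> norm (minus (v x) (v' x)) <= c) ->
  forall s, t0 <= s <= t1 -> norm (minus (fB v s) (fB v' s)) <= L * c.
Proof.
  intros HB HL Hc Hv Hv' H0 H1 He Bv Bv' E D s Hs. rewrite !fB_eq by lra.
  eapply Rle_trans.
  - apply (proj2 (HB s ltac:(lra))); auto using isC_seg.
    + apply seg_norm_le. intros x Hx. apply Bv'. lra.
    + apply seg_norm_le. intros x Hx. apply Bv. lra.
    + intros th Hth. unfold seg. apply E. lra.
  - apply Rmult_le_compat_l; auto. apply normC_le; [lra|]. intros th Hth. unfold diffC, seg.
    destruct (Rle_dec (s + th) t0) as [Hle|Hle]; [|apply D; lra].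
    rewrite E by lra. vcanon. rewrite norm_minus_diag. auto.
Qed.

(** On so short a step the difference of the convolutions is at most half the bound on the
    difference of the functions, so [halving] applies with error 0. *)
Lemma mild_unique_step (R1 L M eta0 : R) (u v : R -> X) (t0 t1 : R) :
  bounded_lip r a B R1 L M eta0 ->
  0 < R1 -> 0 <= L -> a <= t0 -> t0 <= t1 -> t1 <= a + R1 -> t1 - t0 <= eta0 ->
  gro (t1 - t0) * L * (t1 - t0) <= / 2 ->
  (forall x, t0 - r <= x <= t1 -> norm (u x) <= R1) ->
  (forall x, t0 - r <= x <= t1 -> norm (v x) <= R1) ->
  (forall x, t0 - r <= x <= t0 -> u x = v x) ->
  mild u t0 t1 -> mild v t0 t1 ->
  forall t, t0 <= t <= t1 -> u t = v t.
Proof.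
  intros HB HR1 HL H0 H01 H1 He Hsm Bu Bv E [Cu Hu] [Cv Hv] t Ht.
  apply norm_minus_small_eq. intros eps Heps.
  apply Rle_trans with (2 * 0); [|lra].
  revert t Ht.
  apply (halving (fun t => t0 <= t <= t1) (fun t => norm (minus (u t) (v t))) (2 * R1) 0); try lra.
  - intros t Ht. eapply Rle_trans; [apply (norm_minus_le (u t) (v t))|].
    pose proof (Bu t ltac:(lra)). pose proof (Bv t ltac:(lra)). lra.
  - intros c Hc Hd t Ht. rewrite (Hu t Ht), (Hv t Ht), (E t0) by lra.
    replace (minus (plus (stp (t - t0) (v t0)) (cnv (fB u) t0 t))
      (plus (stp (t - t0) (v t0)) (cnv (fB v) t0 t)))
      with (minus (cnv (fB u) t0 t) (cnv (fB v) t0 t)) by vec.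
    pose proof (Rmult_le_pos L c HL Hc) as HLc.
    eapply Rle_trans.
    + apply (conv_diff_bound S omega HS _ _ t0 t (L * c)); try lra; try now apply fB_cont.
      intros s Hs. apply (fB_lip R1 L M eta0 u v t0 t1 c); auto. lra.
    + assert (G0 : gro (t - t0) <= gro (t1 - t0)) by (apply gw_mono; lra).
      pose proof (gw_pos omega (t - t0)).
      apply Rle_trans with (gro (t1 - t0) * (L * c) * (t1 - t0)).
      * apply Rmult_le_compat; try lra.
        -- apply Rmult_le_pos; lra.
        -- apply Rmult_le_compat_r; auto.
      * replace (gro (t1 - t0) * (L * c) * (t1 - t0)) with
          ((gro (t1 - t0) * L * (t1 - t0)) * c) by ring.
        rewrite Rplus_0_l. unfold Rdiv. rewrite (Rmult_comm c).
        apply Rmult_le_compat_r; auto.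
Qed.

Lemma small_step_exists (K L eta0 : R) : 0 < K -> 0 <= L -> 0 < eta0 ->
  exists sg, 0 < sg /\ sg <= 1 /\ sg <= eta0 /\ K * L * sg <= / 2.
Proof.
  intros HK HL He. exists (Rmin 1 (Rmin eta0 (/ (2 * K * (L + 1))))).
  assert (HKL : 0 < 2 * K * (L + 1)) by (apply Rmult_lt_0_compat; lra).
  assert (Hi : 0 < / (2 * K * (L + 1))) by now apply Rinv_0_lt_compat.
  split; [repeat apply Rmin_pos; lra|]. split; [apply Rmin_l|].
  split; [eapply Rle_trans; [apply Rmin_r|apply Rmin_l]|].
  apply Rle_trans with (K * (L + 1) * / (2 * K * (L + 1))).
  - apply Rmult_le_compat.
    + apply Rmult_le_pos; lra.
    + repeat apply Rmin_glb; lra.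
    + apply Rmult_le_compat_l; lra.
    + eapply Rle_trans; [apply Rmin_r|apply Rmin_r].
  - right. field. split; lra.
Qed.

Lemma mild_unique (u v : R -> X) (t0 T : R) : a <= t0 -> mild u t0 T -> mild v t0 T ->
  (forall x, t0 - r <= x <= t0 -> u x = v x) ->
  forall t, t0 - r <= t <= T -> u t = v t.
Proof.
  intros Ha Mu Mv E.
  destruct (Rle_dec t0 T) as [HT|HT]; [|intros t Ht; apply E; lra].
  destruct (cont_on_bounded u (t0 - r) T (continuous_cont_on u _ _ (fun x _ => proj1 Mu x))) as [R2 [HR2 Bu]].
  destruct (cont_on_bounded v (t0 - r) T (continuous_cont_on v _ _ (fun x _ => proj1 Mv x))) as [R3 [HR3 Bv]].
  (* One radius for both functions and all times up to [T]; the step [sg] is therefore the same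
     throughout, and finitely many steps reach [T]. *)
  set (R1 := R2 + R3 + (T - a) + 1).
  destruct (HBl R1 ltac:(unfold R1; lra)) as [L [M [eta0 [HL [HM [Heta HB]]]]]].
  destruct (small_step_exists (gro 1) L eta0 (gw_pos _ _) HL Heta) as [sg [S1 [S2 [S3 S4]]]].
  assert (Hn : forall n t, t0 - r <= t <= T -> t <= t0 + INR n * sg -> u t = v t).
  { induction n as [|n IH]; intros t Ht Hn.
    - simpl in Hn. apply E. lra.
    - rewrite S_INR in Hn. destruct (Rle_dec t (t0 + INR n * sg)) as [Hle|Hle]; [now apply IH|].
      set (t1 := t0 + INR n * sg) in *.
      assert (Ht1 : t0 <= t1).
      { unfold t1. pose proof (Rmult_le_pos _ _ (pos_INR n) (Rlt_le _ _ S1)). lra. }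
      assert (Hd : t - t1 <= sg) by (unfold t1; lra).
      apply (mild_unique_step R1 L M eta0 u v t1 t); auto; try lra.
      + unfold R1; lra.
      + unfold R1; lra.
      + eapply Rle_trans; [|exact S4].
        pose proof (gw_pos omega (t - t1)).
        apply Rmult_le_compat; try lra; [apply Rmult_le_pos; lra|].
        apply Rmult_le_compat_r; auto. apply gw_mono. lra.
      + intros x Hx. specialize (Bu x ltac:(lra)). unfold R1; lra.
      + intros x Hx. specialize (Bv x ltac:(lra)). unfold R1; lra.
      + intros x Hx. apply IH; lra.
      + apply (mild_sub u t1 T); [lra|]. apply (mild_shift u t0); auto. lra.
      + apply (mild_sub v t1 T); [lra|]. apply (mild_shift v t0); auto. lra. }
  intros t Ht. destruct (archimed_inv (T - t0) sg S1) as [n [Hn1 Hn2]].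
  apply (Hn n); auto.
  assert (HnR : 0 < INR n) by (apply lt_0_INR; lia).
  apply (Rmult_lt_compat_r (INR n)) in Hn2; auto.
  unfold Rdiv in Hn2. rewrite Rmult_assoc, Rinv_l in Hn2 by lra. lra.
Qed.

(** Picard iteration. That [sg] is chosen before [t0] and [v0] is what the blow-up alternative rests
    on. *)
Lemma local_existence (R0 : R) : 0 < R0 -> exists sg, 0 < sg /\
  forall t0 v0, a <= t0 <= a + R0 -> (forall x, continuous v0 x) ->
    (forall x, t0 - r <= x <= t0 -> norm (v0 x) <= R0) ->
    exists v, mild v t0 (t0 + sg) /\ forall x, x <= t0 -> v x = v0 x.
Proof.
  intros HR0. set (K := gro 1). assert (HK : 1 <= K) by (apply gw_ge_1; lra).
  (* [K * R0] bounds the orbit of the initial value, to which the convolution adds at most [/ 2];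
     [R0 + 1] bounds the final time relative to [a]. Taking the step for [L + M] gives the
     contraction and the invariance of the ball at once. *)
  set (R1 := K * R0 + R0 + 2).
  assert (HKR : 0 < K * R0) by (apply Rmult_lt_0_compat; lra).
  destruct (HBl R1 ltac:(unfold R1; lra)) as [L [M [eta0 [HL [HM [Heta HB]]]]]].
  destruct (small_step_exists K (L + M) eta0 ltac:(lra) ltac:(lra) Heta) as [sg [S1 [S2 [S3 S4]]]].
  assert (S5 : K * L * sg <= / 2).
  { eapply Rle_trans; [|exact S4]. apply Rmult_le_compat_r; [lra|]. apply Rmult_le_compat_l; lra. }
  assert (S6 : K * M * sg <= / 2).
  { eapply Rle_trans; [|exact S4]. apply Rmult_le_compat_r; [lra|]. apply Rmult_le_compat_l; lra. }
  exists sg; split; auto. intros t0 v0 Ht0 Cv0 Bv0.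
  set (t1 := t0 + sg).
  (* Freezing after [t1] makes the iterates continuous on the line and the contraction estimate
     valid at every [x]. *)
  set (W := fun (v : R -> X) x => plus (stp (clamp t0 t1 x - t0) (v0 t0)) (cnv (fB v) t0 (clamp t0 t1 x))).
  set (Phi := fun (v : R -> X) x => if Rle_dec x t0 then v0 x else W v x).
  set (good := fun v : R -> X => (forall x, continuous v x) /\ (forall x, x <= t0 -> v x = v0 x) /\
    (forall x, t0 - r <= x -> norm (v x) <= R1)).
  assert (Ct : forall x, t0 <= clamp t0 t1 x <= t1) by (intros; apply clamp_in; unfold t1; lra).
  assert (Hgro : forall t, t <= t1 -> gro (t - t0) <= K).
  { intros t Ht. apply gw_mono. unfold t1 in Ht; lra. }
  assert (fBM : forall v, good v -> forall s, t0 <= s <= t1 -> norm (fB v s) <= M).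
  { intros v [Cv [_ Bv]] s Hs. rewrite fB_eq by lra.
    apply (proj1 (HB s ltac:(unfold t1, R1 in *; lra))); [now apply isC_seg|].
    apply seg_norm_le. intros x Hx. apply Bv. lra. }
  assert (Pgood : forall v, good v -> good (Phi v)).
  { intros v Hv. pose proof Hv as [Cv [Ev Bv]]. split; [|split].
    - refine (continuous_glue v0 (W v) t0 Cv0 _ _).
      + intros x. unfold W. apply (continuous_plus (V := X)).
        * apply (continuous_clamp_comp (fun y => stp (y - t0) (v0 t0))).
          intros y. apply (continuous_translate (fun t => stp t (v0 t0))).
          intros z. apply (St_cont S omega HS).
        * apply (conv_clamp_cont S omega HS); [now apply fB_cont|unfold t1; lra].
      + unfold W. rewrite clamp_lo by (unfold t1; lra).
        rewrite (St_0 S omega HS) by lra. rewrite conv_point. vec.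
    - intros x Hx. unfold Phi. destruct (Rle_dec x t0); [auto|lra].
    - intros x Hx. unfold Phi. destruct (Rle_dec x t0) as [Hle|Hle].
      + specialize (Bv0 x ltac:(lra)). unfold R1; lra.
      + unfold W. eapply Rle_trans;
          [apply (norm_plus2 _ (stp (clamp t0 t1 x - t0) (v0 t0)) (cnv (fB v) t0 (clamp t0 t1 x))); reflexivity|].
        pose proof (Ct x) as C.
        assert (A1 : norm (stp (clamp t0 t1 x - t0) (v0 t0)) <= K * R0).
        { eapply Rle_trans; [apply (St_norm S omega HS 1); unfold t1 in *; lra|].
          apply Rmult_le_compat_l; [unfold K in *; lra|]. apply Bv0; lra. }
        assert (A2 : norm (cnv (fB v) t0 (clamp t0 t1 x)) <= / 2).
        { eapply Rle_trans.
          - apply (conv_bound S omega HS _ t0 (clamp t0 t1 x) M); try lra; [now apply fB_cont|].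
            intros s Hs. apply fBM; auto. lra.
          - eapply Rle_trans; [|exact S6].
            pose proof (gw_pos omega (clamp t0 t1 x - t0)).
            apply Rmult_le_compat; [apply Rmult_le_pos; lra|lra| |unfold t1 in *; lra].
            apply Rmult_le_compat_r; auto. apply Hgro. lra. }
        unfold R1. vlra. }
  assert (Pcontr : forall v v' c, good v -> good v' -> 0 <= c ->
    (forall x, t0 <= x <= t1 -> norm (minus (v x) (v' x)) <= c) ->
    forall x, norm (minus (Phi v x) (Phi v' x)) <= c * / 2).
  { intros v v' c Hv Hv' Hc D x. unfold Phi. destruct (Rle_dec x t0) as [Hle|Hle].
    - vcanon. rewrite norm_minus_diag. lra.
    - unfold W. pose proof (Ct x) as C. set (y := clamp t0 t1 x) in *.
      destruct Hv as [Cv [Ev Bv]]. destruct Hv' as [Cv' [Ev' Bv']].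
      apply Rle_trans with (norm (minus (cnv (fB v) t0 y) (cnv (fB v') t0 y))).
      { right. f_equal. vec. }
      pose proof (Rmult_le_pos L c HL Hc) as HLc.
      eapply Rle_trans.
      + apply (conv_diff_bound S omega HS _ _ t0 y (L * c)); try lra; try now apply fB_cont.
        intros s Hs. apply (fB_lip R1 L M eta0 v v' t0 t1 c); auto; try (unfold t1, R1; lra); try lra.
        * intros z Hz. apply Bv; lra.
        * intros z Hz. apply Bv'; lra.
        * intros z Hz. rewrite Ev, Ev' by lra. reflexivity.
      + pose proof (gw_pos omega (y - t0)). pose proof (Hgro y ltac:(lra)).
        apply Rle_trans with (K * (L * c) * sg).
        * apply Rmult_le_compat; [apply Rmult_le_pos; lra|lra| |unfold t1 in *; lra].
          apply Rmult_le_compat_r; auto.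
        * replace (K * (L * c) * sg) with (c * (K * L * sg)) by ring.
          apply Rmult_le_compat_l; auto. }
  set (z0 := fun x => if Rle_dec x t0 then v0 x else v0 t0).
  set (vn := fun n => Nat.iter n Phi z0).
  assert (Gn : forall n, good (vn n)).
  { induction n as [|n IH]; [|now apply Pgood].
    split; [|split].
    - refine (continuous_glue v0 (fun _ => v0 t0) t0 Cv0 _ eq_refl). intros x. apply continuous_const.
    - intros x Hx. simpl. unfold z0. destruct (Rle_dec x t0); [auto|lra].
    - intros x Hx. simpl. unfold z0. destruct (Rle_dec x t0).
      + specialize (Bv0 x ltac:(lra)). unfold R1; lra.
      + specialize (Bv0 t0 ltac:(lra)). unfold R1; lra. }
  assert (HR1 : 0 < R1) by (unfold R1; lra).
  assert (Dn : forall n x, norm (minus (vn (Datatypes.S n) x) (vn n x)) <= 2 * R1 * (/ 2) ^ n).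
  { induction n as [|n IH]; intros x.
    - rewrite pow_O, Rmult_1_r. destruct (Rle_dec x t0) as [Hle|Hle].
      + destruct (Gn 0%nat) as [_ [E0 _]]. destruct (Gn 1%nat) as [_ [E1 _]].
        rewrite E0, E1 by auto. vcanon. rewrite norm_minus_diag. lra.
      + destruct (Gn 0%nat) as [_ [_ E0]]. destruct (Gn 1%nat) as [_ [_ E1]].
        eapply Rle_trans; [apply (norm_minus_le (vn 1%nat x) (vn 0%nat x))|].
        specialize (E0 x ltac:(lra)). specialize (E1 x ltac:(lra)). lra.
    - replace (2 * R1 * (/ 2) ^ (Datatypes.S n)) with ((2 * R1 * (/ 2) ^ n) * / 2) by (simpl; ring).
      change (vn (Datatypes.S (Datatypes.S n)) x) with (Phi (vn (Datatypes.S n)) x).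
      change (vn (Datatypes.S n) x) with (Phi (vn n) x).
      apply Pcontr; auto.
      apply Rmult_le_pos; [lra|apply pow_le; lra]. }
  assert (Lim : forall x, exists l : X, forall n, norm (minus l (vn n x)) <= 2 * (2 * R1) * (/ 2) ^ n).
  { intros x. apply (geometric_limit (fun n => vn n x) (2 * R1)). intros n. apply Dn. }
  set (v := fun x => proj1_sig (constructive_indefinite_description _ (Lim x))).
  assert (Hv : forall x n, norm (minus (v x) (vn n x)) <= 4 * R1 * (/ 2) ^ n).
  { intros x n. unfold v. destruct (constructive_indefinite_description _ (Lim x)) as [l Hl]. simpl.
    specialize (Hl n). vlra. }
  assert (Gv : good v).
  { split; [|split].
    - apply (continuous_uniform_limit v). intros eps He.
      destruct (pow_half_small (4 * R1) eps He) as [n Hn].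
      exists (vn n). split; [apply Gn|]. intros x. specialize (Hv x n). vlra.
    - intros x Hx. apply norm_minus_small_eq. intros eps He.
      destruct (pow_half_small (4 * R1) eps He) as [n Hn].
      specialize (Hv x n). destruct (Gn n) as [_ [E _]]. rewrite (E x Hx) in Hv. vlra.
    - intros x Hx. apply le_epsilon. intros eps He.
      destruct (pow_half_small (4 * R1) eps He) as [n Hn].
      specialize (Hv x n). destruct (Gn n) as [_ [_ E]]. specialize (E x Hx).
      pose proof (norm_le_minus (v x) (vn n x)). vlra. }
  assert (Fix : forall x, v x = Phi v x).
  { intros x. apply norm_minus_small_eq. intros eps He.
    destruct (pow_half_small (4 * R1) eps He) as [n Hn].
    pose proof (Hv x (Datatypes.S n)) as A. simpl pow in A.
    change (vn (Datatypes.S n) x) with (Phi (vn n) x) in A.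
    assert (Hp : 0 <= 4 * R1 * (/ 2) ^ n) by (apply Rmult_le_pos; [lra|apply pow_le; lra]).
    pose proof (Pcontr (vn n) v (4 * R1 * (/ 2) ^ n) (Gn n) Gv Hp
      (fun x _ => eq_ind _ (fun q => q <= _) (Hv x n) _ (norm_minus_sym (v x) (vn n x))) x) as C.
    eapply Rle_trans; [apply (norm_minus_tri _ (Phi (vn n) x))|]. vlra. }
  destruct Gv as [Cv [Ev _]].
  exists v. split; auto. split; auto. intros t Ht. fold t1 in Ht.
  destruct (Rle_dec t t0) as [Hle|Hle].
  - replace t with t0 by lra. rewrite (St_0 S omega HS) by lra. rewrite conv_point. vec.
  - rewrite (Fix t) at 1. unfold Phi. destruct (Rle_dec t t0); [lra|].
    unfold W. rewrite clamp_id by lra. rewrite (Ev t0) by lra. reflexivity.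
Qed.

(** * Maximal solutions and blow-up *)

Section Maximal.
Context (phi : R -> X) (Hphi : isC r phi).

Definition hist (x : R) : X := phi (clamp (- r) 0 (x - a)).

Lemma hist_cont (x : R) : continuous hist x.
Proof.
  unfold hist. revert x. apply (continuous_translate (fun y => phi (clamp (- r) 0 y))).
  apply cont_on_clamp; [lra|exact Hphi].
Qed.

(** Prescribing the values also before [a - r] makes two solutions equal at every point up to [T],
    which simplifies gluing. *)
Definition sol (T : R) (u : R -> X) : Prop := mild u a T /\ forall x, x <= a -> u x = hist x.

Lemma sol_unique (T : R) (u v : R -> X) : sol T u -> sol T v -> forall x, x <= T -> u x = v x.
Proof.
  intros [Mu Eu] [Mv Ev] x Hx. destruct (Rle_dec x a) as [Hle|Hle].
  - now rewrite Eu, Ev.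
  - apply (mild_unique u v a T); auto; try lra. intros y Hy. now rewrite Eu, Ev by lra.
Qed.

Lemma sol_extend (R0 : R) : 0 < R0 -> exists sg, 0 < sg /\ forall T u, a <= T <= a + R0 -> sol T u ->
  (forall x, T - r <= x <= T -> norm (u x) <= R0) -> exists v, sol (T + sg) v.
Proof.
  intros HR0. destruct (local_existence R0 HR0) as [sg [Hsg H]]. exists sg; split; auto.
  intros T u HT [Mu Eu] Bu. destruct (H T u HT (proj1 Mu) Bu) as [v [Mv Ev]].
  exists v. split.
  - apply (mild_concat v a T); [lra| |exact Mv].
    apply (mild_ext u v a T); auto; [lra|apply Mv|]. intros x Hx. apply Ev. lra.
  - intros x Hx. rewrite Ev by lra. now apply Eu.
Qed.

Lemma sol_a : sol a hist.
Proof.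
  split; auto. split; [apply hist_cont|]. intros t Ht. replace t with a by lra.
  rewrite (St_0 S omega HS) by lra. rewrite conv_point. vec.
Qed.

(** [b] is the supremum of the times reached by solutions. Since the continuation step depends only
    on the size of the data, the norm of the history exceeds [M] on a whole left neighbourhood of a
    finite [b], which gives a true limit and not just unboundedness. *)
Theorem maximal_solution : exists (b : Rbar) (u : R -> X),
  Rbar_lt (Finite a) b /\
  (forall T, a <= T -> Rbar_lt (Finite T) b -> exists uT, sol T uT /\ forall x, x <= T -> u x = uT x) /\
  (forall bf : R, b = Finite bf -> forall M, exists delta, 0 < delta /\
     forall t, a <= t -> bf - delta < t < bf -> M <= normC r (seg u t)).
Proof.
  set (E := fun T => a <= T /\ exists u, sol T u).
  set (b := Lub_Rbar E). destruct (Lub_Rbar_correct E) as [Hub Hlb]. fold b in Hub, Hlb.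
  destruct (cont_on_bounded hist (a - r) a (continuous_cont_on hist _ _ (fun x _ => hist_cont x)))
    as [R2 [HR2 Bh]].
  assert (Hab : Rbar_lt (Finite a) b).
  { destruct (sol_extend (R2 + 1) ltac:(lra)) as [sg [Hsg H]].
    destruct (H a hist ltac:(lra) sol_a) as [v Hv].
    { intros x Hx. specialize (Bh x Hx). lra. }
    apply Rbar_lt_le_trans with (Finite (a + sg)); [simpl; lra|]. apply Hub. split; [lra|eauto]. }
  assert (Hex : forall T, exists u, a <= T -> Rbar_lt (Finite T) b -> sol T u).
  { intros T. destruct (classic (a <= T /\ Rbar_lt (Finite T) b)) as [[H1 H2]|H].
    - destruct (classic (exists T', E T' /\ T < T')) as [[T' [[_ [u [Mu Eu]]] HT']]|Hn].
      + exists u. intros _ _. split; auto. apply (mild_sub u a T'); auto. lra.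
      + exfalso. apply (Rbar_lt_not_le _ _ H2). apply Hlb. intros T' HT'. simpl.
        destruct (Rle_dec T' T); auto. exfalso. apply Hn. exists T'. split; auto. lra.
    - exists (fun _ => zero). intros H1 H2. exfalso; auto. }
  set (U := fun T => proj1_sig (constructive_indefinite_description _ (Hex T))).
  assert (HU : forall T, a <= T -> Rbar_lt (Finite T) b -> sol T (U T)).
  { intros T. unfold U. destruct (constructive_indefinite_description _ (Hex T)); auto. }
  (* The value at [x] is read off the chosen solution that lives up to [x]; uniqueness makes these
     values coherent. *)
  set (u := fun x => U (Rmax a x) x).
  assert (Hu : forall T, a <= T -> Rbar_lt (Finite T) b -> forall x, x <= T -> u x = U T x).
  { intros T H1 H2 x Hx. unfold u.
    assert (Hm : Rmax a x <= T) by now apply Rmax_lub.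
    assert (Hm2 : Rbar_lt (Finite (Rmax a x)) b).
    { apply Rbar_le_lt_trans with (Finite T); auto. }
    pose proof (HU _ (Rmax_l a x) Hm2) as A. destruct (HU T H1 H2) as [Mu Eu].
    apply (sol_unique (Rmax a x)); auto; [|apply Rmax_r].
    split; auto. now apply (mild_sub _ a T). }
  exists b, u. split; [auto|split].
  - intros T H1 H2. exists (U T). split; auto.
  - intros bf Hbf M. rewrite Hbf in *. simpl in Hab.
    (* This bounds both the times and the values of a history of norm below [M]. At a time later
       than [bf - sg] such a history could be continued beyond [bf]. *)
    set (R0 := Rabs M + (bf - a) + 1). pose proof (Rabs_pos M) as HM0. pose proof (Rle_abs M) as HM1.
    destruct (sol_extend R0 ltac:(unfold R0; lra)) as [sg [Hsg H]].
    exists sg; split; auto. intros t Ht Htb. destruct (Rle_dec M (normC r (seg u t))) as [Hle|Hle]; auto.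
    exfalso. pose proof (HU t Ht ltac:(simpl; lra)) as St.
    assert (Hc : isC r (seg u t)).
    { apply (cont_on_ext (seg (U t) t)).
      - intros x Hx. unfold seg. symmetry. apply Hu; simpl; lra.
      - apply isC_seg. apply St. }
    destruct (H t (U t) ltac:(unfold R0; lra) St) as [v Hv].
    { intros x Hx. rewrite <- (Hu t Ht ltac:(simpl; lra) x) by lra.
      pose proof (normC_ge r (seg u t) (x - t) Hc ltac:(lra)) as A.
      unfold seg at 1 in A. replace (t + (x - t)) with x in A by ring. unfold R0. lra. }
    specialize (Hub (t + sg) ltac:(split; [lra|eauto])). simpl in Hub. lra.
Qed.

Lemma hist_at (th : R) : - r <= th <= 0 -> hist (a + th) = phi th.
Proof.
  intros H. unfold hist. replace (a + th - a) with th by ring. now rewrite clamp_id.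
Qed.

Lemma sol_mild_sol_on (T : R) (u uT : R -> X) : a <= T -> sol T uT ->
  (forall x, x <= T -> u x = uT x) -> mild_sol_on S B r a T phi u.
Proof.
  intros HT [[Cu Hu] Eu] E. split; [auto|split; [|split]].
  - apply (cont_on_ext uT); [intros; symmetry; apply E; lra|].
    apply continuous_cont_on. auto.
  - intros th Hth. rewrite E, Eu by lra. now apply hist_at.
  - intros t Ht. rewrite E by lra.
    replace (minus (uT t) (S (t - a) (phi 0))) with (conv S (fB uT) a t).
    + apply (is_RInt_ext (fun s => stp (t - s) (fB uT s))).
      * intros s. rewrite Rmin_left, Rmax_right by lra. intros Hs.
        rewrite St_S, fB_eq by lra. f_equal. apply B_ext.
        -- lra.
        -- apply (cont_on_ext (seg uT s)); [|now apply isC_seg].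
           intros th Hth. unfold seg. symmetry. apply E. lra.
        -- now apply isC_seg.
        -- intros th Hth. unfold seg. symmetry. apply E. lra.
      * apply (conv_is S omega HS). now apply fB_cont.
    + rewrite (Hu t Ht). rewrite (Eu a) by lra.
      replace (hist a) with (phi 0) by (rewrite <- hist_at by lra; f_equal; ring).
      rewrite St_S by lra. vec.
Qed.

Lemma mild_sol_on_sol (T : R) (v : R -> X) : mild_sol_on S B r a T phi v ->
  sol T (fun x => v (clamp (a - r) T x)).
Proof.
  intros [HT [Cv [Hv Hi]]].
  assert (Cv' : forall x, continuous (fun x => v (clamp (a - r) T x)) x).
  { apply (cont_on_clamp v (a - r) T); [lra|exact Cv]. }
  assert (Eh : forall x, x <= a -> v (clamp (a - r) T x) = hist x).
  { intros x Hx. unfold hist. rewrite <- Hv by (apply clamp_in; lra). f_equal.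
    destruct (Rle_dec x (a - r)).
    - rewrite !clamp_lo by lra. ring.
    - rewrite !clamp_id by lra. ring. }
  split; [split; [exact Cv'|]|exact Eh].
  intros t Ht. rewrite (clamp_id (a - r) T t) by lra.
  rewrite (Eh a) by lra. replace (hist a) with (phi 0) by (rewrite <- hist_at by lra; f_equal; ring).
  replace (conv S (fB (fun x => v (clamp (a - r) T x))) a t) with (minus (v t) (S (t - a) (phi 0))).
  - rewrite St_S by lra. vec.
  - symmetry. apply (is_RInt_unique (V := X)).
    apply (is_RInt_ext (fun s => S (t - s) (B s (seg v s)))); [|apply Hi; lra].
    intros s. rewrite Rmin_left, Rmax_right by lra. intros Hs.
    rewrite St_S, fB_eq by lra. f_equal. apply B_ext.
    + lra.
    + now apply isC_seg.
    + apply (isC_seg_cont_on r v (a - r) T); auto; lra.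
    + intros th Hth. unfold seg. rewrite clamp_id by lra. reflexivity.
Qed.
End Maximal.

(** * Invariance of [D] *)

(* A maximality principle that needs only countable chains: each step gains at least half of
   what is still attainable (Brezis-Browder). *)
Lemma brezis_browder {A : Type} (P : A -> Prop) (le : A -> A -> Prop) (m : A -> R) (t1 : R) :
  (forall s, le s s) -> (forall s s' s'', le s s' -> le s' s'' -> le s s'') ->
  (forall s s', le s s' -> m s <= m s') -> (forall s, P s -> m s <= t1) ->
  (forall s, P s -> m s < t1 -> exists s', P s' /\ le s s' /\ m s < m s') ->
  (forall sq : nat -> A, (forall n, P (sq n)) -> (forall n, le (sq n) (sq (Datatypes.S n))) ->
     exists s, P s /\ forall n, le (sq n) s) ->
  forall s0, P s0 -> exists s, P s /\ le s0 s /\ m s = t1.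
Proof.
  intros Hrefl Htr Hmono Hbd Hext Hlim s0 Hs0.
  (* The chosen [s'] reaches at least the midpoint between [m s] and the supremum over extensions of
     [s]; hence what any extension [s''] can still gain is halved. *)
  assert (Step : forall s : {s | P s}, exists s' : {s | P s}, le (proj1_sig s) (proj1_sig s') /\
    forall s'', P s'' -> le (proj1_sig s) s'' ->
      m s'' - m (proj1_sig s') <= (m s'' - m (proj1_sig s)) / 2).
  { intros [s Hs]. simpl.
    destruct (completeness (fun x => exists s'', P s'' /\ le s s'' /\ x = m s'')) as [M [HM1 HM2]].
    - exists t1. intros x [s'' [H1 [_ ->]]]. auto.
    - exists (m s), s. auto.
    - assert (HMs : m s <= M) by (apply HM1; exists s; auto).
      destruct (Rle_lt_or_eq_dec _ _ HMs) as [Hlt|Heq].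
      + assert (Hx : exists s', P s' /\ le s s' /\ (M + m s) / 2 <= m s').
        { apply NNPP. intros Hn.
          assert (M <= (M + m s) / 2); [|lra]. apply HM2. intros x [s'' [H1 [H2 ->]]].
          destruct (Rle_dec (m s'') ((M + m s) / 2)) as [Hle|Hle]; auto.
          exfalso. apply Hn. exists s''. repeat split; auto. lra. }
        destruct Hx as [s' [H1 [H2 H3]]]. exists (exist _ s' H1). simpl. split; auto.
        intros s'' H4 H5. assert (m s'' <= M) by (apply HM1; exists s''; auto). lra.
      + exists (exist _ s Hs). simpl. split; auto. intros s'' H4 H5.
        assert (m s'' <= M) by (apply HM1; exists s''; auto).
        pose proof (Hmono _ _ H5). lra. }
  set (next := fun s => proj1_sig (constructive_indefinite_description _ (Step s))).
  assert (Hnext : forall s, le (proj1_sig s) (proj1_sig (next s)) /\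
    forall s'', P s'' -> le (proj1_sig s) s'' ->
      m s'' - m (proj1_sig (next s)) <= (m s'' - m (proj1_sig s)) / 2).
  { intros s. exact (proj2_sig (constructive_indefinite_description _ (Step s))). }
  set (sq := fun n => Nat.iter n next (exist _ s0 Hs0)).
  destruct (Hlim (fun n => proj1_sig (sq n))) as [s [Hs Hle]].
  - intros n. exact (proj2_sig (sq n)).
  - intros n. exact (proj1 (Hnext (sq n))).
  - exists s. split; [auto|split; [exact (Hle O)|]].
    destruct (Rle_lt_or_eq_dec _ _ (Hbd s Hs)) as [Hlt|Heq]; auto. exfalso.
    (* A strict extension [s'] of the upper bound [s] extends every member of the chain, so its gain
       over the [n]-th member is at most a constant times [(/ 2) ^ n]. Yet it is at least
       [m s' - m s], which is positive. *)
    destruct (Hext s Hs Hlt) as [s' [H1 [H2 H3]]].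
    assert (Hall : forall n, le (proj1_sig (sq n)) s') by (intros n; apply Htr with s; auto).
    assert (Hn : forall n, m s' - m (proj1_sig (sq n)) <= (m s' - m s0) * (/ 2) ^ n).
    { induction n as [|n IH]; [simpl; lra|].
      pose proof (proj2 (Hnext (sq n)) s' H1 (Hall n)) as Hg.
      change (proj1_sig (next (sq n))) with (proj1_sig (sq (Datatypes.S n))) in Hg. simpl pow. lra. }
    destruct (pow_half_small (m s' - m s0) (m s' - m s) ltac:(lra)) as [n Hn'].
    specialize (Hn n). pose proof (Hmono _ _ (Hle n)) as Hmn. cbv beta in Hmn. lra.
Qed.

Section Invariance.
Context (D : R -> X -> Prop)
  (HD_closed : forall (tn : nat -> R) (xn : nat -> X) t x,
     (forall n, D (tn n) (xn n)) ->
     filterlim tn eventually (locally t) -> filterlim xn eventually (locally x) -> D t x)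
  (HD_ne : forall t, a - r <= t -> exists x, D t x)
  (HD_conn : forall b, a < b -> exists (Khat : R) (eta_b : R -> R),
     0 < Khat /\
     (forall s, 0 <= s < b - a -> 0 <= eta_b s) /\ eta_b 0 = 0 /\
     (forall s1 s2, 0 <= s1 <= s2 -> s2 < b - a -> eta_b s1 <= eta_b s2) /\
     (forall s, 0 <= s < b - a -> forall eps, 0 < eps -> exists delta, 0 < delta /\
        forall s', 0 <= s' < b - a -> Rabs (s' - s) < delta -> Rabs (eta_b s' - eta_b s) < eps) /\
     (forall t1 t2 x1 x2, a <= t1 -> t1 < t2 -> t2 <= b -> D t1 x1 -> D t2 x2 ->
        exists w : R -> X, cont_on w t1 t2 /\ w t1 = x1 /\ w t2 = x2 /\
          (forall t, t1 < t < t2 -> D t (w t)) /\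
          (forall s t, t1 <= s <= t2 -> t1 <= t <= t2 ->
             norm (minus (w t) (w s)) <=
               eta_b (Rabs (t - s)) + Khat * Rabs (t - s) * (norm (minus x2 x1) / (t2 - t1)))))
  (HD_sub : forall t phi, calD D a r t phi ->
     filterlim
       (fun hh => / hh * distD (D (t + hh))
          (plus (S hh (phi 0)) (RInt (fun s => S (t + hh - s) (B t phi)) t (t + hh))))
       (at_right 0) (locally 0)).

(** Nonemptiness matters: the infimum of the empty set is infinite and [real] would turn it into
    0. *)
Lemma distD_lt (E : X -> Prop) (x : X) (d : R) :
  (exists y, E y) -> distD E x < d -> exists y, E y /\ norm (minus x y) < d.
Proof.
  intros [y0 Hy0] Hd. apply NNPP. intros Hn.
  set (Q := fun q => exists y, E y /\ q = norm (minus x y)) in *.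
  destruct (Glb_Rbar_correct Q) as [Hlb Hglb].
  assert (H1 : Rbar_le (Finite d) (Glb_Rbar Q)).
  { apply Hglb. intros q [y [Hy ->]]. simpl.
    destruct (Rle_dec d (norm (minus x y))) as [Hle|Hle]; auto. exfalso. apply Hn. exists y. split; auto. vlra. }
  specialize (Hlb (norm (minus x y0)) ltac:(exists y0; auto)).
  change (real (Glb_Rbar Q) < d) in Hd.
  destruct (Glb_Rbar Q); simpl in *; try contradiction; lra.
Qed.

Lemma subtangential_point (t : R) (phi : R -> X) (eps : R) : calD D a r t phi -> 0 < eps ->
  exists d, 0 < d /\ forall h, 0 < h < d -> exists y, D (t + h) y /\
    norm (minus y (plus (stp h (phi 0)) (cnv (fun _ => B t phi) t (t + h)))) <= eps * h.
Proof.
  intros HC He.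
  destruct (proj1 (at_right_eps (V := R_NormedModule) _ _ _) (HD_sub t phi HC) eps He) as [d [Hd H]].
  exists d; split; auto. intros h Hh. specialize (H h ltac:(lra)).
  set (z := plus (stp h (phi 0)) (cnv (fun _ => B t phi) t (t + h))).
  assert (Ez : plus (S h (phi 0)) (RInt (fun s => S (t + h - s) (B t phi)) t (t + h)) = z).
  { unfold z. rewrite St_S by lra. f_equal. apply (RInt_ext (V := X)).
    intros x. rewrite Rmin_left, Rmax_right by lra. intros Hx. now rewrite St_S by lra. }
  rewrite Ez in H.
  change (Rabs (/ h * distD (D (t + h)) z - 0) < eps) in H.
  rewrite Rminus_0_r in H. assert (H' := Rle_lt_trans _ _ _ (Rle_abs _) H).
  assert (Hlt : distD (D (t + h)) z < eps * h).
  { apply (Rmult_lt_compat_r h) in H'; [|lra].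
    replace (/ h * distD (D (t + h)) z * h) with (distD (D (t + h)) z) in H' by (field; lra). lra. }
  destruct HC as [Ha _].
  destruct (distD_lt (D (t + h)) z (eps * h) (HD_ne (t + h) ltac:(lra)) Hlt) as [y [Hy Hn]].
  exists y. split; auto. vcanon. rewrite norm_minus_sym. left. exact Hn.
Qed.

(* Defect of the variation-of-constants formula for [v] between the times [s] and [t]. *)
Definition dlt (v : R -> X) (s t : R) : X :=
  minus (v t) (plus (stp (t - s) (v s)) (cnv (fB v) s t)).

(** The defect of the first piece is transported by the semigroup and then adds to that of the
    second; bounds on single steps thus accumulate to bounds between distant nodes. *)
Lemma dlt_cocycle (v : R -> X) (s m t : R) : (forall x, continuous v x) -> s <= m -> m <= t ->
  dlt v s t = plus (dlt v m t) (stp (t - m) (dlt v s m)).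
Proof.
  intros Hv H1 H2. unfold dlt.
  rewrite (conv_chasles S omega HS (fB v) s m t) by (auto; now apply fB_cont).
  rewrite (St_minus S omega HS), (St_plus S omega HS).
  replace (t - s) with ((t - m) + (m - s)) by ring. rewrite (St_semi S omega HS) by lra. vec.
Qed.

Lemma dlt_diag (v : R -> X) (t : R) : dlt v t t = zero.
Proof.
  unfold dlt. rewrite conv_point, (St_0 S omega HS) by lra. vec.
Qed.

Lemma dlt_ext (v v' : R -> X) (s t : R) : (forall x, continuous v x) -> (forall x, continuous v' x) ->
  a <= s -> s <= t -> (forall x, x <= t -> v' x = v x) -> dlt v' s t = dlt v s t.
Proof.
  intros Hv Hv' Ha Hst E. unfold dlt. rewrite !E by lra. do 2 f_equal.
  apply conv_ext; auto. intros y Hy. apply fB_ext; auto; [lra|]. intros x Hx. apply E. lra.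
Qed.

(** * Approximate solutions with values in [D] on a short interval *)

Section LocalInvariance.
(** The margin 1 in [Bu] keeps functions within distance 1 of [u] in the ball where [B] is bounded
    and Lipschitz. [Heps1] makes the final error at most [/ 2], which leaves room to take one more
    step at that distance. *)
Context (t0 t1 R1 L M eta0 Kh K eps : R) (etab : R -> R) (u : R -> X)
  (Ht0 : a <= t0) (Ht01 : t0 < t1) (Ht1 : t1 <= a + R1) (Hlen : t1 - t0 <= 1)
  (Hign : t1 - t0 <= eta0) (HL : 0 <= L) (HM : 0 <= M)
  (HK : K = gro 1) (Hsmall : K * L * (t1 - t0) <= / 2)
  (HB : bounded_lip r a B R1 L M eta0)
  (Mu : mild u t0 t1) (Bu : forall x, t0 - r <= x <= t1 -> norm (u x) + 1 <= R1)
  (Du : forall x, t0 - r <= x <= t0 -> D x (u x))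
  (HKh : 0 < Kh) (Heta0 : etab 0 = 0)
  (Heta_pos : forall s, 0 <= s < t1 + 1 - a -> 0 <= etab s)
  (Heta_mono : forall s1 s2, 0 <= s1 <= s2 -> s2 < t1 + 1 - a -> etab s1 <= etab s2)
  (Heta_cont : forall e, 0 < e -> exists delta, 0 < delta /\
     forall s', 0 <= s' < t1 + 1 - a -> s' < delta -> etab s' < e)
  (Hpath : forall s1 s2 x1 x2, a <= s1 -> s1 < s2 -> s2 <= t1 + 1 -> D s1 x1 -> D s2 x2 ->
     exists w : R -> X, cont_on w s1 s2 /\ w s1 = x1 /\ w s2 = x2 /\
       (forall t, s1 < t < s2 -> D t (w t)) /\
       (forall s t, s1 <= s <= s2 -> s1 <= t <= s2 ->
          norm (minus (w t) (w s)) <=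
            etab (Rabs (t - s)) + Kh * Rabs (t - s) * (norm (minus x2 x1) / (s2 - s1))))
  (Heps : 0 < eps) (Heps1 : 2 * ((1 + K * K) * eps) <= / 2).

Record state := mk_state { s_tau : R; s_v : R -> X; s_N : R -> Prop }.

(* An [eps]-approximate solution on [[t0, s_tau]] with values in [D], frozen after [s_tau].
   [s_N] is its set of nodes; the approximation is accurate (linearly in time) between nodes,
   and elsewhere it is controlled by the two neighbouring nodes. *)
Record approx (s : state) : Prop := {
  ap_tau : t0 <= s_tau s <= t1;
  ap_cont : forall x, continuous (s_v s) x;
  ap_hist : forall x, x <= t0 -> s_v s x = u x;
  ap_frozen : forall x, s_tau s <= x -> s_v s x = s_v s (s_tau s);
  ap_D : forall x, t0 - r <= x <= s_tau s -> D x (s_v s x);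
  ap_close : forall x, t0 <= x <= s_tau s -> norm (minus (s_v s x) (u x)) <= 1;
  ap_N0 : s_N s t0;
  ap_Ntau : s_N s (s_tau s);
  ap_Nin : forall q, s_N s q -> t0 <= q <= s_tau s;
  ap_node : forall n m, s_N s n -> s_N s m -> n <= m ->
    norm (dlt (s_v s) n m) <= eps * gro (m - n) * (m - n);
  ap_between : forall t, t0 <= t <= s_tau s -> exists n m, s_N s n /\ s_N s m /\ n <= t <= m /\
    (forall q, s_N s q -> q <= n \/ m <= q) /\
    norm (minus (s_v s t) (s_v s n)) <= etab (m - n) + Kh * norm (minus (s_v s m) (s_v s n)) /\
    norm (dlt (s_v s) n t) <= eps }.

(** The last clause forbids new nodes in the past, so the two nodes next to a point remain its
    neighbours along a chain. *)
Definition extends (s s' : state) : Prop :=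
  s_tau s <= s_tau s' /\ (forall x, x <= s_tau s -> s_v s' x = s_v s x) /\
  (forall q, s_N s q -> s_N s' q) /\ (forall q, s_N s' q -> q <= s_tau s -> s_N s q).

Lemma K_ge_1 : 1 <= K.
Proof. rewrite HK. apply gw_ge_1; lra. Qed.

Lemma gro_le_K (t : R) : t <= 1 -> gro t <= K.
Proof. intros H. rewrite HK. now apply gw_mono. Qed.

Lemma eps_le_1 : eps <= / 4.
Proof.
  pose proof K_ge_1. assert (1 * eps <= (1 + K * K) * eps); [|lra].
  apply Rmult_le_compat_r; [lra|]. pose proof (Rmult_le_pos K K ltac:(lra) ltac:(lra)). lra.
Qed.

Lemma approx_bound (s : state) : approx s -> forall x, t0 - r <= x -> norm (s_v s x) <= R1.
Proof.
  intros A x Hx. destruct (Rle_dec x t0) as [H0|H0].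
  - rewrite (ap_hist s A) by auto. specialize (Bu x ltac:(lra)). lra.
  - assert (C : forall y, t0 <= y <= s_tau s -> norm (s_v s y) <= R1).
    { intros y Hy. pose proof (ap_close s A y Hy) as C1. pose proof (ap_tau s A).
      pose proof (norm_le_minus (s_v s y) (u y)) as C2. specialize (Bu y ltac:(lra)). vlra. }
    destruct (Rle_dec x (s_tau s)) as [H1|H1]; [apply C; lra|].
    rewrite (ap_frozen s A) by lra. apply C. pose proof (ap_tau s A). lra.
Qed.

Lemma approx_fB_bound (s : state) : approx s -> forall y, t0 <= y <= t1 -> norm (fB (s_v s) y) <= M.
Proof.
  intros A y Hy. rewrite fB_eq by lra. apply (proj1 (HB y ltac:(lra))).
  - apply isC_seg. apply (ap_cont s A).
  - apply seg_norm_le. intros x Hx. apply (approx_bound s A). lra.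
Qed.

(** The crude distance 1 of [ap_close] places everything in the Lipschitz ball; the defect from [t0]
    and [halving] then improve it to order [eps]. *)
Lemma approx_near (s : state) : approx s -> forall t, t0 <= t <= s_tau s ->
  norm (minus (s_v s t) (u t)) <= 2 * ((1 + K * K) * eps).
Proof.
  intros A. pose proof K_ge_1 as HK1. pose proof (ap_tau s A) as Htau. destruct Mu as [Cu Hu].
  pose proof (ap_cont s A) as Cv.
  assert (HKK : 0 <= K * K) by (apply Rmult_le_pos; lra).
  apply (halving (fun t => t0 <= t <= s_tau s) (fun t => norm (minus (s_v s t) (u t))) 1
    ((1 + K * K) * eps)); [apply Rmult_le_pos; lra|lra|apply (ap_close s A)|].
  intros c Hc Hd t Ht.
  (* One [eps] for the stretch after the last node [n]; the defect at [n], at most [eps * K] as the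
     interval has length at most 1, is transported at the cost of another [K]. *)
  assert (Ed : norm (dlt (s_v s) t0 t) <= (1 + K * K) * eps).
  { destruct (ap_between s A t Ht) as [n [m [Nn [Nm [Hnm [_ [_ H2]]]]]]].
    pose proof (ap_Nin s A n Nn) as Hn.
    rewrite (dlt_cocycle (s_v s) t0 n t) by (auto; lra).
    pose proof (ap_node s A t0 n (ap_N0 s A) Nn ltac:(lra)) as H3.
    eapply Rle_trans; [apply (norm_plus2 _ (dlt (s_v s) n t) (stp (t - n) (dlt (s_v s) t0 n))); reflexivity|].
    assert (H4 : norm (stp (t - n) (dlt (s_v s) t0 n)) <= K * (eps * K * 1)).
    { eapply Rle_trans; [apply (St_norm S omega HS 1); lra|]. rewrite <- HK.
      apply Rmult_le_compat_l; [lra|]. eapply Rle_trans; [exact H3|].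
      pose proof (gw_pos omega (n - t0)).
      apply Rmult_le_compat; try lra; [apply Rmult_le_pos; lra|].
      apply Rmult_le_compat_l; [lra|]. apply gro_le_K. lra. }
    lra. }
  apply Rle_trans with (norm (dlt (s_v s) t0 t) + norm (minus (cnv (fB (s_v s)) t0 t) (cnv (fB u) t0 t))).
  { apply norm_plus2. unfold dlt. rewrite (Hu t) by lra. rewrite (ap_hist s A t0) by lra. vec. }
  apply Rplus_le_compat; auto.
  pose proof (Rmult_le_pos L c HL Hc) as HLc.
  eapply Rle_trans.
  - apply (conv_diff_bound S omega HS _ _ t0 t (L * c)); try lra; try now apply fB_cont.
    intros y Hy. apply (fB_lip R1 L M eta0 (s_v s) u t0 (s_tau s) c); auto; try lra.
    + intros x Hx. apply (approx_bound s A). lra.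
    + intros x Hx. specialize (Bu x ltac:(lra)). lra.
    + intros x Hx. apply (ap_hist s A). lra.
  - pose proof (gro_le_K (t - t0) ltac:(lra)). pose proof (gw_pos omega (t - t0)).
    apply Rle_trans with (K * (L * c) * (t1 - t0)).
    + apply Rmult_le_compat; [apply Rmult_le_pos; lra|lra| |lra]. apply Rmult_le_compat_r; auto.
    + replace (K * (L * c) * (t1 - t0)) with ((K * L * (t1 - t0)) * c) by ring.
      unfold Rdiv. rewrite (Rmult_comm c). apply Rmult_le_compat_r; auto.
Qed.

Lemma min_pos_exists (l : list R) : (forall x, In x l -> 0 < x) ->
  exists h, 0 < h /\ forall x, In x l -> h < x.
Proof.
  induction l as [|y l IH]; intros H.
  - exists 1. split; [lra|]. intros x [].
  - destruct IH as [h [Hh Hl]]; [intros x Hx; apply H; now right|].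
    pose proof (H y (or_introl eq_refl)) as Hy.
    exists (Rmin h (y / 2)). split; [apply Rmin_pos; lra|].
    pose proof (Rmin_l h (y / 2)). pose proof (Rmin_r h (y / 2)).
    intros x [<-|Hx]; [lra|]. specialize (Hl x Hx). lra.
Qed.

Lemma approx_extend (s : state) : approx s -> s_tau s < t1 ->
  exists s', approx s' /\ extends s s' /\ s_tau s < s_tau s'.
Proof.
  intros A Hlt. pose proof K_ge_1 as HK1. pose proof eps_le_1 as He1.
  destruct s as [tau v N]. simpl in Hlt.
  pose proof (ap_tau _ A) as Htau. pose proof (ap_cont _ A) as Cv. pose proof (ap_hist _ A) as Hh.
  pose proof (ap_frozen _ A) as Hf. pose proof (ap_D _ A) as HDv. pose proof (ap_close _ A) as Hcl.
  pose proof (ap_N0 _ A) as HN0. pose proof (ap_Ntau _ A) as HNt. pose proof (ap_Nin _ A) as HNi.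
  pose proof (ap_node _ A) as Hnode. pose proof (ap_between _ A) as Hbt.
  pose proof (approx_near _ A) as Hnear. simpl in *.
  set (x0 := v tau). set (b0 := B tau (seg v tau)).
  assert (HC : calD D a r tau (seg v tau)).
  { split; [lra|split; [now apply isC_seg|]]. intros th Hth. unfold seg. apply HDv. lra. }
  (* Half of the admissible defect goes to the subtangential error, the other half to the variation
     of [B] along the new piece. *)
  destruct (subtangential_point tau (seg v tau) (eps / 2) HC ltac:(lra)) as [da [Hda Pa]].
  destruct (HBc tau (seg v tau) ltac:(lra) (isC_seg r v tau Cv) (eps / 2) ltac:(lra)) as [db [Hdb Pb]].
  destruct (seg_continuous r v tau ltac:(lra) Cv (db / 2) ltac:(lra)) as [dc [Hdc Pc]].
  (* [kap] bounds the oscillation of the path: [eps / 8] for the defect inside the new interval,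
     [db / 4] for the continuity of [B], [/ 4] for the distance to [u]. *)
  destruct (pos_min3 (eps / 8) (db / 4) (/ 4) ltac:(lra) ltac:(lra) ltac:(lra))
    as [kap [Hkap [Kap1 [Kap2 Kap3]]]].
  destruct (Heta_cont (kap / 2) ltac:(lra)) as [dd [Hdd Pd]].
  (* Largest jump allowed from [x0] to the new node: its contribution to the oscillation is at most
     [kap / 2], and the modulus [etab] gives the other half. *)
  set (rho := kap / (2 * (Kh + 1))).
  assert (Hrho : 0 < rho) by (unfold rho; apply Rdiv_lt_0_compat; lra).
  destruct (St_near_0 S omega HS x0 (Rmin (rho / 2) (eps / 8))) as [de [Hde Pe]].
  { apply Rmin_pos; lra. }
  set (b1 := norm b0). assert (Hb1 : 0 <= b1) by apply norm_ge_0.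
  assert (HKb : 0 <= K * b1) by (apply Rmult_le_pos; lra).
  set (Q := K * b1 + K * eps + 1).
  assert (HKe : 0 <= K * eps) by (apply Rmult_le_pos; lra).
  destruct (proj1 (continuous_eps u tau) (proj1 Mu tau) (/ 4) ltac:(lra)) as [dg [Hdg Pg]].
  destruct (min_pos_exists (da :: db :: dc :: dd :: de :: dg :: (t1 - tau) :: (rho / 2) / Q :: (eps / 4) / Q :: nil))
    as [h [Hh0 Hmin]].
  { simpl. intros x Hx.
    repeat destruct Hx as [<-|Hx]; auto; try lra; try contradiction; apply Rdiv_lt_0_compat; unfold Q; lra. }
  assert (hs : h < da /\ h < db /\ h < dc /\ h < dd /\ h < de /\ h < dg /\ h < t1 - tau)
    by (repeat split; apply Hmin; simpl; auto 12).
  destruct hs as [ha [hb [hc [hd [he [hg ht]]]]]].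
  assert (hq1 : Q * h <= rho / 2).
  { assert (h < (rho / 2) / Q) by (apply Hmin; simpl; auto 12).
    apply Rle_trans with (Q * ((rho / 2) / Q)); [apply Rmult_le_compat_l; unfold Q in *; lra|].
    right; field; unfold Q; lra. }
  assert (hq2 : Q * h <= eps / 4).
  { assert (h < (eps / 4) / Q) by (apply Hmin; simpl; auto 12).
    apply Rle_trans with (Q * ((eps / 4) / Q)); [apply Rmult_le_compat_l; unfold Q in *; lra|].
    right; field; unfold Q; lra. }
  clear Hmin.
  assert (hgro : gro h <= K) by (apply gro_le_K; lra).
  assert (hgro1 : 1 <= gro h) by (apply gw_ge_1; lra).
  destruct (Pa h ltac:(lra)) as [y [Dy Hy]].
  change (seg v tau 0) with (v (tau + 0)) in Hy. rewrite Rplus_0_r in Hy. fold x0 b0 in Hy.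
  set (tau' := tau + h).
  assert (Cb0 : forall z : R, continuous (fun _ : R => b0) z) by (intros; apply continuous_const).
  assert (Hcb : norm (cnv (fun _ => b0) tau tau') <= K * b1 * h).
  { eapply Rle_trans; [apply (conv_bound S omega HS _ tau tau' b1); auto; unfold tau'; try lra|].
    - intros; apply Rle_refl.
    - unfold tau'. replace (tau + h - tau) with h by ring.
      apply Rmult_le_compat_r; [lra|]. apply Rmult_le_compat_r; auto. }
  assert (hst : forall z, z <= h -> norm (minus (stp z x0) x0) < rho / 2 /\ norm (minus (stp z x0) x0) < eps / 8).
  { intros z Hz. specialize (Pe z ltac:(lra)). split.
    - eapply Rlt_le_trans; [exact Pe|apply Rmin_l].
    - eapply Rlt_le_trans; [exact Pe|apply Rmin_r]. }
  assert (Hyx : norm (minus y x0) <= rho).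
  { destruct (hst h ltac:(lra)) as [Q1 _].
    eapply Rle_trans.
    { apply (norm_plus3 _ (minus y (plus (stp h x0) (cnv (fun _ => b0) tau tau')))
        (minus (stp h x0) x0) (cnv (fun _ => b0) tau tau')). vec. }
    assert (eps / 2 * h + K * b1 * h <= Q * h).
    { unfold Q. rewrite <- Rmult_plus_distr_r. apply Rmult_le_compat_r; [lra|].
      assert (1 * eps <= K * eps) by (apply Rmult_le_compat_r; lra). lra. }
    fold tau' in Hy. vlra. }
  set (q := etab h + Kh * norm (minus y x0)).
  assert (Hq : q <= kap).
  { unfold q. pose proof (Pd h ltac:(lra) hd).
    assert (Kh * norm (minus y x0) <= (Kh + 1) * rho).
    { apply Rmult_le_compat; vlra || apply norm_ge_0. }
    replace ((Kh + 1) * rho) with (kap / 2) in * by (unfold rho; field; lra). lra. }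
  assert (Hq0 : 0 <= q).
  { unfold q. pose proof (Heta_pos h ltac:(lra)).
    pose proof (Rmult_le_pos Kh (norm (minus y x0)) ltac:(lra) (norm_ge_0 _)). lra. }
  destruct (Hpath tau tau' x0 y) as [w [Cw [Wl [Wr [WD Wosc]]]]];
    [lra|unfold tau'; lra|unfold tau'; lra|apply HDv; lra|exact Dy|].
  assert (Wx : forall z, tau <= z <= tau' -> norm (minus (w z) x0) <= q).
  { intros z Hz. rewrite <- Wl.
    eapply Rle_trans; [apply (Wosc tau z); lra|]. unfold q.
    rewrite Rabs_right by lra. apply Rplus_le_compat.
    - apply Heta_mono; unfold tau' in *; lra.
    - rewrite Rmult_assoc. apply Rmult_le_compat_l; [lra|].
      unfold tau'. replace (tau + h - tau) with h by ring.
      apply Rle_trans with (h * (norm (minus y x0) / h)); [|right; field; lra].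
      apply Rmult_le_compat_r; [|unfold tau' in *; lra].
      apply Rdiv_le_0_compat; [apply norm_ge_0|lra]. }
  set (v' := fun x => if Rle_dec x tau then v x else w (clamp tau tau' x)).
  assert (Htt : tau <= tau') by (unfold tau'; lra).
  assert (Cv' : forall x, continuous v' x).
  { refine (continuous_glue v (fun x => w (clamp tau tau' x)) tau Cv _ _).
    - apply (cont_on_clamp w); auto.
    - rewrite clamp_lo by lra. now rewrite Wl. }
  assert (E' : forall x, x <= tau -> v' x = v x).
  { intros x Hx. unfold v'. destruct (Rle_dec x tau); [auto|lra]. }
  assert (Ew : forall x, tau <= x <= tau' -> v' x = w x).
  { intros x Hx. unfold v'. destruct (Rle_dec x tau).
    - replace x with tau by lra. now rewrite Wl.
    - now rewrite clamp_id. }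
  assert (Ef : forall x, tau' <= x -> v' x = v' tau').
  { intros x Hx. rewrite (Ew tau') by lra. unfold v'. destruct (Rle_dec x tau); [unfold tau' in *; lra|].
    now rewrite clamp_hi. }
  assert (Ey : v' tau' = y) by (rewrite Ew by lra; exact Wr).
  (* Valid at every [x], because the old function is frozen after [tau] and the new one after
     [tau']. *)
  assert (Vq : forall x, norm (minus (v' x) (v x)) <= q).
  { intros x. unfold v'. destruct (Rle_dec x tau) as [Hx|Hx].
    - vcanon. rewrite norm_minus_diag. auto.
    - rewrite (Hf x) by lra. apply Wx. now apply clamp_in. }
  assert (FB : forall z, tau <= z <= tau' -> norm (minus (fB v' z) b0) <= eps / 2).
  { intros z Hz. rewrite fB_eq by lra. left.
    assert (Hz2 : Rabs (z - tau) <= h) by (rewrite Rabs_right; unfold tau' in *; lra).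
    apply Pb; [lra|now apply isC_seg|lra|].
    specialize (Pc z ltac:(lra)).
    apply Rle_lt_trans with (q + normC r (diffC (seg v z) (seg v tau))); [|lra].
    apply normC_le; [lra|]. intros th Hth.
    pose proof (normC_ge r (diffC (seg v z) (seg v tau)) th
      (isC_diffC r _ _ (isC_seg r v z Cv) (isC_seg r v tau Cv)) Hth) as Q1.
    unfold diffC at 1 in Q1. unfold seg at 1 2 in Q1. unfold diffC at 1. unfold seg at 1 2.
    eapply Rle_trans; [apply (norm_minus_tri _ (v (z + th)))|].
    specialize (Vq (z + th)). vlra. }
  assert (FBb : forall z, tau <= z <= tau' -> norm (fB v' z) <= b1 + eps).
  { intros z Hz. specialize (FB z Hz). pose proof (norm_le_minus (fB v' z) b0). unfold b1. vlra. }
  assert (CfB : forall z, continuous (fB v') z) by now apply fB_cont.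
  assert (Dlt1 : norm (dlt v' tau tau') <= eps * gro h * h).
  { unfold dlt. rewrite Ey, (E' tau) by lra. fold x0.
    replace (tau' - tau) with h by (unfold tau'; ring).
    eapply Rle_trans.
    { apply (norm_plus2 _ (minus y (plus (stp h x0) (cnv (fun _ => b0) tau tau')))
        (minus (cnv (fun _ => b0) tau tau') (cnv (fB v') tau tau'))). vec. }
    assert (Q1 : norm (minus (cnv (fun _ => b0) tau tau') (cnv (fB v') tau tau')) <= gro h * (eps / 2) * h).
    { eapply Rle_trans; [apply (conv_diff_bound S omega HS _ _ tau tau' (eps / 2)); auto; try lra|].
      - intros z Hz. vcanon. rewrite norm_minus_sym. apply FB. lra.
      - unfold tau'. replace (tau + h - tau) with h by ring. apply Rle_refl. }
    assert (Q2 : eps / 2 * h <= gro h * (eps / 2) * h).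
    { apply Rmult_le_compat_r; [lra|]. rewrite <- (Rmult_1_l (eps / 2)) at 1.
      apply Rmult_le_compat_r; lra. }
    fold tau' in Hy. replace (eps * gro h * h) with (gro h * (eps / 2) * h + gro h * (eps / 2) * h) by field.
    vlra. }
  assert (Dlt2 : forall z, tau <= z <= tau' -> norm (dlt v' tau z) <= eps).
  { intros z Hz. unfold dlt. rewrite (Ew z) by lra. rewrite (E' tau) by lra. fold x0.
    eapply Rle_trans.
    { apply (norm_minus_eq _ (minus (w z) (stp (z - tau) x0)) (cnv (fB v') tau z)). vec. }
    pose proof (norm_minus_tri (w z) x0 (stp (z - tau) x0)) as Q3.
    rewrite (norm_minus_sym x0) in Q3.
    destruct (hst (z - tau)) as [_ Q1]; [unfold tau' in *; lra|].
    assert (Q2 : norm (cnv (fB v') tau z) <= Q * h).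
    { eapply Rle_trans; [apply (conv_bound S omega HS _ tau z (b1 + eps)); auto; try lra|].
      - intros y' Hy'. apply FBb. lra.
      - pose proof (gro_le_K (z - tau) ltac:(unfold tau' in *; lra)). pose proof (gw_pos omega (z - tau)).
        apply Rmult_le_compat; [apply Rmult_le_pos; lra|lra| |unfold tau' in *; lra].
        apply Rle_trans with (K * (b1 + eps)); [apply Rmult_le_compat_r; lra|unfold Q; lra]. }
    specialize (Wx z Hz). vlra. }
  exists (mk_state tau' v' (fun z => N z \/ z = tau')). split; [|split]; [| |simpl; unfold tau'; lra].
  2:{ split; [simpl; lra|split; [simpl; auto|split; [simpl; auto|]]]. simpl.
      intros z [Hz|Hz] Hz'; auto. exfalso. unfold tau' in Hz. lra. }
  assert (Hds : forall n m, N n -> n <= m -> m <= tau -> dlt v' n m = dlt v n m).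
  { intros n m Hn Hnm Hm. specialize (HNi n Hn). apply dlt_ext; auto; [lra|]. intros x Hx. apply E'. lra. }
  constructor; simpl.
  - unfold tau'. lra.
  - exact Cv'.
  - intros x Hx. rewrite E' by lra. auto.
  - exact Ef.
  - intros x Hx. destruct (Rle_dec x tau) as [Hle|Hle]; [rewrite E' by auto; apply HDv; lra|].
    destruct (Req_dec x tau') as [->|Hne]; [rewrite Ey; exact Dy|].
    rewrite Ew by lra. apply WD. lra.
  (* The distance 1 is recovered as [/ 4] for the path, [/ 2] for the old error at [tau] by
     [approx_near], and [/ 4] for the motion of [u]. *)
  - intros x Hx. destruct (Rle_dec x tau) as [Hle|Hle]; [rewrite E' by auto; apply Hcl; lra|].
    rewrite Ew by lra. specialize (Wx x ltac:(lra)). specialize (Hnear tau ltac:(lra)). fold x0 in Hnear.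
    assert (Q1 : norm (minus (u x) (u tau)) < / 4).
    { apply Pg. rewrite Rabs_right; unfold tau' in *; lra. }
    eapply Rle_trans.
    { apply (norm_plus3 _ (minus (w x) x0) (minus x0 (u tau)) (minus (u tau) (u x))). vec. }
    rewrite (norm_minus_sym (u tau)). vlra.
  - now left.
  - now right.
  - intros z [Hz| ->]; [specialize (HNi z Hz); lra|lra].
  - intros n m [Hn|Hn] [Hm|Hm] Hnm.
    + pose proof (HNi m Hm). rewrite Hds by (auto; lra). now apply Hnode.
    + subst m. specialize (HNi n Hn) as Hn'.
      rewrite (dlt_cocycle v' n tau tau') by (auto; lra).
      eapply Rle_trans; [apply (norm_plus2 _ (dlt v' tau tau') (stp (tau' - tau) (dlt v' n tau))); reflexivity|].
      rewrite (Hds n tau) by (auto; lra). specialize (Hnode n tau Hn HNt ltac:(lra)).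
      replace (tau' - tau) with h by (unfold tau'; ring).
      assert (Q1 : norm (stp h (dlt v n tau)) <= gro h * (eps * gro (tau - n) * (tau - n))).
      { eapply Rle_trans; [apply (St_norm S omega HS h); lra|]. apply Rmult_le_compat_l; [lra|auto]. }
      (* The weight is multiplicative: transporting the old bound by [h] produces exactly the weight
         wanted for the longer interval, and only the lengths add. *)
      assert (Eg : gro (tau' - n) = gro h * gro (tau - n)).
      { rewrite <- gw_plus. f_equal. unfold tau'. ring. }
      rewrite Eg. pose proof (gw_ge_1 omega (tau - n) ltac:(lra)) as Hg1.
      assert (Q2 : eps * gro h * h <= eps * (gro h * gro (tau - n)) * h).
      { apply Rmult_le_compat_r; [lra|]. apply Rmult_le_compat_l; [lra|].
        rewrite <- (Rmult_1_r (gro h)) at 1. apply Rmult_le_compat_l; lra. }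
      replace (tau' - n) with (h + (tau - n)) by (unfold tau'; ring).
      vlra.
    + subst n. specialize (HNi m Hm). unfold tau' in *. lra.
    + subst n m. rewrite dlt_diag. rewrite Rminus_diag, Rmult_0_r.
      right. exact norm_zero.
  - intros t Ht. destruct (Rle_dec t tau) as [Hle|Hle].
    + destruct (Hbt t ltac:(lra)) as [n [m [Nn [Nm [Hnm [Hno [H1 H2]]]]]]].
      pose proof (HNi m Nm) as Hm. pose proof (HNi n Nn) as Hn.
      exists n, m. split; [auto|split; [auto|split; [auto|split]]].
      * intros z [Hz| ->]; [auto|right; lra].
      * rewrite !E' by lra. split; auto. rewrite Hds by (auto; lra). auto.
    + exists tau, tau'. split; [now left|split; [now right|split; [lra|split]]].
      * intros z [Hz| ->]; [left; apply HNi; auto|right; lra].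
      * split; [|apply Dlt2; lra]. rewrite Ey, (Ew t), (E' tau) by lra. fold x0.
        replace (tau' - tau) with h by (unfold tau'; ring). apply Wx. lra.
Qed.

Lemma extends_refl (s : state) : extends s s.
Proof. split; [lra|]. auto. Qed.

Lemma extends_trans (s s' s'' : state) : extends s s' -> extends s' s'' -> extends s s''.
Proof.
  intros [A1 [A2 [A3 A4]]] [B1 [B2 [B3 B4]]]. split; [lra|split; [|split]].
  - intros x Hx. rewrite B2 by lra. auto.
  - auto.
  - intros q Hq Hle. apply A4; auto. apply B4; auto. lra.
Qed.

(** The constant does not depend on the state: the defect contributes at most 1 since [eps] is
    small, and the convolution at most [M]. *)
Lemma node_transport (s : state) (n m : R) : approx s -> s_N s n -> s_N s m -> n <= m ->
  norm (minus (s_v s m) (stp (m - n) (s_v s n))) <= K * (M + 1) * (m - n).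
Proof.
  intros A Hn Hm Hnm. pose proof K_ge_1 as HK1. pose proof eps_le_1 as He1.
  pose proof (ap_node s A n m Hn Hm Hnm) as H1.
  pose proof (ap_Nin s A n Hn) as In1. pose proof (ap_Nin s A m Hm) as In2.
  pose proof (ap_tau s A) as Htau.
  pose proof (gro_le_K (m - n) ltac:(lra)) as Hg. pose proof (gw_pos omega (m - n)) as Hg0.
  assert (H2 : norm (cnv (fB (s_v s)) n m) <= gro (m - n) * M * (m - n)).
  { apply (conv_bound S omega HS); auto.
    - apply fB_cont. apply (ap_cont s A).
    - intros y Hy. apply (approx_fB_bound s A). lra. }
  eapply Rle_trans; [apply (norm_plus2 _ (dlt (s_v s) n m) (cnv (fB (s_v s)) n m)); unfold dlt; vec|].
  apply Rle_trans with (gro (m - n) * (M + 1) * (m - n)).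
  - assert (eps * gro (m - n) * (m - n) <= 1 * gro (m - n) * (m - n)).
    { apply Rmult_le_compat_r; [lra|]. apply Rmult_le_compat_r; lra. }
    lra.
  - apply Rmult_le_compat_r; [lra|]. apply Rmult_le_compat_r; lra.
Qed.

Lemma approx_chain_limit (sq : nat -> state) :
  (forall n, approx (sq n)) -> (forall n, extends (sq n) (sq (Datatypes.S n))) ->
  exists s, approx s /\ forall n, extends (sq n) s.
Proof.
  intros A E1. pose proof K_ge_1 as HK1.
  assert (E : forall n m, (n <= m)%nat -> extends (sq n) (sq m)).
  { intros n m Hnm. induction Hnm as [|m Hnm IH]; [apply extends_refl|].
    now apply extends_trans with (sq m). }
  set (tn := fun n => s_tau (sq n)). set (vn := fun n => s_v (sq n)).
  assert (Tmono : forall n m, (n <= m)%nat -> tn n <= tn m) by (intros; now apply E).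
  assert (Tin : forall n, t0 <= tn n <= t1) by (intros; apply (ap_tau _ (A n))).
  assert (Veq : forall n m x, (n <= m)%nat -> x <= tn n -> vn m x = vn n x).
  { intros n m x Hnm. now apply E. }
  destruct (completeness (fun x => exists n, x = tn n)) as [ts [Hts1 Hts2]].
  { exists t1. intros x [n ->]. apply Tin. }
  { exists (tn O), O. auto. }
  assert (Tle : forall n, tn n <= ts) by (intros n; apply Hts1; exists n; auto).
  assert (Tst : t0 <= ts <= t1).
  { split; [pose proof (Tin O); pose proof (Tle O); lra|]. apply Hts2. intros x [n ->]. apply Tin. }
  assert (Tlim : forall e, 0 < e -> exists n, ts - e < tn n).
  { intros e He. apply NNPP. intros Hn. assert (ts <= ts - e); [|lra].
    apply Hts2. intros x [n ->]. destruct (Rle_dec (tn n) (ts - e)); auto.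
    exfalso. apply Hn. exists n. lra. }
  set (C := K * (M + 1)). assert (HC : 0 <= C) by (apply Rmult_le_pos; lra).
  assert (Cau : forall e, 0 < e -> exists k, forall m, (k <= m)%nat -> forall x,
    norm (minus (vn m x) (vn k x)) <= e).
  { intros e He. set (e1 := e / (16 * (Kh + 2))).
    assert (He1 : 0 < e1) by (apply Rdiv_lt_0_compat; lra).
    (* [k0] makes the linear transport error small and fixes the orbit of [x0]; only then can [k1]
       be chosen, from the continuity of this orbit. *)
    destruct (Tlim (e1 / (C + 1))) as [k0 Hk0]; [apply Rdiv_lt_0_compat; lra|].
    set (x0 := vn k0 (tn k0)).
    destruct (proj1 (continuous_eps (fun t => stp t x0) (ts - tn k0))
      (St_cont S omega HS x0 (ts - tn k0)) e1 He1) as [d1 [Hd1 P1]].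
    destruct (Heta_cont (e / 4) ltac:(lra)) as [d2 [Hd2 P2]].
    destruct (Tlim (Rmin d1 d2)) as [k1 Hk1]; [now apply Rmin_pos|].
    pose proof (Rmin_l d1 d2) as Hm1. pose proof (Rmin_r d1 d2) as Hm2.
    set (k := Nat.max k0 k1).
    assert (Kk0 : tn k0 <= tn k) by (apply Tmono; unfold k; lia).
    assert (Kk1 : tn k1 <= tn k) by (apply Tmono; unfold k; lia).
    exists k. intros m Hm x.
    assert (Hk0m : (k0 <= m)%nat) by (unfold k in Hm; lia).
    assert (HC1 : forall q, tn k0 <= q <= ts -> C * (q - tn k0) <= e1).
    { intros q Hq. apply Rle_trans with ((C + 1) * (e1 / (C + 1))).
      - apply Rmult_le_compat; lra.
      - right; field; lra. }
    assert (Osc1 : forall q, s_N (sq m) q -> tn k <= q -> norm (minus (vn m q) (stp (ts - tn k0) x0)) <= 2 * e1).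
    { intros q Nq Hq. pose proof (ap_Nin _ (A m) q Nq) as Hqi. fold (tn m) in Hqi. pose proof (Tle m).
      assert (Nk0 : s_N (sq m) (tn k0)) by (apply (E k0 m Hk0m); apply (ap_Ntau _ (A k0))).
      pose proof (node_transport (sq m) (tn k0) q (A m) Nk0 Nq ltac:(lra)) as Q1.
      fold (vn m) in Q1. rewrite (Veq k0 m (tn k0) Hk0m ltac:(lra)) in Q1. fold x0 in Q1. fold C in Q1.
      specialize (HC1 q ltac:(lra)).
      specialize (P1 (q - tn k0)).
      assert (Q2 : norm (minus (stp (q - tn k0) x0) (stp (ts - tn k0) x0)) < e1).
      { apply P1. replace (q - tn k0 - (ts - tn k0)) with (q - ts) by ring. apply Rabs_def1; lra. }
      eapply Rle_trans; [apply (norm_minus_tri _ (stp (q - tn k0) x0))|]. vlra. }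
    assert (Osc : forall q q', s_N (sq m) q -> tn k <= q -> s_N (sq m) q' -> tn k <= q' ->
      norm (minus (vn m q) (vn m q')) <= 4 * e1).
    { intros q q' H1 H2 H3 H4. pose proof (Osc1 q H1 H2) as Q1. pose proof (Osc1 q' H3 H4) as Q2.
      eapply Rle_trans; [apply (norm_minus_tri _ (stp (ts - tn k0) x0))|].
      rewrite (norm_minus_sym (stp (ts - tn k0) x0)). vlra. }
    assert (Main : forall y, tn k <= y <= tn m -> norm (minus (vn m y) (vn k (tn k))) <= e).
    { intros y Hy. rewrite <- (Veq k m (tn k) Hm ltac:(lra)).
      pose proof (Tin k) as Tk.
      destruct (ap_between _ (A m) y) as [n [n' [Nn [Nn' [Hnn [Hno [H1 _]]]]]]]; [fold (tn m); lra|].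
      fold (vn m) in H1.
      assert (Nk : s_N (sq m) (tn k)) by (apply (E k m Hm); apply (ap_Ntau _ (A k))).
      pose proof (ap_Nin _ (A m) n' Nn') as Hn'. fold (tn m) in Hn'. pose proof (Tle m) as Tm.
      (* The end [tn k] of the earlier stage is still a node and cannot lie strictly between the
         neighbours of [y]: either both neighbours are late nodes, or [y] is [tn k] itself. *)
      destruct (Hno (tn k) Nk) as [Hk|Hk].
      - pose proof (Osc n (tn k) Nn Hk Nk ltac:(lra)) as Q1.
        pose proof (Osc n' n Nn' ltac:(lra) Nn Hk) as Q2.
        pose proof (P2 (n' - n) ltac:(lra) ltac:(lra)) as Q3.
        assert (Q4 : Kh * norm (minus (vn m n') (vn m n)) <= Kh * (4 * e1)) by (apply Rmult_le_compat_l; vlra).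
        assert (Q5 : Kh * (4 * e1) + 4 * e1 <= e / 4).
        { replace (e / 4) with ((Kh + 2) * (4 * e1)) by (unfold e1; field; lra). lra. }
        eapply Rle_trans; [apply (norm_minus_tri _ (vn m n))|]. vlra.
      - replace y with (tn k) by lra. vcanon. rewrite norm_minus_diag. lra. }
    destruct (Rle_dec x (tn k)) as [Hx|Hx].
    - rewrite (Veq k m x Hm Hx). vcanon. rewrite norm_minus_diag. lra.
    - unfold vn at 2. rewrite (ap_frozen _ (A k) x) by (fold (tn k); lra). fold (vn k) (tn k).
      destruct (Rle_dec x (tn m)) as [Hxm|Hxm]; [apply Main; lra|].
      unfold vn at 1. rewrite (ap_frozen _ (A m) x) by (fold (tn m); lra). fold (vn m) (tn m).
      apply Main. split; [now apply Tmono|lra]. }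
  assert (Lim : forall x, exists l : X, filterlim (fun n => vn n x) eventually (locally l)).
  { intros x. apply cauchy_seq_lim. intros e He. destruct (Cau (e / 4) ltac:(lra)) as [k Hk].
    exists k. intros n m Hn Hm. pose proof (Hk n Hn x). pose proof (Hk m Hm x).
    eapply Rle_lt_trans; [apply (norm_minus_tri _ (vn k x))|]. rewrite (norm_minus_sym (vn k x)). vlra. }
  set (v := fun x => proj1_sig (constructive_indefinite_description _ (Lim x))).
  assert (Hv : forall x, filterlim (fun n => vn n x) eventually (locally (v x))).
  { intros x. exact (proj2_sig (constructive_indefinite_description _ (Lim x))). }
  assert (Unif : forall e, 0 < e -> exists k, forall m, (k <= m)%nat -> forall x,
    norm (minus (v x) (vn m x)) <= e).
  { intros e He. destruct (Cau (e / 4) ltac:(lra)) as [k Hk]. exists k. intros m Hm x.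
    destruct (proj1 (seq_lim_eps (fun n => vn n x) (v x)) (Hv x) (e / 2) ltac:(lra)) as [N HN].
    specialize (HN (Nat.max k N) ltac:(lia)).
    pose proof (Hk (Nat.max k N) ltac:(lia) x) as Q1. pose proof (Hk m Hm x) as Q2.
    eapply Rle_trans.
    { apply (norm_plus3 _ (minus (v x) (vn (Nat.max k N) x)) (minus (vn (Nat.max k N) x) (vn k x))
        (minus (vn k x) (vn m x))). vec. }
    rewrite (norm_minus_sym (v x)), (norm_minus_sym (vn k x)). vlra. }
  assert (Cv : forall x, continuous v x).
  { apply (continuous_uniform_limit v). intros e He. destruct (Unif e He) as [k Hk].
    exists (vn k). split; [apply (ap_cont _ (A k))|]. intros x. apply (Hk k (le_n k)). }
  assert (Ev : forall n x, x <= tn n -> v x = vn n x).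
  { intros n x Hx. apply norm_minus_small_eq. intros e He. destruct (Unif e He) as [k Hk].
    pose proof (Hk (Nat.max k n) ltac:(lia) x) as Q1.
    rewrite (Veq n (Nat.max k n) x ltac:(lia) Hx) in Q1. exact Q1. }
  assert (Ef : forall x, ts <= x -> v x = v ts).
  { intros x Hx. apply norm_minus_small_eq. intros e He. destruct (Unif (e / 2) ltac:(lra)) as [k Hk].
    pose proof (Hk k (le_n k) x) as Q1. pose proof (Hk k (le_n k) ts) as Q2. pose proof (Tle k) as Tk.
    assert (Q3 : vn k x = vn k ts).
    { unfold vn. rewrite (ap_frozen _ (A k) x), (ap_frozen _ (A k) ts) by (fold (tn k); lra). auto. }
    rewrite Q3 in Q1. eapply Rle_trans; [apply (norm_minus_tri _ (vn k ts))|].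
    rewrite (norm_minus_sym (vn k ts)). vlra. }
  assert (Tcov : forall x, x < ts -> exists n, x <= tn n).
  { intros x Hx. destruct (Tlim (ts - x) ltac:(lra)) as [n Hn]. exists n. lra. }
  assert (Vts : forall e, 0 < e -> exists k, forall m, (k <= m)%nat ->
    norm (minus (v ts) (v (tn m))) <= e /\ ts - tn m <= e).
  { intros e He. destruct (proj1 (continuous_eps v ts) (Cv ts) e He) as [d [Hd P]].
    destruct (Tlim (Rmin d e)) as [k Hk]; [now apply Rmin_pos|].
    pose proof (Rmin_l d e). pose proof (Rmin_r d e).
    exists k. intros m Hm. pose proof (Tmono k m Hm). pose proof (Tle m). split; [|lra].
    rewrite (norm_minus_sym (v ts)). left. apply P. apply Rabs_def1; lra. }
  set (N := fun q => (exists n, s_N (sq n) q) \/ q = ts).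
  assert (FBM : forall y, t0 <= y <= ts -> norm (fB v y) <= M).
  { intros y Hy. rewrite fB_eq by lra. apply (proj1 (HB y ltac:(lra))); [now apply isC_seg|].
    apply seg_norm_le. intros x Hx. apply le_epsilon. intros e He. destruct (Unif e He) as [k Hk].
    specialize (Hk k (le_n k) x). pose proof (approx_bound _ (A k) x ltac:(lra)) as Q. fold (vn k) in Q.
    pose proof (norm_le_minus (v x) (vn k x)). vlra. }
  assert (Dext : forall k n m, t0 <= n -> n <= m -> m <= tn k -> dlt v n m = dlt (vn k) n m).
  { intros k n m H0 H1 H2. apply dlt_ext; auto; [apply (ap_cont _ (A k))|lra|].
    intros x Hx. apply Ev. lra. }
  (* Continuity of the limit at [ts] makes the defect of the last gap vanish, so the node estimates
     up to [tn m] pass to the new node [ts]. *)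
  assert (Dts : forall e, 0 < e -> exists k, forall m, (k <= m)%nat -> norm (dlt v (tn m) ts) <= e).
  { intros e He. set (e1 := e / (4 * (K + K * M + 1))).
    assert (HKM : 0 <= K * M) by (apply Rmult_le_pos; lra).
    assert (He1 : 0 < e1) by (apply Rdiv_lt_0_compat; lra).
    destruct (St_near_0 S omega HS (v ts) e1 He1) as [d [Hd P]].
    destruct (Vts (Rmin e1 (d / 2))) as [k Hk]; [apply Rmin_pos; lra|].
    pose proof (Rmin_l e1 (d / 2)) as Hm1. pose proof (Rmin_r e1 (d / 2)) as Hm2.
    exists k. intros m Hm. destruct (Hk m Hm) as [Q1 Q2]. pose proof (Tle m) as Tm. pose proof (Tin m) as Tm'.
    specialize (P (ts - tn m) ltac:(lra)).
    assert (Q3 : norm (cnv (fB v) (tn m) ts) <= K * M * e1).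
    { eapply Rle_trans.
      - apply (conv_bound S omega HS _ (tn m) ts M); auto; [now apply fB_cont|].
        intros y Hy. apply FBM. lra.
      - pose proof (gro_le_K (ts - tn m) ltac:(lra)). pose proof (gw_pos omega (ts - tn m)).
        apply Rmult_le_compat; [apply Rmult_le_pos; lra|lra| |lra]. apply Rmult_le_compat_r; lra. }
    assert (Q4 : norm (minus (stp (ts - tn m) (v ts)) (stp (ts - tn m) (v (tn m)))) <= K * e1).
    { eapply Rle_trans; [apply (St_diff_norm S omega HS 1); lra|]. rewrite <- HK.
      apply Rmult_le_compat_l; vlra. }
    unfold dlt. eapply Rle_trans.
    { apply (norm_minus_eq _ (plus (minus (v ts) (stp (ts - tn m) (v ts)))
        (minus (stp (ts - tn m) (v ts)) (stp (ts - tn m) (v (tn m))))) (cnv (fB v) (tn m) ts)). vec. }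
    pose proof (norm_triangle (minus (v ts) (stp (ts - tn m) (v ts)))
        (minus (stp (ts - tn m) (v ts)) (stp (ts - tn m) (v (tn m))))) as Q5.
    rewrite (norm_minus_sym (v ts)) in Q5.
    assert (Q6 : e1 + K * e1 + K * M * e1 <= e).
    { replace e with ((K + K * M + 1) * (4 * e1)) by (unfold e1; field; lra).
      pose proof (Rmult_le_pos (K + K * M + 1) (3 * e1) ltac:(lra) ltac:(lra)). lra. }
    eapply Rle_trans; [apply Rplus_le_compat_r; exact Q5|]. vlra. }
  exists (mk_state ts v N). split.
  2:{ intros n. split; [apply Tle|split; [|split]]; simpl.
      - intros x Hx. now apply Ev.
      - intros q Hq. left. now exists n.
      - intros q [[j Hj]| ->] Hq.
        + destruct (le_lt_dec j n) as [Hjn|Hjn]; [now apply (E j n Hjn)|].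
          apply (E n j ltac:(lia)); auto.
        + fold (tn n) in Hq. pose proof (Tle n). replace ts with (tn n) by lra. apply (ap_Ntau _ (A n)). }
  constructor; simpl.
  - exact Tst.
  - exact Cv.
  - intros x Hx. rewrite (Ev O) by (pose proof (Tin O); lra). now apply (ap_hist _ (A O)).
  - exact Ef.
  - intros x Hx. destruct (Rle_lt_or_eq_dec _ _ (proj2 Hx)) as [Hlt| ->].
    + destruct (Tcov x Hlt) as [n Hn]. rewrite (Ev n x Hn). apply (ap_D _ (A n)). fold (tn n). lra.
    + apply (HD_closed tn (fun n => v (tn n))).
      * intros n. rewrite (Ev n) by lra. apply (ap_D _ (A n)). fold (tn n). pose proof (Tin n). lra.
      * apply (proj2 (seq_lim_eps (V := R_NormedModule) tn ts)). intros e He.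
        destruct (Tlim e He) as [k Hk]. exists k. intros m Hm.
        change (Rabs (tn m - ts) < e). pose proof (Tmono k m Hm). pose proof (Tle m). apply Rabs_def1; lra.
      * apply (proj2 (seq_lim_eps (fun n => v (tn n)) (v ts))). intros e He.
        destruct (Vts (e / 2) ltac:(lra)) as [k Hk]. exists k. intros m Hm. destruct (Hk m Hm) as [Q _].
        rewrite norm_minus_sym. vlra.
  - intros x Hx. destruct (Rle_lt_or_eq_dec _ _ (proj2 Hx)) as [Hlt| ->].
    + destruct (Tcov x Hlt) as [n Hn]. rewrite (Ev n x Hn). apply (ap_close _ (A n)). fold (tn n). lra.
    + apply le_epsilon. intros e He.
      destruct (proj1 (continuous_eps u ts) (proj1 Mu ts) (e / 2) ltac:(lra)) as [d [Hd P]].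
      destruct (Vts (Rmin (e / 2) (d / 2))) as [k Hk]; [apply Rmin_pos; lra|].
      pose proof (Rmin_l (e / 2) (d / 2)) as Hm1. pose proof (Rmin_r (e / 2) (d / 2)) as Hm2.
      destruct (Hk k (le_n k)) as [Q1 Q2]. pose proof (Tle k). pose proof (Tin k).
      specialize (P (tn k) ltac:(apply Rabs_def1; lra)).
      assert (Q3 : norm (minus (v (tn k)) (u (tn k))) <= 1).
      { rewrite (Ev k) by lra. apply (ap_close _ (A k)). fold (tn k). lra. }
      eapply Rle_trans.
      { apply (norm_plus3 _ (minus (v ts) (v (tn k))) (minus (v (tn k)) (u (tn k))) (minus (u (tn k)) (u ts))). vec. }
      vlra.
  - left. exists O. apply (ap_N0 _ (A O)).
  - now right.
  - intros q [[n Hn]| ->]; [|lra]. pose proof (ap_Nin _ (A n) q Hn) as Q. fold (tn n) in Q.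
    pose proof (Tle n). lra.
  - intros n m Hn Hm Hnm. destruct (Req_dec n m) as [->|Hne].
    { rewrite dlt_diag, Rminus_diag, Rmult_0_r. right. exact norm_zero. }
    destruct Hm as [[j Hj]|Hm].
    + destruct Hn as [[i Hi]|Hn].
      * set (k := Nat.max i j).
        assert (Nn : s_N (sq k) n) by (apply (E i k ltac:(unfold k; lia)); auto).
        assert (Nm : s_N (sq k) m) by (apply (E j k ltac:(unfold k; lia)); auto).
        pose proof (ap_Nin _ (A k) n Nn) as Q1. pose proof (ap_Nin _ (A k) m Nm) as Q2. fold (tn k) in Q1, Q2.
        rewrite (Dext k n m) by lra. now apply (ap_node _ (A k)).
      * exfalso. pose proof (ap_Nin _ (A j) m Hj) as Q2. fold (tn j) in Q2. pose proof (Tle j). lra.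
    + destruct Hn as [[i Hi]|Hn]; [|exfalso; lra]. subst m.
      apply le_epsilon. intros e He. destruct (Dts e He) as [k0 Hk0].
      set (k := Nat.max i k0). specialize (Hk0 k ltac:(unfold k; lia)).
      assert (Nn : s_N (sq k) n) by (apply (E i k ltac:(unfold k; lia)); auto).
      pose proof (ap_Nin _ (A k) n Nn) as Q1. fold (tn k) in Q1. pose proof (Tle k) as Tk.
      rewrite (dlt_cocycle v n (tn k) ts) by (auto; lra).
      eapply Rle_trans; [apply (norm_plus2 _ (dlt v (tn k) ts) (stp (ts - tn k) (dlt v n (tn k)))); reflexivity|].
      assert (Q2 : norm (stp (ts - tn k) (dlt v n (tn k))) <= eps * gro (ts - n) * (ts - n)).
      { eapply Rle_trans; [apply (St_norm S omega HS (ts - tn k)); lra|].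
        rewrite (Dext k n (tn k)) by lra.
        pose proof (ap_node _ (A k) n (tn k) Nn (ap_Ntau _ (A k)) ltac:(lra)) as Q3. fold (vn k) in Q3.
        replace (gro (ts - n)) with (gro (ts - tn k) * gro (tn k - n)) by (rewrite <- gw_plus; f_equal; ring).
        pose proof (gw_pos omega (ts - tn k)). pose proof (gw_pos omega (tn k - n)).
        eapply Rle_trans; [apply Rmult_le_compat_l; [lra|exact Q3]|].
        replace (gro (ts - tn k) * (eps * gro (tn k - n) * (tn k - n)))
          with (eps * (gro (ts - tn k) * gro (tn k - n)) * (tn k - n)) by ring.
        apply Rmult_le_compat_l; [|lra]. repeat apply Rmult_le_pos; lra. }
      vlra.
  - intros t Ht. destruct (Rle_lt_or_eq_dec _ _ (proj2 Ht)) as [Hlt| ->].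
    + destruct (Tcov t Hlt) as [k Hk].
      destruct (ap_between _ (A k) t) as [n [m [Nn [Nm [Hnm [Hno [H1 H2]]]]]]]; [fold (tn k); lra|].
      pose proof (ap_Nin _ (A k) n Nn) as Q1. pose proof (ap_Nin _ (A k) m Nm) as Q2. fold (tn k) in Q1, Q2.
      exists n, m. split; [left; eauto|split; [left; eauto|split; [auto|split]]].
      * intros q [[j Hj]| ->]; [|right; pose proof (Tle k); lra].
        destruct (le_lt_dec j k) as [Hjk|Hjk].
        -- apply Hno. now apply (E j k Hjk).
        -- destruct (Rle_dec q (tn k)) as [Hq|Hq]; [|right; lra].
           apply Hno. apply (E k j ltac:(lia)); auto.
      * rewrite !(Ev k) by lra. split; [exact H1|]. rewrite (Dext k n t) by lra. exact H2.
    (* The limit node is its own neighbour on both sides, which is where [etab 0 = 0] enters. *)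
    + exists ts, ts. split; [now right|split; [now right|split; [lra|split]]].
      * intros q [[j Hj]| ->]; [|left; lra]. left.
        pose proof (ap_Nin _ (A j) q Hj) as Q. fold (tn j) in Q. pose proof (Tle j). lra.
      * rewrite Rminus_diag, Heta0, dlt_diag. vcanon. rewrite norm_minus_diag. split; [lra|].
        eapply Rle_trans; [right; exact norm_zero|lra].
Qed.

(** The principle of maximality starts from the state whose only node is [t0]; a state that reaches
    [t1] exists because short states extend strictly and chains have upper bounds. *)
Lemma approximate_solution : exists v : R -> X, forall t, t0 <= t <= t1 ->
  D t (v t) /\ norm (minus (v t) (u t)) <= 2 * ((1 + K * K) * eps).
Proof.
  pose proof (proj1 Mu) as Cu.
  set (s0 := mk_state t0 (fun x => if Rle_dec x t0 then u x else u t0) (fun q => q = t0)).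
  assert (E0 : forall x, x <= t0 -> s_v s0 x = u x).
  { intros x Hx. simpl. destruct (Rle_dec x t0); [auto|lra]. }
  assert (Ef : forall x, t0 <= x -> s_v s0 x = u t0).
  { intros x Hx. simpl. destruct (Rle_dec x t0); [f_equal; lra|auto]. }
  assert (A0 : approx s0).
  { constructor.
    - simpl; lra.
    - refine (continuous_glue u (fun _ => u t0) t0 Cu _ eq_refl). intros; apply continuous_const.
    - exact E0.
    - intros x Hx. rewrite (Ef x), (Ef (s_tau s0)) by (simpl in *; lra). reflexivity.
    - intros x Hx. simpl in Hx. rewrite E0 by lra. now apply Du.
    - intros x Hx. simpl in Hx. rewrite E0 by lra. vcanon. rewrite norm_minus_diag. lra.
    - reflexivity.
    - reflexivity.
    - intros q Hq. simpl in *. lra.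
    - intros n m Hn Hm _. simpl in Hn, Hm. subst n m. rewrite dlt_diag, Rminus_diag, Rmult_0_r.
      right. exact norm_zero.
    - intros t Ht. simpl in Ht. replace t with t0 by lra. exists t0, t0.
      split; [reflexivity|split; [reflexivity|split; [lra|split; [intros q Hq; simpl in Hq; lra|]]]].
      rewrite Rminus_diag, Heta0, dlt_diag. vcanon. rewrite norm_minus_diag. split; [lra|].
      eapply Rle_trans; [right; exact norm_zero|lra]. }
  destruct (brezis_browder approx extends s_tau t1 extends_refl extends_trans) with (s0 := s0)
    as [s [A [_ Hs]]]; auto.
  - intros s s' H. apply H.
  - intros s A. apply (ap_tau s A).
  - intros s A Hlt. now apply approx_extend.
  - apply approx_chain_limit.
  - exists (s_v s). intros t Ht. split.
    + apply (ap_D s A). lra.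
    + apply (approx_near s A). lra.
Qed.
End LocalInvariance.

(** At each fixed [t], values of approximations with smaller and smaller error lie in the slice of
    [D] at [t] and tend to [u t]; the closedness of [D] concludes. The interval is fixed before the
    error. *)
Lemma local_invariance (u : R -> X) (t0 T : R) : a <= t0 -> t0 < T -> mild u t0 T ->
  (forall x, t0 - r <= x <= t0 -> D x (u x)) ->
  exists t1, t0 < t1 <= T /\ forall t, t0 <= t <= t1 -> D t (u t).
Proof.
  intros Ha HT Mu Du.
  destruct (cont_on_bounded u (t0 - r) T (continuous_cont_on u _ _ (fun x _ => proj1 Mu x))) as [R2 [HR2 Bu]].
  set (R1 := R2 + 1 + (T - a)).
  destruct (HBl R1 ltac:(unfold R1; lra)) as [L [M [eta0 [HL [HM [Heta HB]]]]]].
  destruct (small_step_exists (gro 1) L eta0 (gw_pos _ _) HL Heta) as [sg [S1 [S2 [S3 S4]]]].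
  set (t1 := Rmin T (t0 + sg)).
  assert (T1 : t0 < t1) by (apply Rmin_glb_lt; lra).
  assert (T2 : t1 <= T) by apply Rmin_l.
  assert (T3 : t1 <= t0 + sg) by apply Rmin_r.
  (* The modulus is controlled only on the half-open [[0, b - a)]; the extra 1 puts every length
     that occurs inside it. *)
  destruct (HD_conn (t1 + 1) ltac:(lra)) as [Kh [etab [HKh [He1 [He2 [He3 [He4 He5]]]]]]].
  exists t1. split; [lra|]. intros t Ht.
  pose proof (gw_pos omega 1) as HK0.
  set (cc := 2 * (1 + gro 1 * gro 1)).
  assert (Hcc : 2 <= cc).
  { unfold cc. pose proof (Rmult_le_pos (gro 1) (gro 1) ltac:(lra) ltac:(lra)). lra. }
  assert (Key : forall e, 0 < e -> e <= / 2 -> exists x, D t x /\ norm (minus x (u t)) <= e).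
  { intros e He Hle.
    assert (He' : 0 < e / cc) by (apply Rdiv_lt_0_compat; lra).
    assert (Hcce : 2 * ((1 + gro 1 * gro 1) * (e / cc)) = e).
    { fold cc. replace (2 * ((1 + gro 1 * gro 1) * (e / cc))) with (cc * (e / cc)) by (unfold cc; ring). field. lra. }
    destruct (approximate_solution t0 t1 R1 L M eta0 Kh (gro 1) (e / cc) etab u) as [v Hv]; auto; try lra.
    - unfold R1; lra.
    - eapply Rle_trans; [|exact S4]. apply Rmult_le_compat_l; [|lra]. apply Rmult_le_pos; lra.
    - now apply (mild_sub u t0 T).
    - intros x Hx. specialize (Bu x ltac:(lra)). unfold R1. vlra.
    - intros e' He''. destruct (He4 0 ltac:(lra) e' He'') as [d [Hd P]]. exists d; split; auto.
      intros s' Hs Hs'. specialize (P s' Hs). rewrite Rminus_0_r, He2, Rminus_0_r in P.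
      specialize (P ltac:(rewrite Rabs_right; lra)). eapply Rle_lt_trans; [apply Rle_abs|exact P].
    - destruct (Hv t Ht) as [Q1 Q2]. rewrite Hcce in Q2. exists (v t). auto. }
  destruct (nat_choice (fun n x => D t x /\ norm (minus x (u t)) <= / 2 * (/ 2) ^ n)) as [xn Hxn].
  { intros n. apply Key.
    - apply Rmult_lt_0_compat; [lra|apply pow_lt; lra].
    - assert ((/ 2) ^ n <= 1) by (apply (pow_half_le 0); lia). lra. }
  apply (HD_closed (fun _ => t) xn).
  - intros n. apply Hxn.
  - apply filterlim_const.
  - apply (proj2 (seq_lim_eps xn (u t))). intros e He.
    destruct (pow_half_small (/ 2) e He) as [N HN]. exists N. intros n Hn.
    destruct (Hxn n) as [_ Q]. eapply Rle_lt_trans; [exact Q|].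
    eapply Rle_lt_trans; [|exact HN]. apply Rmult_le_compat_l; [lra|now apply pow_half_le].
Qed.

(** Continuation in time: the set of good times contains its supremum by closedness, and
    [local_invariance] moves past it. The whole history is carried along, since the subtangential
    condition applies to histories lying in [D]. *)
Lemma invariance (u : R -> X) (T : R) : a <= T -> mild u a T ->
  (forall x, a - r <= x <= a -> D x (u x)) ->
  forall t, a - r <= t <= T -> D t (u t).
Proof.
  intros HT Mu Du.
  set (E := fun s => a <= s <= T /\ forall x, a - r <= x <= s -> D x (u x)).
  destruct (completeness E) as [ts [H1 H2]].
  { exists T. intros s [Hs _]. lra. }
  { exists a. split; [lra|auto]. }
  assert (Ha : a <= ts) by (apply H1; split; [lra|auto]).
  assert (HtT : ts <= T) by (apply H2; intros s [Hs _]; lra).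
  assert (Hlt : forall x, a - r <= x < ts -> D x (u x)).
  { intros x Hx. apply NNPP. intros Hn. assert (ts <= x); [|lra].
    apply H2. intros s [Hs Hs']. destruct (Rle_dec s x) as [Hle|Hle]; auto.
    exfalso. apply Hn. apply Hs'. lra. }
  assert (Hts : D ts (u ts)).
  { destruct (Req_dec ts a) as [->|Hne]; [apply Du; lra|].
    set (xn := fun n : nat => ts - (ts - a) * (/ 2) ^ n).
    assert (Hx : forall e, 0 < e -> exists N, forall n, (N <= n)%nat -> Rabs (xn n - ts) < e).
    { intros e He. destruct (pow_half_small (ts - a) e He) as [N HN]. exists N. intros n Hn.
      unfold xn. replace (ts - (ts - a) * (/ 2) ^ n - ts) with (- ((ts - a) * (/ 2) ^ n)) by ring.
      rewrite Rabs_Ropp. assert (Hp : 0 < (/ 2) ^ n) by (apply pow_lt; lra).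
      rewrite Rabs_right by (apply Rle_ge; apply Rmult_le_pos; lra).
      eapply Rle_lt_trans; [|exact HN]. apply Rmult_le_compat_l; [lra|now apply pow_half_le]. }
    apply (HD_closed xn (fun n => u (xn n))).
    - intros n. assert (Hp : 0 < (/ 2) ^ n) by (apply pow_lt; lra).
      assert (Hp1 : (/ 2) ^ n <= 1) by (apply (pow_half_le 0); lia).
      assert (0 < (ts - a) * (/ 2) ^ n) by (apply Rmult_lt_0_compat; lra).
      assert ((ts - a) * (/ 2) ^ n <= (ts - a) * 1) by (apply Rmult_le_compat_l; lra).
      apply Hlt. unfold xn. lra.
    - apply (proj2 (seq_lim_eps (V := R_NormedModule) xn ts)). exact Hx.
    - apply (proj2 (seq_lim_eps (fun n => u (xn n)) (u ts))). intros e He.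
      destruct (proj1 (continuous_eps u ts) (proj1 Mu ts) e He) as [d [Hd P]].
      destruct (Hx d Hd) as [N HN]. exists N. intros n Hn. apply P. auto. }
  assert (Hle : forall x, a - r <= x <= ts -> D x (u x)).
  { intros x Hx. destruct (Req_dec x ts) as [->|Hne]; auto. apply Hlt. lra. }
  destruct (Rle_lt_or_eq_dec _ _ HtT) as [Hc|Hc]; [|rewrite <- Hc; exact Hle].
  exfalso. destruct (local_invariance u ts T Ha Hc) as [t1 [Ht1 Hd]].
  - apply (mild_shift u a); [lra|exact Mu].
  - intros x Hx. apply Hle. lra.
  - assert (t1 <= ts); [|lra]. apply H1. split; [lra|]. intros x Hx.
    destruct (Rle_dec x ts); [apply Hle; lra|apply Hd; lra].
Qed.
End Invariance.
End Mild.

Theorem theorem5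
  (X : CompleteNormedModule R_AbsRing) (r a omega : R)
  (S : R -> X -> X)                                   (* S t = e^{-At} *)
  (p : R -> X -> X) (G : R -> X -> X -> X)
  (g gc : R -> R -> (R -> X) -> R)                    (* g(theta,t,phi), g_c(theta,t,phi) *)
  (eta h : nat -> R -> (R -> X) -> R)                 (* eta_k(t,phi), h_k(t,phi) *)
  (M_Vg L_Vgc : R) (eta_ign : R -> R)
  (D : R -> X -> Prop) (DB : R -> (R -> X) -> Prop)
  (Lp C1 C2 : R)
  (* standing assumptions *)
  (Hr : 0 < r)
  (HS : compact_C0_semigroup S omega)
  (* (A1) *)
  (HA1 : forall t phi, isC r phi -> variation_le (fun theta => g theta t phi) (- r) 0 M_Vg)
  (* decomposition g = g_d + g_c: g_c continuous part, g_d jump part *)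
  (Hgc_cont : forall t phi, isC r phi -> cont_on (fun theta => gc theta t phi) (- r) 0)
  (Hgd : forall t phi, isC r phi ->
     is_jump_part r (fun theta => g theta t phi - gc theta t phi)
       (fun k => eta k t phi) (fun k => h k t phi))
  (* (A2) *)
  (HA2 : forall theta, - r <= theta <= 0 -> contRC r (gc theta))
  (* (A3) *)
  (HA3_eta_cont : forall k, contRC r (eta k))
  (HA3_h_cont : forall k, contRC r (h k))
  (HA3_eta_range : forall k t phi, isC r phi -> 0 <= eta k t phi <= r)
  (HA3_abs : forall t phi, isC r phi -> ex_series (fun k => Rabs (h k t phi)))
  (HA3_unif : forall Rb, 0 < Rb -> forall eps, 0 < eps -> exists N : nat,
     forall t phi, isC r phi -> Rabs t <= Rb -> normC r phi <= Rb ->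
       forall n m : nat, (N <= n)%nat ->
         @sumX R_AbelianMonoid (fun k => Rabs (h (n + k)%nat t phi)) m <= eps)
  (* (A4) *)
  (HA4_L : 0 <= L_Vgc)
  (HA4 : forall t1 t2 phi psi, a <= t1 -> a <= t2 -> isC r phi -> isC r psi ->
     variation_le (fun theta => gc theta t1 phi - gc theta t2 psi) (- r) 0
       (L_Vgc * (Rabs (t1 - t2) + normC r (diffC phi psi))))
  (* (A5) *)
  (HA5_cont : forall T, a <= T -> cont_on eta_ign a T)
  (HA5_pos : forall t, a <= t -> 0 < eta_ign t)
  (HA5 : forall t phi1 phi2, a <= t -> isC r phi1 -> isC r phi2 ->
     (forall theta, - r <= theta <= - eta_ign t -> phi1 theta = phi2 theta) ->
     forall k, eta k t phi1 = eta k t phi2 /\ h k t phi1 = h k t phi2)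
  (* (H1) *)
  (HH1_dom : forall t x, D t x -> a - r <= t)
  (HH1_closed : forall (tn : nat -> R) (xn : nat -> X) t x,
     (forall n, D (tn n) (xn n)) ->
     filterlim tn eventually (locally t) -> filterlim xn eventually (locally x) -> D t x)
  (HH1_ne : forall t, a - r <= t -> exists x, D t x)
  (* (H2) *)
  (HH2 : forall t, a <= t -> exists phi, calD D a r t phi)
  (* (H3) *)
  (HH3 : forall b, a < b -> exists (Khat : R) (eta_b : R -> R),
     0 < Khat /\
     (forall s, 0 <= s < b - a -> 0 <= eta_b s) /\ eta_b 0 = 0 /\
     (forall s1 s2, 0 <= s1 <= s2 -> s2 < b - a -> eta_b s1 <= eta_b s2) /\
     (forall s, 0 <= s < b - a -> forall eps, 0 < eps -> exists delta, 0 < delta /\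
        forall s', 0 <= s' < b - a -> Rabs (s' - s) < delta -> Rabs (eta_b s' - eta_b s) < eps) /\
     (forall t1 t2 x1 x2, a <= t1 -> t1 < t2 -> t2 <= b -> D t1 x1 -> D t2 x2 ->
        exists w : R -> X, cont_on w t1 t2 /\ w t1 = x1 /\ w t2 = x2 /\
          (forall t, t1 < t < t2 -> D t (w t)) /\
          (forall s t, t1 <= s <= t2 -> t1 <= t <= t2 ->
             norm (minus (w t) (w s)) <=
               eta_b (Rabs (t - s)) + Khat * Rabs (t - s) * (norm (minus x2 x1) / (t2 - t1)))))
  (* (H4) *)
  (HH4_incl : forall t phi, calD D a r t phi -> DB t phi)
  (HH4_dom : forall t phi, DB t phi -> a <= t /\ isC r phi)
  (HH4_cont : forall t phi, DB t phi -> forall eps, 0 < eps -> exists delta, 0 < delta /\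
     forall s psi, DB s psi -> Rabs (s - t) < delta -> normC r (diffC psi phi) < delta ->
       norm (minus (Bfun r G p g s psi) (Bfun r G p g t phi)) < eps)
  (* subtangential condition *)
  (Hsubtan : forall t phi, calD D a r t phi ->
     filterlim
       (fun hh => / hh * distD (D (t + hh))
          (plus (S hh (phi 0)) (RInt (fun s => S (t + hh - s) (Bfun r G p g t phi)) t (t + hh))))
       (at_right 0) (locally 0))
  (* hypotheses on p *)
  (Hp_L : 0 <= Lp) (Hp_C1 : 0 <= C1) (Hp_C2 : 0 <= C2)
  (Hp_lip : forall t s u v, norm (minus (p t u) (p s v)) <= Lp * (Rabs (s - t) + norm (minus u v)))
  (Hp_growth : forall s u, norm (p s u) <= C1 * norm u + C2)
  (* hypotheses on G *)
  (HG : forall R0, 0 < R0 -> exists (LG : R) (nu : R -> R), 0 < LG /\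
     (forall T, 0 <= T -> cont_on nu 0 T) /\ (forall s, 0 <= s -> 0 <= nu s) /\ nu 0 = 0 /\
     (forall t1 t2 u1 u2 v1 v2,
        norm u1 <= R0 -> norm u2 <= R0 -> norm v1 <= R0 -> norm v2 <= R0 ->
        a <= t1 <= a + R0 -> a <= t2 <= a + R0 ->
        norm (minus (G t1 u1 v1) (G t2 u2 v2)) <=
          nu (Rabs (t1 - t2)) + LG * (norm (minus u1 u2) + norm (minus v1 v2)))) :
  forall phi : R -> X, isC r phi ->
    exists (b : Rbar) (u : R -> X),
      Rbar_lt (Finite a) b /\
      mild_sol_ab S (Bfun r G p g) r a b phi u /\
      (forall v, mild_sol_ab S (Bfun r G p g) r a b phi v ->
         forall t, a - r <= t -> Rbar_lt (Finite t) b -> v t = u t) /\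
      (calD D a r a phi ->
         (forall t, a <= t -> Rbar_lt (Finite t) b -> D t (u t)) /\
         (forall bf : R, b = Finite bf ->
            forall M, exists delta, 0 < delta /\
              forall t, a <= t -> bf - delta < t < bf -> M <= normC r (seg u t))).
Proof.
  intros phi Hphi.
  assert (HBc := Bfun_cont X r a p G g gc eta h M_Vg L_Vgc Lp C1 C2 Hr HA1 Hgd
    HA3_eta_cont HA3_h_cont HA3_eta_range HA3_abs HA3_unif HA4_L HA4 Hp_L Hp_C1 Hp_C2
    Hp_lip Hp_growth HG).
  assert (HBl := Bfun_bounded_lip X r a p G g gc eta h M_Vg L_Vgc eta_ign Lp C1 C2 Hr HA1 Hgd
    HA3_eta_range HA3_abs HA3_unif HA4_L HA4 HA5_cont HA5_pos HA5 Hp_L Hp_C1 Hp_C2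
    Hp_lip Hp_growth HG).
  destruct (maximal_solution S omega HS r a Hr (Bfun r G p g) HBc HBl phi Hphi)
    as [b [u [Hab [Hsol Hblow]]]].
  exists b, u. split; [exact Hab|split; [|split]].
  - intros T HT HTb. destruct (Hsol T HT HTb) as [uT [HuT E]].
    exact (sol_mild_sol_on S omega HS r a Hr (Bfun r G p g) HBc phi T u uT HT HuT E).
  - intros v Hv t Hta Htb.
    (* [t] may lie in the initial interval, where a solution must still be taken on an interval
       ending no earlier than [a]. *)
    assert (HT : a <= Rmax a t) by apply Rmax_l.
    assert (HTb : Rbar_lt (Finite (Rmax a t)) b) by (apply Rmax_case; auto).
    destruct (Hsol _ HT HTb) as [uT [HuT E]].
    pose proof (mild_sol_on_sol S r a Hr (Bfun r G p g) HBc phi _ v (Hv _ HT HTb)) as Hv'.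
    rewrite (E t) by apply Rmax_r.
    rewrite <- (sol_unique S omega HS r a Hr (Bfun r G p g) HBc HBl phi _ _ _ Hv' HuT t (Rmax_r a t)).
    rewrite clamp_id; [reflexivity|]. split; [exact Hta|apply Rmax_r].
  - intros [_ [_ HD0]]. split; [|exact Hblow].
    intros t Ht Htb. destruct (Hsol t Ht Htb) as [uT [[Mu Eu] E]]. rewrite (E t) by lra.
    apply (invariance S omega HS r a Hr (Bfun r G p g) HBc HBl D HH1_closed HH1_ne HH3 Hsubtan uT t Ht Mu);
      [|lra].
    intros x Hx. rewrite Eu by lra. replace x with (a + (x - a)) by ring.
    rewrite hist_at by lra. apply HD0. lra.
Qed.
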